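(* Let $N\ge 0$ be an integer. If $E\subset\mathbb{T}$ is measurable and $I\subset\mathbb{T}$ is a circle interval (arc) with $|I|=|E|$, then $$\lambda_{\max}\big(T_E^{(N)}\big)\le\lambda_{\max}\big(T_I^{(N)}\big).$$
   Context: $\mathbb{T}=\mathbb{R}/(2\pi\mathbb{Z})$ with angular measure $dt$, so $|\mathbb{T}|=2\pi$. $\mathcal{A}_N=\operatorname{span}_{\mathbb{C}}\{1,e^{it},\ldots,e^{iNt}\}$, and $P_N$ is the orthogonal projection of $L^2(\mathbb{T})$ onto $\mathcal{A}_N$. For measurable $E\subset\mathbb{T}$, $M_E$ is multiplication by the indicator function $\mathbf{1}_E$ and $T_E^{(N)}=P_NM_EP_N|_{\mathcal{A}_N}$. Its largest eigenvalue is $$\lambda_{\max}(T_E^{(N)})=\sup_{0\ne p\in\mathcal{A}_N}\frac{\int_E|p(t)|^2\,dt}{\int_{\mathbb{T}}|p(t)|^2\,dt}.$$ *)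

(* Defs.v *)
From mathcomp Require Import all_boot all_order all_algebra.
From mathcomp Require Import all_classical all_reals all_analysis.
From mathcomp Require Export complex.
Set Implicit Arguments.
Unset Strict Implicit.
Unset Printing Implicit Defensive.
Import Order.TTheory GRing.Theory Num.Theory.
Local Open Scope classical_set_scope.
Local Open Scope ring_scope.
Local Open Scope complex_scope.

(* A subset of the circle R/(2 pi Z) is encoded by its preimage in R, and a
   function on the circle by its 2pi-periodic lift; measures and integrals over
   the circle are taken over the fundamental domain [0, 2 pi[. *)
Section circle.
Context {R : realType}.
Implicit Types (E I : set R) (N : nat) (f g p q : R -> R[i]).

Definition circle_set E := forall t : R, E (t + 2 * pi) <-> E t.

(* Lebesgue (not merely Borel) measurability: this is the sigma-algebra of
   [completed_lebesgue_measure]. *)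
Definition lebesgue_measurable E :=
  ((wlength (@idfun R))^*)%mu.-cara.-measurable E.

Definition circle_measure E : \bar R :=
  completed_lebesgue_measure (E `&` `[0, 2 * pi[).

(* The image of an interval of R under R -> R/(2 pi Z); degenerate arcs and the
   whole circle are allowed. *)
Definition circle_arc I := exists i : interval R,
  I = [set t | exists k : int, t + k%:~R * (2 * pi) \in i].

Definition circle_integral f : R[i] :=
  Rintegral completed_lebesgue_measure `[0, 2 * pi[ (fun t => complex.Re (f t))
  +i* Rintegral completed_lebesgue_measure `[0, 2 * pi[
        (fun t => complex.Im (f t)).

Definition inner f g : R[i] := circle_integral (fun t => f t * (g t)^*).

Definition expi (x : R) : R[i] := cos x +i* sin x.

Definition A_ N : set (R -> R[i]) :=
  [set p | exists c : 'I_N.+1 -> R[i],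
     p = fun t => \sum_(k < N.+1) c k * expi (k%:R * t)].

(* For f in L^2, the unique g in A_ N with f - g orthogonal to A_ N; elements of
   A_ N are continuous, so uniqueness holds pointwise and not only a.e. *)
Definition P_ N f : R -> R[i] :=
  xget (fun=> 0) [set g | A_ N g /\ forall q, A_ N q -> inner (f \- g) q = 0].

Definition M_ E f : R -> R[i] := fun t => (\1_E t)%:C * f t.

Definition T_ N E p : R -> R[i] := P_ N (M_ E (P_ N p)).

Definition is_eigenvalue N (T : (R -> R[i]) -> (R -> R[i])) (z : R[i]) :=
  exists p, [/\ A_ N p, p <> (fun=> 0) & T p = fun t => z * p t].

(* [T_ N E] is self-adjoint on the (N+1)-dimensional space A_ N, so its
   eigenvalues are real and form a finite nonempty set, whose [sup] is its
   maximum. *)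
Definition lambda_max N E : R :=
  sup [set l : R | is_eigenvalue N (T_ N E) l%:C].

End circle.

(* Main.v *)
(* Let M be the best constant for a single arc of length |E|. Approximating E from
   cell to cell, it is enough to bound the integral of |p|^2 over every union of
   finitely many disjoint arcs of total length |E| by M times the mass of p. Take a
   maximiser among the unions of m arcs. If an arc is degenerate or two arcs touch,
   there are really fewer arcs and induction applies. Otherwise let z_i be the
   endpoints and s_i = 1 or -1 according to the side. The first variation in the
   endpoints shows that |p(z_i)| is independent of i for every extremal p; this yields
   a self-reciprocal extremal p that does not vanish off the unit circle. Since the
   endpoints of both signs alternate, sum_i s_i / (z_i - x) has a zero x, and none on
   the circle (there it is an alternating sum of cotangents). Moving the endpoints with
   the complex velocities 1 / (z_i - x), and p accordingly, gives a null direction of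
   the second variation, which is semidefinite; this forces the velocities to be equal,
   a contradiction. *)
Require Import Defs.
From mathcomp Require Import all_boot all_order all_algebra.
From mathcomp Require Import all_classical all_reals all_analysis.
From mathcomp Require Import ring lra zify.
Set Implicit Arguments.
Unset Strict Implicit.
Unset Printing Implicit Defensive.
Import Order.TTheory GRing.Theory Num.Theory.
Local Open Scope ring_scope.

(** On the unit circle |p|^2 is z^(-N) p(z) (crecip N p)(z). Writing conjugation as [crecip] makes
    arc integrals, endpoint values and derivatives linear in one polynomial, so that a point x off
    the circle can enter the formulas; for a self-reciprocal p the product is just p * p. The
    obstacle is to find an explicit null direction of the second variation. Real velocities that
    keep the total length offer none; a complex direction does, and it is admissible because its
    real and imaginary parts are. The equation sum_i s_i / (z_i - x) = 0 is used twice: it is the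
    length constraint on v_i = 1 / (z_i - x), and since (1 - |x|^2) / |z - x|^2 is the Poisson
    kernel 1 + 2 Re (x / (z - x)), it also gives sum_i s_i |v_i|^2 = 0, which is all that remains of
    the second variation along this direction. Two exceptions are treated apart: a single arc, for
    which the equation has no solution x, and N = 0, where the derivative of p vanishes. *)

(** The difference would have the roots 1, 2, 3, ... in a number exceeding its degree. Reciprocals
    are evaluated through x^-1, so identities between them are checked away from 0. *)
Lemma poly_eq_nonzero (C : numDomainType) (p q : {poly C}) :
  (forall x, x != 0 -> p.[x] = q.[x]) -> p = q.
Proof.
move=> pq; apply/eqP; rewrite -subr_eq0; apply/negPn/negP => nz.
pose rs := [seq i.+1%:R : C | i <- iota 0 (size (p - q))].
suff: (size rs < size (p - q)%R)%N by rewrite size_map size_iota ltnn.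
apply: max_poly_roots nz _ _.
  apply/allP => _ /mapP[i _ ->].
  by rewrite /root hornerD hornerN pq ?subrr // pnatr_eq0.
rewrite map_inj_uniq ?iota_uniq // => i j /eqP.
by rewrite eqr_nat => /eqP[].
Qed.

Lemma size_polyM_leS (C : nzSemiRingType) n m (p q : {poly C}) :
  (size p <= n.+1)%N -> (size q <= m.+1)%N -> (size (p * q)%R <= (n + m).+1)%N.
Proof.
move=> sp sq; apply: leq_trans (size_polyMleq _ _) _.
by rewrite -subn1 leq_subLR add1n -addSn -addnS leq_add.
Qed.

(** * Conjugate-reciprocal polynomials and differentiation along the circle *)

Section ConjugateReciprocal.
Variable C : numClosedFieldType.
Implicit Types (p q r : {poly C}) (n m : nat) (x : C).

(* The trigonometric polynomial z^(-n/2) p(z) is conjugated on the unit circle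
   when p is replaced by crecip n p. *)
Definition crecip n p : {poly C} := \poly_(k < n.+1) (p`_(n - k))^*.

Lemma size_crecip n p : (size (crecip n p) <= n.+1)%N.
Proof. exact: size_poly. Qed.

Lemma coef_crecip n p k : (crecip n p)`_k = if (k < n.+1)%N then (p`_(n - k))^* else 0.
Proof. by rewrite coef_poly. Qed.

(** The value at x comes from the value at the mirror point of x in the unit circle, so nonzero
    roots of [p] reflect to roots of [crecip n p]. *)
Lemma horner_crecip n p x : (size p <= n.+1)%N -> x != 0 ->
  (crecip n p).[x] = x ^+ n * (p.[(x^-1)^*])^*.
Proof.
move=> sp x0; rewrite horner_poly (horner_coef_wide _ sp) rmorph_sum mulr_sumr.
rewrite (reindex_inj rev_ord_inj) /=; apply: eq_bigr => i _.
rewrite !subSS subKn ?leq_ord // rmorphM rmorphXn /= conjCK mulrCA; congr (_ * _).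
by rewrite exprVn -exprB ?unitfE ?leq_ord.
Qed.

Lemma crecipK n p : (size p <= n.+1)%N -> crecip n (crecip n p) = p.
Proof.
move=> sp; apply/polyP => k; rewrite !coef_crecip.
case: ltnP => [kn|nk]; last by rewrite nth_default // (leq_trans sp).
by rewrite ltnS leq_subr subKn ?conjCK.
Qed.

Lemma crecipD n p q : crecip n (p + q) = crecip n p + crecip n q.
Proof.
apply/polyP => k; rewrite coefD !coef_crecip; case: ltnP => _; last by rewrite addr0.
by rewrite coefD rmorphD.
Qed.

Lemma crecipZ n (a : C) p : crecip n (a *: p) = a^* *: crecip n p.
Proof.
apply/polyP => k; rewrite coefZ !coef_crecip; case: ltnP => _; last by rewrite mulr0.
by rewrite coefZ rmorphM.
Qed.

Lemma crecipM n m p q : (size p <= n.+1)%N -> (size q <= m.+1)%N ->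
  crecip (n + m) (p * q) = crecip n p * crecip m q.
Proof.
move=> sp sq; apply: poly_eq_nonzero => x x0.
rewrite hornerM !horner_crecip //; first by rewrite hornerM rmorphM exprD /=; ring.
exact: size_polyM_leS.
Qed.

Lemma crecip_linear a : crecip 1 ('X - a%:P) = 1 - a^* *: 'X.
Proof.
apply: poly_eq_nonzero => x x0; rewrite horner_crecip ?size_XsubC // !hornerE /=.
by rewrite rmorphB /= conjCK expr1 mulrBr divff // mulrC.
Qed.

End ConjugateReciprocal.

Section TrigDerivative.
Variable C : numClosedFieldType.
Implicit Types (p q : {poly C}) (n m : nat).

(* If z = exp(i t), then z^(-n/2) (tder n p)(z) is the derivative in t of
   z^(-n/2) p(z). *)
Definition tder n p : {poly C} := 'i *: ('X * p^`() - (n%:R / 2) *: p).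

(** The normalising factors z^(-n/2) and z^(-m/2) multiply, so the product rule adds the indices. *)
Lemma tderM n m p q : tder (n + m) (p * q) = tder n p * q + p * tder m q.
Proof.
rewrite /tder derivM natrD mulrDl scalerDl -!scalerAl -!scalerAr -scalerDr.
congr (_ *: _); rewrite !mulrBl !mulrBr -!scalerAl -!scalerAr; ring.
Qed.

Lemma coef_tder n p k : (tder n p)`_k = 'i * (k%:R - n%:R / 2) * p`_k.
Proof.
rewrite coefZ coefB coefXM coefZ coef_deriv -mulrA mulrBl; congr (_ * (_ - _)).
by case: k => [|k] /=; rewrite ?mul0r // mulr_natl.
Qed.

Lemma size_tder n p : (size (tder n p) <= size p)%N.
Proof.
by apply/leq_sizeP => j pj; rewrite coef_tder nth_default ?mulr0.
Qed.

(** A factor contributes Re (x / (x - r)) = 1/2 + (|x|^2 - 1) / (2 |x - r|^2), because |r| = 1. The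
    last sum is positive as soon as there is a root; hence off the circle x P'(x) / P(x) cannot be
    half the number of roots. *)
Lemma log_derivative_real_part (rs : seq C) (x : C) :
  (forall r, r \in rs -> `|r| = 1) -> `|x| != 1 ->
  let P := \prod_(r <- rs) ('X - r%:P) in
  'Re (x * P^`().[x] / P.[x]) =
    (size rs)%:R / 2 + (`|x| ^+ 2 - 1) / 2 * \sum_(r <- rs) `|x - r| ^- 2.
Proof.
move=> rs1 x1 P; rewrite {}/P; elim: rs rs1 => [|r rs IH] rs1 /=.
  by rewrite !big_nil mulr0 addr0 mul0r -polyC1 derivC horner0 mulr0 mul0r raddf0.
have r1 : `|r| = 1 by apply: rs1; rewrite mem_head.
have {}IH := IH (fun a ars => rs1 a (@mem_behead _ (r :: rs) a ars)).
have rx : x - r != 0.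
  by rewrite subr_eq0; apply: contraNneq x1 => ->; rewrite r1.
have Px : (\prod_(a <- rs) ('X - a%:P)).[x] != 0.
  rewrite horner_prod prodf_seq_neq0; apply/allP => a ars /=.
  rewrite !hornerE subr_eq0; apply: contraNneq x1 => ->.
  by rewrite rs1 ?inE ?ars ?orbT.
rewrite !big_cons derivM derivXsubC mul1r hornerD !hornerM.
rewrite mulrDr mulrDl !hornerXsubC.
have -> : x * (\prod_(a <- rs) ('X - a%:P)).[x] /
    ((x - r) * (\prod_(a <- rs) ('X - a%:P)).[x]) = x / (x - r).
  by field; rewrite rx Px.
have -> : x * ((x - r) * ((\prod_(a <- rs) ('X - a%:P))^`()).[x]) /
    ((x - r) * (\prod_(a <- rs) ('X - a%:P)).[x]) =
    x * ((\prod_(a <- rs) ('X - a%:P))^`()).[x] / (\prod_(a <- rs) ('X - a%:P)).[x].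
  by field; rewrite rx Px.
rewrite raddfD /= IH.
have -> : 'Re (x / (x - r)) = 1 / 2 + (`|x| ^+ 2 - 1) / 2 * `|x - r| ^- 2.
  rewrite ReE rmorphM fmorphV /= !normCK !rmorphB /=.
  have crx : x^* - r^* != 0 by rewrite -rmorphB conjC_eq0.
  have r0 : r != 0 by rewrite -normr_eq0 r1 oner_eq0.
  have rr : r^* = r^-1 by apply: (mulfI r0); rewrite -normCK r1 expr1n divff.
  move: crx; rewrite rr => crx.
  field; rewrite r0 rx andbT /=; apply: contraNneq crx => H.
  by rewrite -(mulfK r0 (x^*)) (subr0_eq H) mul1r subrr.
rewrite -natr1; set S := \sum_(_ <- _) _.
by field; rewrite normr_eq0 rx.
Qed.

End TrigDerivative.

(** For velocities that move only the nodes [i] and [j]: with [f] constant the sum is 0, so the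
    total length is kept. *)
Lemma sum_two_point_weights (F : fieldType) (T : finType) (s f : T -> F) i j :
  (forall k, s k != 0) ->
  \sum_k s k * ((s k)^-1 * ((k == i)%:R - (k == j)%:R)) * f k = f i - f j.
Proof.
move=> s0; transitivity (\sum_k (k == i)%:R * f k - \sum_k (k == j)%:R * f k).
  by rewrite -sumrB; apply: eq_bigr => k _; rewrite mulVKf // mulrBl.
have sumE l : \sum_k (k == l)%:R * f k = f l.
  by rewrite (bigD1 l) //= eqxx mul1r big1 ?addr0 // => k /negPf->; rewrite mul0r.
by rewrite !sumE.
Qed.

Lemma quadratic_le0_eq0 (C : numClosedFieldType) (b Y : C) : 0 <= b -> Y \is Num.real ->
  (forall e, 0 < e -> (2 * e) * b + e ^+ 2 * b * Y <= 0) -> b = 0.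
Proof.
move=> b0 Yr H; apply/eqP/negPn/negP => bn.
have bp : 0 < b by rewrite lt_def bn.
have Y1 : 0 < 1 + `|Y| by rewrite ltr_pwDl ?ltr01.
(* This step size makes the left side a positive multiple of 2 + |Y| + (|Y| + Y), which cannot be
   nonpositive. *)
have := H (1 + `|Y|)^-1; rewrite invr_gt0 Y1 => /(_ isT).
have -> : 2 * (1 + `|Y|)^-1 * b + (1 + `|Y|)^-1 ^+ 2 * b * Y =
   (b * (1 + `|Y|)^-2) * (2 + `|Y| + (`|Y| + Y)) by field; rewrite gt_eqF.
rewrite pmulr_rle0 ?mulr_gt0 ?exprn_gt0 ?invr_gt0 ?exprn_gt0//.
have YY : 0 <= `|Y| + Y by have := real_lerNnormlW Yr (lexx `|Y|); rewrite -subr_ge0 opprK addrC.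
by rewrite lt_geF // ltr_wpDr // ltr_wpDr // ltr0n.
Qed.

(** * The second variation of an extremal configuration *)

Section SecondVariation.
Variables (C : numClosedFieldType) (N : nat) (T : finType) (s z : T -> C).
Variable J : {poly C} -> C.

(** The Laurent polynomial z^(-n) g(z) at x; on the circle |p|^2 is the case [g := p * crecip N p],
    [n := N]. *)
Definition lau n (x : C) (g : {poly C}) : C := x ^- n * g.[x].

(** The kernel of the sesquilinear form J (p * crecip N q): the involution [crecip N] turns an
    arbitrary [r] into an arbitrary [q]. *)
Definition in_kernel (p : {poly C}) :=
  (size p <= N.+1)%N /\ forall r : {poly C}, (size r <= N.+1)%N -> J (p * r) = 0.

(* Half the second derivative of J (p * p) when the nodes move along the circle
   with velocities v and the self-reciprocal p moves in the direction q. *)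
Definition hessian (p q : {poly C}) (v : T -> C) : C :=
  2^-1 * \sum_i s i * v i ^+ 2 * lau N (z i) (tder (N + N) (p * p)) +
  2 * \sum_i s i * v i * lau N (z i) (p * q) + J (q * q).

(** What is used about a maximal configuration with endpoints [z] and signs [s]. The model for [J]
    is the integral over the arcs minus the maximal ratio times the mean value: [J_tder] is then the
    fundamental theorem of calculus, [J_le0] maximality with the arcs fixed, and the two variations
    concern moving endpoints. *)
Hypotheses (z_unit : forall i, `|z i| = 1) (z_inj : injective z).
Hypotheses (s_real : forall i, s i \is Num.real) (s_neq0 : forall i, s i != 0).
Hypothesis sum_s : \sum_i s i = 0.
Hypothesis JD : forall p q, J (p + q) = J p + J q.
Hypothesis JZ : forall a p, J (a *: p) = a * J p.
Hypothesis J_tder : forall g : {poly C}, (size g <= (N + N).+1)%N ->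
  J (tder (N + N) g) = \sum_i s i * lau N (z i) g.
Hypothesis J_crecip : forall g : {poly C}, (size g <= (N + N).+1)%N ->
  J (crecip (N + N) g) = (J g)^*.
Hypothesis J_le0 : forall p : {poly C}, (size p <= N.+1)%N -> J (p * crecip N p) <= 0.
Hypothesis first_variation : forall p, in_kernel p ->
  forall i j, `|p.[z i]| = `|p.[z j]|.
Hypothesis second_variation : forall (p q : {poly C}) v,
  in_kernel p -> crecip N p = p -> (size q <= N.+1)%N -> crecip N q = q ->
  (forall i, v i \is Num.real) -> \sum_i s i * v i = 0 -> hessian p q v <= 0.

Implicit Types (p q r : {poly C}).

Let z_neq0 i : z i != 0.
Proof. by rewrite -normr_eq0 z_unit oner_eq0. Qed.

Lemma lauM_crecip (p q : {poly C}) i : (size q <= N.+1)%N ->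
  lau N (z i) (p * crecip N q) = p.[z i] * (q.[z i])^*.
Proof.
move=> sq; rewrite /lau hornerM horner_crecip //.
rewrite (_ : ((z i)^-1)^* = z i); last first.
  by rewrite fmorphV /=; apply: (mulIf (invr_neq0 (z_neq0 i))); rewrite -invfM mulrC -normCK z_unit expr1n invr1 divff.
by rewrite mulrCA (mulrA (_ ^- _)) mulVf ?mul1r // expf_neq0.
Qed.

Lemma kernelD p q : in_kernel p -> in_kernel q -> in_kernel (p + q).
Proof.
move=> [sp Jp] [sq Jq]; split; first by rewrite (leq_trans (size_polyD _ _)) // geq_max sp.
by move=> r sr; rewrite mulrDl JD Jp ?Jq ?addr0.
Qed.

Lemma kernelZ a p : in_kernel p -> in_kernel (a *: p).
Proof.
move=> [sp Jp]; split; first exact: leq_trans (size_scale_leq _ _) _.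
by move=> r sr; rewrite -scalerAl JZ Jp ?mulr0.
Qed.

Lemma kernel_crecip p : in_kernel p -> in_kernel (crecip N p).
Proof.
move=> [sp Jp]; split=> [|r sr]; first exact: size_crecip.
rewrite -(crecipK sr) -crecipM ?size_crecip // J_crecip ?size_polyM_leS ?size_crecip //.
by rewrite Jp ?conjC0 ?size_crecip.
Qed.

(** The Cauchy-Schwarz argument for a semidefinite form: were the pairing with some [q] nonzero, a
    small multiple of [q] added to [p] would make the form positive. *)
Lemma kernel_of_isotropic p : (size p <= N.+1)%N -> J (p * crecip N p) = 0 ->
  in_kernel p.
Proof.
move=> sp Jp; split => // r sr; rewrite -(crecipK sr).
set q := crecip N r; have sq : (size q <= N.+1)%N by exact: size_crecip.
apply/eqP; rewrite -normr_eq0 -sqrf_eq0; apply/eqP.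
have Jqp : J (q * crecip N p) = (J (p * crecip N q))^*.
  rewrite -J_crecip ?size_polyM_leS ?size_crecip // crecipM ?size_crecip //.
  by rewrite crecipK // mulrC.
apply: (@quadratic_le0_eq0 _ _ (J (q * crecip N q))); first by rewrite exprn_ge0.
  by apply: ler0_real; exact: J_le0.
(* The factor [J (p * crecip N q)] aligns the phases, so that the linear term becomes 2 e |J (p *
   crecip N q)|^2. *)
move=> e e0; have := J_le0 (p := p + (e * J (p * crecip N q)) *: q) _.
rewrite (leq_trans (size_polyD _ _)) ?geq_max ?sp ?(leq_trans (size_scale_leq _ _)) //.
move=> /(_ isT); rewrite crecipD crecipZ mulrDl !mulrDr -!scalerAl -!scalerAr.
rewrite !JD !JZ Jp Jqp normCK rmorphM /= (CrealP (ger0_real (ltW e0))).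
by congr (_ <= _); ring.
Qed.

(** Integration by parts: the endpoint terms vanish, and the derivative passes to [r], which stays
    of degree at most N. *)
Lemma kernel_tder p : in_kernel p -> (forall i, p.[z i] = 0) ->
  in_kernel (tder N p).
Proof.
move=> [sp Jp] pz; split=> [|r sr]; first exact: leq_trans (size_tder _ _) _.
have := J_tder (size_polyM_leS sp sr); rewrite tderM JD [X in _ + X]Jp ?addr0; last first.
  exact: leq_trans (size_tder _ _) _.
by move=> ->; rewrite big1 // => i _; rewrite /lau hornerM pz mul0r !mulr0.
Qed.

(** By the first variation a kernel element that vanishes at one node vanishes at all of them. If
    all did, the kernel would be stable under [tder N], and induction on the size would leave only
    monomials, which have no zero on the circle. The element found is then symmetrised. *)
Lemma kernel_nonvanishing i0 : (exists2 p : {poly C}, p != 0 & in_kernel p) ->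
  exists p, [/\ in_kernel p, crecip N p = p & p.[z i0] != 0].
Proof.
move=> [p1 p1n Kp1].
have [p Kp pz] : exists2 p, in_kernel p & p.[z i0] != 0.
  have [//|Kz] := boolp.pselect (exists2 p, in_kernel p & p.[z i0] != 0).
  have {}Kz p : in_kernel p -> forall i, p.[z i] = 0.
    move=> Kp i; have p0 : p.[z i0] = 0.
      by apply/eqP/negPn/negP => pn; apply: Kz; exists p.
    by apply/eqP; rewrite -normr_eq0 (first_variation Kp i i0) p0 normr0.
  suff H n p : in_kernel p -> (size p <= n)%N -> p = 0.
    by move/eqP: p1n => []; exact: H Kp1 (leqnn _).
  elim: n p => [|n IH] p Kp; first by rewrite leqn0 size_poly_eq0 => /eqP.
  move=> sp; have [->//|pn] := eqVneq p 0.
  have sp0 : (0 < size p)%N by rewrite size_poly_gt0.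
  (* cancels the leading coefficient of p *)
  pose d : C := 'i * ((size p).-1%:R - N%:R / 2).
  have q0 : tder N p + (- d) *: p = 0.
    apply: IH; first by apply: kernelD; [exact: kernel_tder (Kz _ Kp)|exact: kernelZ].
    apply/leq_sizeP => j nj; rewrite coefD coef_tder coefZ.
    have [pj|jp] := leqP (size p) j; first by rewrite nth_default // !mulr0 addr0.
    have -> : j = (size p).-1 by lia.
    by rewrite mulNr subrr.
  (* [tder N] is diagonal on monomials with distinct eigenvalues, so an eigenvector is a
     monomial. *)
  have pE : p = lead_coef p *: 'X^((size p).-1).
    apply/polyP => j; rewrite coefZ coefXn.
    have := congr1 (fun q : {poly C} => q`_j) q0.
    rewrite coefD coef_tder coefZ coef0 /d => H.
    have {H} : 'i * (j%:R - (size p).-1%:R) * p`_j = 0 by apply: etrans H; ring.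
    case: eqP => [->|jn] H; first by rewrite mulr1.
    move/eqP: H; rewrite !mulf_eq0 (negPf (neq0Ci _)) subr_eq0 eqr_nat mulr0.
    by case: eqP => //= _ /eqP.
  have := Kz _ Kp i0; rewrite pE hornerZ hornerXn => /eqP.
  by rewrite mulf_eq0 lead_coef_eq0 (negPf pn) expf_eq0 (negPf (z_neq0 _)) andbF.
have [sp _] := Kp.
(* p + crecip N p and 'i (p - crecip N p) are both self-reciprocal, and they cannot both vanish at
   z_0 where p does not. *)
have [H|H] := eqVneq ((p + crecip N p).[z i0]) 0; last first.
  exists (p + crecip N p); split=> //; first exact: kernelD (kernel_crecip _).
  by rewrite crecipD crecipK // addrC.
exists ('i *: (p + (-1) *: crecip N p)); split.
- by apply/kernelZ/kernelD/kernelZ/kernel_crecip.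
- rewrite crecipZ crecipD crecipZ crecipK // conjCi rmorphN1.
  by rewrite !scalerDr !scalerA !mulrN1 opprK addrC.
have -> : crecip N p = (p + crecip N p) - p by rewrite addrC addKr.
rewrite hornerZ hornerD hornerZ hornerD H hornerN sub0r mulf_neq0 ?neq0Ci //.
by rewrite mulrN mulN1r opprK -mulr2n mulrn_eq0.
Qed.

(* If p vanishes at x off the circle, then p (X - z_0) / (X - x) is again in the
   kernel; it vanishes at z_0, hence at every node, and so does p. *)
Lemma kernel_roots_unit p i0 i1 x : i0 != i1 -> in_kernel p -> crecip N p = p ->
  p.[z i0] != 0 -> p.[x] = 0 -> `|x| = 1.
Proof.
move=> i01 Kp pp pz px; have [sp Jp] := Kp.
have p0 : p != 0 by apply: contraNneq pz => ->; rewrite horner0.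
apply/eqP/negPn/negP => x1.
have /factor_theorem[h ph] : root p x by apply/eqP.
have h0 : h != 0 by apply: contraNneq p0 => h0; rewrite ph h0 mul0r.
have sh : (size h < N.+1)%N.
  by rewrite (leq_trans _ sp) // ph size_Mmonic ?monicXsubC // size_XsubC addn2.
have N0 : (0 < N)%N by move: h0; rewrite -size_poly_gt0; lia.
have shN : (size h <= N.-1.+1)%N by lia.
have crecip_h a : crecip N (h * ('X - a%:P)) = crecip N.-1 h * (1 - a^* *: 'X).
  by rewrite -{1}(prednK N0) -addn1 crecipM ?size_XsubC // crecip_linear.
(* Self-reciprocity pairs the root x with its mirror point, which is a different point since |x| is
   not 1; this second root lies in [h]. *)
have hx : (crecip N.-1 h).[x] = 0.
  have : p.[x] = (crecip N.-1 h).[x] * (1 - `|x| ^+ 2).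
    by rewrite -{1}pp ph crecip_h hornerM !hornerE normCK [_^* * _]mulrC.
  rewrite px => /esym/eqP; rewrite mulf_eq0 subr_eq0 [1 == _]eq_sym.
  by rewrite sqrp_eq1 ?normr_ge0 // (negPf x1) orbF => /eqP.
pose q := h * ('X - (z i0)%:P).
have sq : (size q <= N.+1)%N.
  by rewrite size_Mmonic ?monicXsubC // size_XsubC addn2.
have /factor_theorem[k qk] : root (crecip N q) x.
  by apply/eqP; rewrite crecip_h hornerM hx mul0r.
(* [crecip N q] contains the factor X - x; moved over to [q] it restores [p], so [q] is
   isotropic. *)
have Kq : in_kernel q.
  apply: kernel_of_isotropic => //.
  have -> : q * crecip N q = p * (k * ('X - (z i0)%:P)) by rewrite qk /q {1}ph; ring.
  apply: Jp.
  have [->|k0] := eqVneq k 0; first by rewrite mul0r size_poly0.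
  have := size_crecip N q; rewrite qk !size_Mmonic ?monicXsubC // !size_XsubC.
  by [].
have qz : q.[z i1] = 0.
  apply/eqP; rewrite -normr_eq0 (first_variation Kq i1 i0) hornerM hornerXsubC.
  by rewrite subrr mulr0 normr0.
move: qz => /eqP; rewrite hornerM hornerXsubC mulf_eq0 subr_eq0 (inj_eq z_inj).
rewrite [i1 == _]eq_sym (negPf i01) orbF => /eqP hz.
move/eqP: pz; apply; apply/eqP; rewrite -normr_eq0 (first_variation Kp i0 i1).
by rewrite ph hornerM hz mul0r normr0.
Qed.

(** All roots of [p] lie on the circle. In particular [p] does not vanish at 0, so by
    self-reciprocity it has degree exactly N. A zero x of [tder N p] would mean x p'(x) / p(x) = N /
    2, with the ordinary derivative, against [log_derivative_real_part]. *)
Lemma kernel_tder_neq0 p i0 i1 x : (0 < N)%N -> i0 != i1 -> in_kernel p ->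
  crecip N p = p -> p.[z i0] != 0 -> `|x| != 1 -> (tder N p).[x] != 0.
Proof.
move=> N0 i01 Kp pp pz x1; have [sp _] := Kp.
have rootp y : p.[y] = 0 -> `|y| = 1 by exact: kernel_roots_unit i01 Kp pp pz.
have p0 : p != 0 by apply: contraNneq pz => ->; rewrite horner0.
have [rs pE] := closed_field_poly_normal p.
set P := \prod_(a <- rs) ('X - a%:P) in pE.
have lp : lead_coef p != 0 by rewrite lead_coef_eq0.
have rs1 a : a \in rs -> `|a| = 1.
  move=> ars; apply: rootp; rewrite pE hornerZ horner_prod.
  by rewrite (big_rem a) //= hornerXsubC subrr mul0r mulr0.
have sN : size rs = N.
  have sP : size p = (size rs).+1 by rewrite pE size_scale // size_prod_XsubC.
  have pN : p`_N != 0.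
    rewrite -pp coef_crecip ltnSn subnn conjC_eq0 -horner_coef0.
    by apply/eqP => /rootp/eqP; rewrite normr0 eq_sym oner_eq0.
  apply/eqP; rewrite -eqSS -sP eqn_leq sp /=.
  by case: ltnP => // /(nth_default 0) H; rewrite H eqxx in pN.
have Px : P.[x] != 0.
  apply/eqP => H; move/eqP: x1; apply; apply: rootp.
  by rewrite pE hornerZ H mulr0.
apply/eqP => H; have := log_derivative_real_part rs1 x1.
rewrite /= -/P.
have -> : x * (P^`()).[x] / P.[x] = N%:R / 2.
  move/eqP: H; rewrite pE /tder derivZ !hornerE mulf_eq0 (negPf (neq0Ci _)) /=.
  rewrite subr_eq0 !(mulrAC _ (lead_coef p)) (inj_eq (mulIf lp)) => /eqP ->.
  by rewrite mulfK.
rewrite sN (Creal_ReP _ _) ?rpred_div ?realn // -[LHS]addr0 => /addrI /esym/eqP.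
rewrite !mulf_eq0 subr_eq0 invr_eq0 pnatr_eq0 orbF.
rewrite sqrp_eq1 ?normr_ge0 // (negPf x1) /=.
apply/negP; rewrite gt_eqF //; case: rs sN rs1 {pE P Px} => [|a rs] /=; first by lia.
move=> _ rs1; rewrite big_cons ltr_pwDl //; last first.
  by apply: sumr_ge0 => i _; rewrite invr_ge0 exprn_ge0.
rewrite invr_gt0 exprn_gt0 // normr_gt0 subr_eq0.
by apply: contraNneq x1 => ->; rewrite rs1 ?mem_head.
Qed.

Let lauD i p q : lau N (z i) (p + q) = lau N (z i) p + lau N (z i) q.
Proof. by rewrite /lau hornerD mulrDr. Qed.

Let lauZ i a p : lau N (z i) (a *: p) = a * lau N (z i) p.
Proof. by rewrite /lau hornerZ mulrCA. Qed.

(* A zero of the semidefinite hessian is orthogonal to every (w, 0). *)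
Let hessian_null p q v w : in_kernel p -> crecip N p = p ->
  (size q <= N.+1)%N -> crecip N q = q ->
  (forall i, v i \is Num.real) -> \sum_i s i * v i = 0 ->
  (forall i, w i \is Num.real) -> \sum_i s i * w i = 0 ->
  hessian p q v = 0 ->
  \sum_i s i * w i * (2^-1 * v i * lau N (z i) (tder (N + N) (p * p)) +
    lau N (z i) (p * q)) = 0.
Proof.
move=> Kp pp sq qq vr sv wr sw H0; set X := \sum_i _.
pose Y := 2^-1 * \sum_i s i * w i ^+ 2 * lau N (z i) (tder (N + N) (p * p)).
(* Along v + t w the hessian is quadratic in t, nonpositive, and 0 at t = 0; X is half its linear
   coefficient. *)
have Ht t : t \is Num.real -> (2 * t) * X + t ^+ 2 * Y <= 0.
  move=> tr; have := @second_variation p q (fun i => v i + t * w i) Kp pp sq qq.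
  have -> : hessian p q (fun i => v i + t * w i) = hessian p q v + ((2 * t) * X + t ^+ 2 * Y).
    rewrite /hessian /X /Y !mulr_sumr [RHS]addrC addrA; congr (_ + _).
    by rewrite -!big_split /=; apply: eq_bigr => i _; field.
  rewrite H0 add0r; apply.
    by move=> i; rewrite rpredD // rpredM.
  under eq_bigr do rewrite mulrDr mulrCA.
  by rewrite big_split /= sv -mulr_sumr sw mulr0 addr0.
have H1 := Ht 1 (rpred1 _).
have H2 : (2 * -1) * X + (-1) ^+ 2 * Y <= 0 by apply: Ht; rewrite rpredN rpred1.
(* The values at t = 1 and t = -1 are real, being comparable with 0, and they determine X and Y. *)
have Xr : X \is Num.real.
  have -> : X = ((2 * 1 * X + 1 ^+ 2 * Y) - (2 * -1 * X + (-1) ^+ 2 * Y)) / 4 by field.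
  by rewrite rpred_div ?realn // rpredB // ler0_real.
have Yr : Y \is Num.real.
  have -> : Y = ((2 * 1 * X + 1 ^+ 2 * Y) + (2 * -1 * X + (-1) ^+ 2 * Y)) / 2 by field.
  by rewrite rpred_div ?realn // rpredD // ler0_real.
apply/eqP; rewrite -sqrf_eq0; apply/eqP.
apply: (@quadratic_le0_eq0 _ _ Y) => //; first by rewrite real_exprn_even_ge0.
move=> e e0; have : e * X \is Num.real by rewrite rpredM // gtr0_real.
move=> /Ht.
by congr (_ <= _); ring.
Qed.

(** The assumed expression is the hermitian extension of the hessian, with [crecip N] as conjugation
    of polynomials. It is the sum of the hessians of the real and the imaginary part of (v, q); both
    are nonpositive, so both are zero, and the two real orthogonality relations recombine. *)
Lemma complex_hessian_null p q v w : in_kernel p -> crecip N p = p ->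
  (size q <= N.+1)%N -> \sum_i s i * v i = 0 ->
  (forall i, w i \is Num.real) -> \sum_i s i * w i = 0 ->
  2^-1 * \sum_i s i * (v i * (v i)^*) * lau N (z i) (tder (N + N) (p * p)) +
    \sum_i s i * (v i * lau N (z i) (p * crecip N q) + (v i)^* * lau N (z i) (p * q)) +
    J (q * crecip N q) = 0 ->
  \sum_i s i * w i * (2^-1 * v i * lau N (z i) (tder (N + N) (p * p)) +
    lau N (z i) (p * q)) = 0.
Proof.
move=> Kp pp sq sv wr sw H0.
pose q1 := 2^-1 *: (q + crecip N q); pose q2 := (2 * 'i)^-1 *: (q - crecip N q).
pose v1 i := 'Re (v i); pose v2 i := 'Im (v i).
have i2 : (2 * 'i : C) != 0 by rewrite mulf_neq0 ?neq0Ci ?pnatr_eq0.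
have sc : (size (crecip N q) <= N.+1)%N by exact: size_crecip.
have s1 : (size q1 <= N.+1)%N.
  by rewrite (leq_trans (size_scale_leq _ _)) // (leq_trans (size_polyD _ _)) // geq_max sq.
have s2 : (size q2 <= N.+1)%N.
  rewrite (leq_trans (size_scale_leq _ _)) // (leq_trans (size_polyD _ _)) //.
  by rewrite geq_max sq size_polyN.
have c1 : crecip N q1 = q1.
  by rewrite /q1 crecipZ crecipD crecipK // fmorphV /= conjC_nat [crecip N q + q]addrC.
have c2 : crecip N q2 = q2.
  rewrite /q2 crecipZ -scaleN1r crecipD crecipZ crecipK // rmorphN1 fmorphV rmorphM /=.
  rewrite conjC_nat conjCi mulrN invrN !scaleN1r.
  by rewrite -[RHS]opprK -scalerN -scaleNr opprB.
have vr1 i : v1 i \is Num.real by exact: Creal_Re.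
have vr2 i : v2 i \is Num.real by exact: Creal_Im.
have vE i : v i = v1 i + 'i * v2 i by exact: Crect.
have vcE i : (v i)^* = v1 i - 'i * v2 i.
  by rewrite {1}vE rmorphD rmorphM /= conjCi !(CrealP _) // mulNr.
have sv1 : \sum_i s i * v1 i = 0.
  transitivity ('Re (\sum_i s i * v i)); last by rewrite sv raddf0.
  by rewrite raddf_sum; apply: eq_bigr => i _; rewrite /= ReMl.
have sv2 : \sum_i s i * v2 i = 0.
  transitivity ('Im (\sum_i s i * v i)); last by rewrite sv raddf0.
  by rewrite raddf_sum; apply: eq_bigr => i _; rewrite /= ImMl.
have q1E : q = q1 + 'i *: q2.
  rewrite /q1 /q2 scalerA (_ : 'i * (2 * 'i)^-1 = 2^-1); last first.
    by field; rewrite neq0Ci.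
  by rewrite -scalerDr addrACA subrr addr0 -mulr2n -scaler_nat scalerA mulVf ?scale1r ?pnatr_eq0.
clearbody q1 q2 v1 v2.
have q2E : crecip N q = q1 - 'i *: q2.
  by rewrite {1}q1E crecipD c1 crecipZ c2 conjCi scaleNr.
have H1 := second_variation Kp pp s1 c1 vr1 sv1.
have H2 := second_variation Kp pp s2 c2 vr2 sv2.
have ii : 'i * 'i = -1 :> C by rewrite -expr2 sqrCi.
have H12 : hessian p q1 v1 + hessian p q2 v2 = 0.
  rewrite -H0 q2E q1E /hessian.
  have -> : (q1 + 'i *: q2) * (q1 - 'i *: q2) = q1 * q1 + q2 * q2.
    rewrite -mul_polyC; have -> : q1 * q1 + q2 * q2 = q1 * q1 - ('i * 'i)%:P * (q2 * q2).
      by rewrite ii polyCN mulN1r opprK.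
    by rewrite polyCM; ring.
  rewrite JD !mulr_sumr [LHS]addrACA; congr (_ + _).
  rewrite -!big_split /=; apply: eq_bigr => i _.
  rewrite vcE vE -scaleNr !mulrDr !lauD -!scalerAr !lauZ.
  by field: ii.
have h1 : hessian p q1 v1 = 0.
  by apply/eqP; move/eqP: H12; rewrite naddr_eq0 // => /andP[].
have h2 : hessian p q2 v2 = 0.
  by apply/eqP; move/eqP: H12; rewrite naddr_eq0 // => /andP[].
have E1 := hessian_null Kp pp s1 c1 vr1 sv1 wr sw h1.
have E2 := hessian_null Kp pp s2 c2 vr2 sv2 wr sw h2.
have := congr2 (fun a b => a + 'i * b) E1 E2; rewrite /= mulr0 addr0.
apply: etrans; rewrite q1E mulr_sumr -big_split /=.
apply: eq_bigr => i _; rewrite (mulrDr p q1) lauD -scalerAr (lauZ i 'i (p * q2)) vE; ring.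
Qed.

(* The direction v_i = 1 / (z_i - x), q = (U p - p') / (X - x), where p' = tder N p and
   U = p'(x) / p(x), is a zero of the hessian. Pairing it with (w, 0) gives
   U |p(z_0)|^2 sum_i s_i w_i v_i = 0 whenever sum_i s_i w_i = 0, although the v_i
   are distinct. *)
Lemma no_balanced_point (i0 i1 : T) (x : C) : (0 < N)%N -> i0 != i1 ->
  (exists2 p : {poly C}, p != 0 & in_kernel p) ->
  `|x| != 1 -> \sum_i s i / (z i - x) = 0 -> False.
Proof.
move=> N0 i01 /(kernel_nonvanishing i0)[p [Kp pp pz]] x1 sv.
have [sp Jp] := Kp.
have px : p.[x] != 0.
  by apply/eqP => /(kernel_roots_unit i01 Kp pp pz)/eqP; rewrite (negPf x1).
have dpx := kernel_tder_neq0 N0 i01 Kp pp pz x1.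
pose U := (tder N p).[x] / p.[x].
have U0 : U != 0 by rewrite mulf_neq0 ?invr_eq0.
have zx i : z i - x != 0.
  by rewrite subr_eq0; apply: contraNneq x1 => <-; rewrite z_unit.
pose v i := (z i - x)^-1.
have sv0 : \sum_i s i * v i = 0 by [].
have /factor_theorem[q qE] : root (U *: p + (-1) *: tder N p) x.
  by apply/eqP; rewrite hornerD (hornerZ U) (hornerZ (-1)) /U divfK // mulN1r subrr.
have size_quotient (g h : {poly C}) : (size g <= N.+1)%N -> g = h * ('X - x%:P) ->
    (size h <= N.+1)%N.
  move=> sg gh; have [->|h0] := eqVneq h 0; first by rewrite size_poly0.
  move: sg; rewrite gh size_Mmonic ?monicXsubC // size_XsubC addn2 /=; exact: ltnW.
have sdp : (size (tder N p) <= N.+1)%N by rewrite (leq_trans (size_tder _ _)).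
have sq : (size q <= N.+1)%N.
  apply: size_quotient qE; rewrite (leq_trans (size_polyD _ _)) // geq_max.
  by apply/andP; split; apply: leq_trans (size_scale_leq _ _) _.
(* Like [U] for [q], the constant [c] creates a zero at x: [crecip N q] is (X - x) r up to a
   multiple of the kernel element [p]. *)
pose c := (crecip N q).[x] / p.[x].
have /factor_theorem[r rE] : root (crecip N q + (- c) *: p) x.
  by apply/eqP; rewrite hornerD !hornerZ /c mulNr divfK // subrr.
have sr : (size r <= N.+1)%N.
  apply: size_quotient rE; rewrite (leq_trans (size_polyD _ _)) // geq_max.
  by rewrite (leq_trans (size_scale_leq _ _)) ?size_crecip.
pose kap := `|p.[z i0]| ^+ 2.
have kap0 : kap != 0 by rewrite sqrf_eq0 normr_eq0.
have ppE i : lau N (z i) (p * p) = kap.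
  by rewrite -{2}pp lauM_crecip // -normCK (first_variation Kp i i0).
pose D i := lau N (z i) (p * tder N p).
have tE i : lau N (z i) (tder (N + N) (p * p)) = 2 * D i.
  by rewrite tderM lauD [tder N p * p]mulrC mulr_natl mulr2n.
have lauV i (g h : {poly C}) : g = h * ('X - x%:P) ->
    lau N (z i) (p * h) = v i * lau N (z i) (p * g).
  move=> ->; rewrite /lau !hornerM hornerXsubC /v.
  by move: (_ ^- _) => e; field; exact: zx.
have pqE i : lau N (z i) (p * q) = v i * (U * kap - D i).
  rewrite (lauV _ _ _ qE) mulrDr lauD -(scalerAr U) -(scalerAr (-1)).
  by rewrite (lauZ i U) (lauZ i (-1)) ppE mulN1r.
have prE i : lau N (z i) (p * r) = v i * (lau N (z i) (p * crecip N q) - c * kap).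
  by rewrite (lauV _ _ _ rE) mulrDr -!scalerAr lauD !lauZ ppE mulNr.
have Jdp : J (tder N p * r) = \sum_i s i * lau N (z i) (p * r).
  rewrite -J_tder ?size_polyM_leS // tderM JD [X in _ + X]Jp ?addr0 //.
  exact: leq_trans (size_tder _ _) _.
(* The factor X - x passes from [crecip N q] to [q] and gives U p - p'. The terms with [p] vanish
   under [J], and -J (p' r) becomes an endpoint sum through [J_tder]. *)
have Jqq : J (q * crecip N q) = - \sum_i s i * (v i * lau N (z i) (p * crecip N q)).
  have -> : crecip N q = r * ('X - x%:P) + c *: p.
    by rewrite -rE scaleNr subrK.
  rewrite mulrDr JD -scalerAr JZ [q * p]mulrC Jp // mulr0 addr0.
  rewrite mulrCA -qE mulrDr -(scalerAr U) -(scalerAr (-1)) JD (JZ U) (JZ (-1)) [r * p]mulrC [r * tder N p]mulrC.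
  rewrite Jp // mulr0 add0r mulN1r Jdp; congr (- _).
  under eq_bigr do rewrite prE.
  have E0 : \sum_i s i * v i * (c * kap) = 0 by rewrite -mulr_suml sv0 mul0r.
  rewrite -[RHS]subr0 -[X in _ = _ - X]E0 -sumrB.
  rewrite -rE scaleNr subrK; apply: eq_bigr => i _; ring.
have zc i : (z i)^* = (z i)^-1.
  by apply: (mulfI (z_neq0 i)); rewrite -normCK z_unit expr1n divff.
(* The Poisson kernel identity (1 - |x|^2) |v_i|^2 = 1 + x v_i + conj (x v_i), summed with the
   signs. *)
have svv : \sum_i s i * (v i * (v i)^*) = 0.
  have nx : 1 - x * x^* != 0.
    by rewrite -normCK subr_eq0 eq_sym sqrp_eq1.
  apply/eqP; rewrite -(mulIr_eq0 _ (mulIf nx)); apply/eqP.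
  transitivity (\sum_i s i + x * (\sum_i s i * v i) + x^* * (\sum_i s i * v i)^*);
    last by rewrite sum_s sv0 conjC0 !mulr0 !addr0.
  rewrite raddf_sum !mulr_sumr mulr_suml -!big_split /=; apply: eq_bigr => i _.
  rewrite rmorphM /= (CrealP (s_real i)) /v fmorphV rmorphB /= zc.
  have zcx : 1 - x^* * z i != 0.
    have := zx i; rewrite -conjC_eq0 rmorphB /= zc => /(mulf_neq0 (z_neq0 i)).
    by rewrite mulrBr divff // mulrC.
  have -> : ((z i)^-1 - x^*)^-1 = z i / (1 - x^* * z i).
    by field; rewrite z_neq0 zcx.
  by field; rewrite zcx zx.
pose w i := (s i)^-1 * ((i == i0)%:R - (i == i1)%:R).
have wr i : w i \is Num.real.
  by rewrite rpredM ?rpredV // rpredB ?realn.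
have sw : \sum_i s i * w i = 0.
  by under eq_bigr do rewrite -[_ * _]mulr1; rewrite sum_two_point_weights ?subrr.
have := complex_hessian_null Kp pp sq sv0 wr sw.
(* The terms with [D i] cancel, [Jqq] cancels those with [crecip N q], and only U kap sum_i s_i
   |v_i|^2 remains. *)
rewrite (_ : _ + _ = 0); last first.
  rewrite Jqq; transitivity (U * kap * \sum_i s i * (v i * (v i)^*));
    last by rewrite svv mulr0.
  rewrite !mulr_sumr -big_split -sumrB /=.
  apply: eq_bigr => i _; rewrite pqE tE; by field.
move=> /(_ erefl).
rewrite (eq_bigr (fun i => s i * w i * (U * kap * v i))); last first.
  by move=> i _; rewrite pqE tE; field.
rewrite sum_two_point_weights // -mulrBr => /eqP; rewrite mulf_eq0 (mulf_eq0 U kap) (negPf U0) (negPf kap0) /=.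
rewrite subr_eq0 (inj_eq invr_inj) (inj_eq (addIr _)) (inj_eq z_inj).
by rewrite (negPf i01).
Qed.
End SecondVariation.

(** * A zero of the partial fraction sum over the nodes *)

Section BalancedPoint.
Variables (C : numClosedFieldType) (T : finType) (s z : T -> C).
Hypotheses (z_unit : forall i, `|z i| = 1) (z_inj : injective z).
Hypotheses (s_real : forall i, s i \is Num.real) (s_neq0 : forall i, s i != 0).
Hypotheses (sum_s : \sum_i s i = 0) (cardT : (2 < #|T|)%N).

Let cofactor_poly i : {poly C} := \prod_(j | j != i) ('X - (z j)%:P).

Let horner_cofactor i k : k != i -> (cofactor_poly i).[z k] = 0.
Proof. by move=> ki; rewrite horner_prod (bigD1 k) //= hornerXsubC subrr mul0r. Qed.

Let horner_cofactor_diag i : (cofactor_poly i).[z i] != 0.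
Proof.
rewrite horner_prod; apply/prodf_neq0 => j ji.
by rewrite hornerXsubC subr_eq0 eq_sym (inj_eq z_inj).
Qed.

Let horner_cofactorE i x : (forall j, x != z j) ->
  (cofactor_poly i).[x] = \prod_j (x - z j) / (x - z i).
Proof.
move=> xz; have xi : x - z i != 0 by rewrite subr_eq0.
rewrite [\prod_j _](bigD1 i) //= mulrAC divff // mul1r horner_prod.
by apply: eq_bigr => j _; rewrite hornerXsubC.
Qed.

Let coef_cofactor i : (cofactor_poly i)`_#|T|.-1 = 1.
Proof.
have sE : size (cofactor_poly i) = #|T|.
  have -> : cofactor_poly i = \prod_(j <- enum (predC1 i)) ('X - (z j)%:P).
    by rewrite big_enum.
  by rewrite size_prod_XsubC -cardE cardC1; lia.
rewrite -sE -lead_coefE; apply/eqP; rewrite -/(_ \is monic).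
exact: monic_prod_XsubC.
Qed.

(** The numerator [n] does not vanish at the nodes, so each of its roots is a solution. The delicate
    case is a constant numerator; there 0 is shown to be a root as well. *)
Lemma balanced_point : exists2 x, (forall i, x != z i) & \sum_i s i / (z i - x) = 0.
Proof.
have z0 i : z i != 0 by rewrite -normr_eq0 z_unit oner_eq0.
have zc i : (z i)^* = (z i)^-1.
  by apply: (mulfI (z0 i)); rewrite -normCK z_unit expr1n divff.
pose n : {poly C} := \sum_i s i *: cofactor_poly i.
have nz i : n.[z i] != 0.
  rewrite horner_sum (bigD1 i) //= big1 ?addr0 => [|j ji].
    by rewrite hornerZ mulf_neq0.
  by rewrite hornerZ horner_cofactor 1?eq_sym // mulr0.
have nE x : (forall j, x != z j) -> n.[x] = - \prod_j (x - z j) * \sum_i s i / (z i - x).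
  move=> xz; rewrite horner_sum mulr_sumr; apply: eq_bigr => i _.
  rewrite hornerZ horner_cofactorE // -(opprB x) invrN; ring.
have nP x : n.[x] = 0 -> \sum_i s i / (z i - x) = 0 /\ forall i, x != z i.
  move=> nx; have xz i : x != z i by apply: contraNneq (nz i) => <-; rewrite nx.
  split=> //; move/eqP: nx; rewrite nE // mulf_eq0 oppr_eq0 => /orP[|/eqP//].
  by move=> /prodf_eq0[i _]; rewrite subr_eq0 (negPf (xz i)).
have [sn|/closed_rootP[x /eqP/nP[]]] := eqVneq (size n) 1%N; last by exists x.
suff /nP[] : n.[0] = 0 by exists 0.
have z00 i : 0 != z i by rewrite eq_sym.
rewrite nE //; apply/eqP; rewrite mulf_eq0; apply/orP; right; apply/eqP.
(* The two sides differ by (sum_i s_i) times the product of all X - z_j, which is 0. With [n]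
   constant and at least three nodes, the top coefficient gives sum_i s_i z_i = 0; its conjugate is
   the sum at x = 0. *)
have gE : \sum_i (s i * z i) *: cofactor_poly i = 'X * n.
  rewrite mulr_sumr; apply/eqP; rewrite -subr_eq0 -sumrB; apply/eqP.
  transitivity (- (\sum_i s i) *: \prod_j ('X - (z j)%:P)); last first.
    by rewrite sum_s oppr0 scale0r.
  rewrite scaleNr scaler_suml -sumrN; apply: eq_bigr => i _.
  rewrite [\prod_j _](bigD1 i) //= -/(cofactor_poly i) -!mul_polyC !polyCM; ring.
have sz0 : \sum_i s i * z i = 0.
  have := congr1 (fun p : {poly C} => p`_#|T|.-1) gE.
  rewrite coef_sum; under eq_bigr do rewrite coefZ coef_cofactor mulr1.
  by move=> ->; rewrite coefXM nth_default ?if_same // sn; lia.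
transitivity ((\sum_i s i * z i)^*); last by rewrite sz0 conjC0.
rewrite rmorph_sum; apply: eq_bigr => i _.
by rewrite rmorphM /= (CrealP (s_real i)) zc subr0.
Qed.

End BalancedPoint.

Import numFieldNormedType.Exports.

(** * Trigonometric polynomials and their primitives *)

Section Trigonometry.
Variable R : realType.
Implicit Types (x y t : R).

(** Applied in turn to sin x, 1 - cos x, x - sin x and cos x - 1 + x^2 / 2, where each function from
    the second on has the preceding one as its derivative. *)
Lemma mvt_bound0 (f df : R -> R) (M x : R) : (forall y, is_derive y (1 : R) f (df y)) ->
  f 0 = 0 -> (forall y, `|y| <= `|x| -> `|df y| <= M) -> `|f x| <= M * `|x|.
Proof.
move=> fd f0 fM.
have fc A : {within A, continuous f}%classic.
  apply: continuous_subspaceT => y; apply: differentiable_continuous.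
  exact/derivable1_diffP/ex_derive.
have [x0|x0] := leP 0 x.
  have [c] := MVT_segment x0 (fun y _ => fd y) (fc _).
  rewrite f0 !subr0 in_itv /= => /andP[c0 cx] ->; rewrite normrM ler_wpM2r // fM //.
  by rewrite !ger0_norm.
have [c] := MVT_segment (ltW x0) (fun y _ => fd y) (fc _).
rewrite f0 sub0r in_itv /= => /andP[cx c0] /eqP; rewrite eqr_oppLR sub0r mulrN opprK => /eqP ->.
by rewrite normrM ler_wpM2r // fM // !ler0_norm ?(ltW x0) // lerN2.
Qed.

Lemma norm_sin_le x : `|sin x| <= `|x|.
Proof.
rewrite -[leRHS]mul1r; apply: (@mvt_bound0 sin cos); rewrite ?sin0 //.
by move=> y _; exact: cos_max.
Qed.

Lemma norm_1Bcos_le M x : (forall y, `|y| <= `|x| -> `|sin y| <= M) ->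
  `|1 - cos x| <= M * `|x|.
Proof.
move=> H; apply: (@mvt_bound0 (fun x => 1 - cos x) sin); rewrite ?cos0 ?subrr //.
by move=> y; apply: is_derive_eq; rewrite add0r mul1r opprK.
Qed.

Lemma norm_subr_sin_le M x : (forall y, `|y| <= `|x| -> `|1 - cos y| <= M) ->
  `|x - sin x| <= M * `|x|.
Proof.
move=> H; apply: (@mvt_bound0 (fun x => x - sin x) (fun x => 1 - cos x)) => //.
by rewrite sin0 subrr.
Qed.

Lemma norm_cos_taylor_le x : `|cos x - 1 + x ^+ 2 / 2| <= `|x| ^+ 3.
Proof.
rewrite [leRHS]exprSr; apply: (@mvt_bound0 (fun x => cos x - 1 + x ^+ 2 / 2) (fun x => x - sin x)).
- by move=> y; apply: is_derive_eq; rewrite /GRing.scale /=; field.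
- by rewrite cos0 subrr expr0n mul0r addr0.
move=> y yx; apply: le_trans (_ : `|x| * `|y| <= _); last by rewrite expr2 ler_wpM2l.
apply: norm_subr_sin_le => u uy; apply: le_trans (_ : 1 * `|u| <= _); last first.
  by rewrite mul1r; exact: le_trans yx.
by apply: norm_1Bcos_le => v _; rewrite ler_norml sin_geN1 sin_le1.
Qed.

Lemma norm_sin_taylor_le x : `|sin x - x| <= `|x| ^+ 3.
Proof.
rewrite distrC [leRHS]exprSr; apply: norm_subr_sin_le => y yx.
apply: le_trans (_ : `|y| * `|y| <= _); last by rewrite expr2 ler_pM.
by apply: norm_1Bcos_le => u uy; exact: le_trans (norm_sin_le _) _.
Qed.

End Trigonometry.

Local Open Scope complex_scope.

Section Expi.
Variable R : realType.
Implicit Types (x y t : R).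

Lemma imaginaryE : ('i : R[i])%R = 0 +i* 1.
Proof. by rewrite -complexiE. Qed.

Lemma complex_rectE (z : R[i]) : z = (complex.Re z)%:C + 'i%R * (complex.Im z)%:C.
Proof. by rewrite -complexiE -complexE. Qed.

Lemma expiE x : expi x = (cos x)%:C + 'i%R * (sin x)%:C.
Proof. by rewrite [LHS]complex_rectE. Qed.

Lemma expi0 : expi 0 = 1 :> R[i].
Proof. by rewrite expiE cos0 sin0 mulr0 addr0. Qed.

Lemma expiD x y : expi (x + y) = expi x * expi y.
Proof.
rewrite !expiE cosD sinD rmorphB rmorphD !rmorphM /=.
have ii : 'i * 'i = -1 :> R[i] by rewrite -expr2 sqrCi.
by ring: ii.
Qed.

Lemma expiN x : expi (- x) = (expi x)^-1.
Proof.
have e : expi x * expi (- x) = 1 by rewrite -expiD subrr expi0.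
have e0 : expi x != 0 by apply/eqP => e0; move/eqP: e; rewrite e0 mul0r eq_sym oner_eq0.
by apply: (mulfI e0); rewrite e divff.
Qed.

Lemma conj_expi x : (expi x)^*%R = expi (- x).
Proof. by rewrite /expi cosN sinN. Qed.

Lemma conj_real_complex x : (x%:C)^*%R = x%:C :> R[i].
Proof. exact: conjc_real. Qed.

Lemma norm_expi x : `|expi x| = 1.
Proof.
apply/eqP; rewrite -sqrp_eq1 // normCK conj_expi -expiD subrr expi0; exact/eqP.
Qed.

Lemma expi_neq0 x : expi x != 0.
Proof. by rewrite -normr_eq0 norm_expi oner_eq0. Qed.

Lemma expi_mulrn n x : expi (n%:R * x) = expi x ^+ n.
Proof.
elim: n => [|n IH]; first by rewrite mul0r expi0.
by rewrite -natr1 mulrDl mul1r expiD IH exprSr.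
Qed.

Lemma expi_period x : expi (x + 2 * pi) = expi x.
Proof. by rewrite expiD /expi mulr_natl cos2pi sin2pi mulr1. Qed.

Lemma expi_periodz x (k : int) : expi (x + k%:~R * (2 * pi)) = expi x.
Proof.
elim/int_ind: k => [|n IH|n IH] in x *; first by rewrite mul0r addr0.
  by rewrite -addn1 PoszD intrD mulrDl mul1r addrA expi_period IH.
by rewrite -[LHS]expi_period -addn1 PoszD opprD intrD mulrDl mulN1r addrA subrK IH.
Qed.

Lemma norm_rect_le x y : `|x%:C + 'i%R * y%:C| <= (`|x| + `|y|)%:C.
Proof.
apply: le_trans (ler_normD _ _) _; rewrite normrM normCi mul1r !normc_def /=.
by rewrite !expr0n !addr0 !sqrtr_sqr rmorphD.
Qed.

Lemma expi_taylor x :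
  `|expi x - 1 - 'i%R * x%:C + x%:C ^+ 2 / 2| <= (2 * `|x| ^+ 3)%:C.
Proof.
have -> : expi x - 1 - 'i%R * x%:C + x%:C ^+ 2 / 2 =
    (cos x - 1 + x ^+ 2 / 2)%:C + 'i%R * (sin x - x)%:C.
  rewrite expiE !rmorphD !rmorphN !rmorphM /= fmorphV rmorph_nat rmorph1; ring.
apply: le_trans (norm_rect_le _ _) _; rewrite lecR mulr_natl mulr2n lerD //.
  exact: norm_cos_taylor_le.
exact: norm_sin_taylor_le.
Qed.

Definition rnorm (z : R[i]) : R := complex.Re `|z|.

Lemma rnormE z : `|z| = (rnorm z)%:C.
Proof. by rewrite /rnorm normc_def. Qed.

Lemma rnorm_ge0 z : 0 <= rnorm z.
Proof. by rewrite -lecR -rnormE; exact: normr_ge0. Qed.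

End Expi.

Section Primitive.
Variable R : realType.
Variable N : nat.
Implicit Types (g : {poly R[i]}) (t h : R) (k : nat).

Definition freq k : R := k%:R - N%:R.

Lemma freq_eq0 k : (freq k == 0) = (k == N).
Proof. by rewrite subr_eq0 eqr_nat. Qed.

Lemma lau_expi g t : (size g <= (N + N).+1)%N ->
  lau N (expi t) g = \sum_(k < (N + N).+1) g`_k * expi (freq k * t).
Proof.
move=> sg; rewrite /lau (horner_coef_wide _ sg) mulr_sumr; apply: eq_bigr => k _.
rewrite /freq mulrBl expiD expiN -!expi_mulrn; ring.
Qed.

(* prim g is an antiderivative of t |-> lau N (expi t) g. *)
Definition prim_coef k t : R[i] :=
  if k == N then t%:C else expi (freq k * t) / ('i%R * (freq k)%:C).

Definition prim g t := \sum_(k < (N + N).+1) g`_k * prim_coef k t.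

Lemma primD g1 g2 t : prim (g1 + g2) t = prim g1 t + prim g2 t.
Proof. by rewrite -big_split; apply: eq_bigr => k _; rewrite coefD mulrDl. Qed.

Lemma primZ a g t : prim (a *: g) t = a * prim g t.
Proof. by rewrite mulr_sumr; apply: eq_bigr => k _; rewrite coefZ mulrA. Qed.

Lemma prim_crecip g t : prim (crecip (N + N) g) t = (prim g t)^*%R.
Proof.
rewrite rmorph_sum (reindex_inj rev_ord_inj) /=; apply: eq_bigr => k _.
rewrite subSS coef_crecip ltn_ord rmorphM /=; congr (_ * _).
rewrite /prim_coef (_ : (_ == _) = (k == N :> nat)); last by have := ltn_ord k; lia.
case: eqP => _; first by rewrite conj_real_complex.
have -> : freq (N + N - k) = - freq k.
  by rewrite /freq natrB ?leq_ord // natrD; ring.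
rewrite rmorphM fmorphV rmorphM /= conj_expi conjCi conj_real_complex.
by rewrite mulNr opprK rmorphN mulNr mulrN opprK.
Qed.

Lemma prim_tder g t : (size g <= (N + N).+1)%N ->
  prim (tder (N + N) g) t = lau N (expi t) g - g`_N.
Proof.
move=> sg; rewrite lau_expi //.
have NN : (N < (N + N).+1)%N by lia.
have -> : g`_N = \sum_(k < (N + N).+1) (if k == N :> nat then g`_N else 0).
  rewrite (bigD1 (Ordinal NN)) //= eqxx big1 ?addr0 // => i.
  by rewrite -val_eqE /= => /negPf ->.
rewrite -sumrB; apply: eq_bigr => k _; rewrite coef_tder /prim_coef natrD.
case: eqP => [->|/eqP kN].
  by rewrite /freq subrr mul0r expi0 mulr1 subrr; field.
rewrite subr0 (_ : k%:R - (N%:R + N%:R) / 2 = (freq k)%:C); last first.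
  by rewrite /freq rmorphB !rmorph_nat; field.
field; rewrite neq0Ci /= -(rmorph0 (real_complex R)) (inj_eq (@complexI _)).
by rewrite freq_eq0 kN.
Qed.

Lemma prim_period g t : prim g (t + 2 * pi) = prim g t + (2 * pi)%:C * g`_N.
Proof.
have NN : (N < (N + N).+1)%N by lia.
have -> : (2 * pi)%:C * g`_N = \sum_(k < (N + N).+1) (if k == N :> nat then (2 * pi)%:C * g`_N else 0).
  rewrite (bigD1 (Ordinal NN)) //= eqxx big1 ?addr0 // => i.
  by rewrite -val_eqE /= => /negPf ->.
rewrite -big_split; apply: eq_bigr => k _; rewrite /= /prim_coef.
case: eqP => [->|_]; first by rewrite rmorphD mulrDr [X in _ + X]mulrC.
rewrite addr0 /freq mulrDr; congr (_ * (_ / _)).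
by rewrite -[RHS](expi_periodz _ (k%:Z - N%:Z)) intrB.
Qed.

(** Frequency by frequency from [expi_taylor]: the error 2 |freq h|^3 is divided by |freq| in the
    primitive. The bound is uniform in [t]. *)
Lemma prim_taylor g : (size g <= (N + N).+1)%N -> exists2 K : R, 0 <= K &
  forall t h, `|prim g (t + h) - prim g t - h%:C * lau N (expi t) g
     - h%:C ^+ 2 / 2 * lau N (expi t) (tder (N + N) g)| <= (K * `|h| ^+ 3)%:C.
Proof.
move=> sg; exists (\sum_(k < (N + N).+1) rnorm g`_k * (2 * freq k ^+ 2)).
  by apply: sumr_ge0 => k _; rewrite mulr_ge0 ?rnorm_ge0 // mulr_ge0 ?sqr_ge0.
move=> t h; rewrite !lau_expi //; last exact: leq_trans (size_tder _ _) _.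
rewrite !mulr_sumr -!sumrB mulr_suml rmorph_sum /=.
apply: le_trans (ler_norm_sum _ _ _) _; apply: ler_sum => k _.
rewrite coef_tder -[(rnorm _ * _) * _]mulrA [leRHS]rmorphM /= -rnormE.
set e := expi (freq k * t).
have -> : g`_k * prim_coef k (t + h) - g`_k * prim_coef k t - h%:C * (g`_k * e) -
   h%:C ^+ 2 / 2 * ('i * (k%:R - (N + N)%:R / 2) * g`_k * e) =
   g`_k * (prim_coef k (t + h) - prim_coef k t - h%:C * e -
     h%:C ^+ 2 / 2 * 'i * (freq k)%:C * e).
  by rewrite /freq rmorphB !rmorph_nat natrD; field.
rewrite normrM ler_wpM2l // /prim_coef; case: eqP => [kN|/eqP kN].
  have f0 : freq k = 0 by apply/eqP; rewrite freq_eq0 kN.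
  rewrite /e f0 mul0r expi0 rmorph0 mulr0 mul0r mulr1 subr0 rmorphD /=.
  by rewrite (_ : _ + _ - _ - _ = 0) ?normr0 ?expr0n ?mulr0 ?mul0r //; ring.
have f0 : (freq k)%:C != 0 :> R[i].
  by rewrite -(rmorph0 (real_complex R)) (inj_eq (@complexI _)) freq_eq0.
rewrite mulrDr expiD -/e.
have i0 := neq0Ci R[i].
have ii : 'i * 'i = -1 :> R[i] by rewrite -expr2 sqrCi.
have -> : e * expi (freq k * h) / ('i * (freq k)%:C) - e / ('i * (freq k)%:C) -
   h%:C * e - h%:C ^+ 2 / 2 * 'i * (freq k)%:C * e =
   e / ('i * (freq k)%:C) * (expi (freq k * h) - 1 - 'i * (freq k * h)%:C + (freq k * h)%:C ^+ 2 / 2).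
  rewrite (_ : (freq k * h)%:C = (freq k)%:C * h%:C) ?rmorphM //.
  have -> : h%:C ^+ 2 / 2 * 'i * (freq k)%:C * e = - (h%:C ^+ 2 / 2 / 'i * (freq k)%:C * e).
    by rewrite invCi; ring.
  by field; rewrite i0 f0.
rewrite !normrM norm_expi normfV normrM normCi !mul1r mulrC ler_pdivrMr ?normr_gt0 //.
apply: le_trans (expi_taylor _) _.
rewrite rnormE /rnorm normc_def /= expr0n addr0 sqrtr_sqr -rmorphM lecR normrM exprMn.
rewrite -(ger0_norm (sqr_ge0 (freq k))) normrX [leRHS]mulrAC -!mulrA ler_wpM2l //.
Qed.

End Primitive.

(** * Alternating sums of cotangents *)

Section AlternatingCotangent.
Variable R : realType.
Implicit Types (a b t : R).

Lemma alternating_sum_pairs (f : nat -> R) m :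
  \sum_(i < 2 * m) (-1) ^+ i.+1 * f i = \sum_(j < m) (f (2 * j).+1 - f (2 * j)%N).
Proof.
elim: m => [|m IH]; first by rewrite muln0 !big_ord0.
rewrite mulnS addnC addn2 !big_ord_recr /= IH !exprS exprM sqrrN expr1n expr1n.
by ring.
Qed.

(** The sum grouped by the gaps between the arcs instead of the arcs; the outermost two points form
    a pair of their own. *)
Lemma alternating_sum_shifted_pairs (f : nat -> R) m :
  \sum_(i < 2 * m.+1) (-1) ^+ i.+1 * f i =
  f (2 * m).+1 - f 0 - \sum_(j < m) (f (2 * j).+2 - f (2 * j).+1).
Proof.
rewrite alternating_sum_pairs; elim: m => [|m IH].
  by rewrite big_ord0 !big_ord_recr big_ord0 /= subr0 add0r.
rewrite big_ord_recr IH /= [in RHS]big_ord_recr /=.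
rewrite (_ : (2 * m.+1) = (2 * m).+2)%N; last by lia.
by ring.
Qed.

Definition cotan t : R := cos t / sin t.

Lemma cotanB a b : sin a != 0 -> sin b != 0 ->
  cotan a - cotan b = sin (b - a) / (sin a * sin b).
Proof. by move=> a0 b0; rewrite /cotan sinB; field; rewrite a0 b0. Qed.

Lemma sin_gt0_of_pos a : 0 < a -> a < pi -> 0 < sin a.
Proof. by move=> a0 ap; apply: sin_gt0_pi; rewrite a0. Qed.

Lemma sin_lt0_of_neg a : - pi < a -> a < 0 -> sin a < 0.
Proof.
by move=> ap a0; rewrite -oppr_gt0 -sinN; apply: sin_gt0_of_pos; lra.
Qed.

(** The cotangent decreases on each side of 0, and at most one pair of neighbours straddles 0. If no
    arc does, grouping by arcs gives negative terms only. If an arc does, no gap does, and grouping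
    by gaps gives a positive sum: the outer pair lies on both sides of 0 at distance less than pi,
    so its difference is positive too. *)
Lemma alternating_cotan_neq0 m (u : nat -> R) : (0 < m)%N ->
  (forall i j, (i < j < 2 * m)%N -> u i < u j) -> u (2 * m).-1 < u 0 + pi ->
  - pi < u 0 -> u 0 < 0 -> (forall i, (i < 2 * m)%N -> u i != 0) ->
  \sum_(i < 2 * m) (-1) ^+ i.+1 * cotan (u i) != 0.
Proof.
case: m => // m _ incr ulast u0pi u0 unz.
have upi i : (i < 2 * m.+1)%N -> - pi < u i /\ u i < pi.
  move=> im; have h0 : u 0 <= u i.
    by case: i im => [|i] im //; apply/ltW/incr.
  have h1 : u i <= u (2 * m.+1).-1.
    have : (i <= (2 * m.+1).-1)%N by lia.
    by rewrite leq_eqVlt => /orP[/eqP->//|il]; apply/ltW/incr; lia.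
  by lra.
have usin i : (i < 2 * m.+1)%N -> sin (u i) != 0.
  move=> im; have [h1 h2] := upi _ im; case: (ltgtP (u i) 0) (unz _ im) => // h _.
    by rewrite lt_eqF // sin_lt0_of_neg.
  by rewrite gt_eqF // sin_gt0_of_pos.
have same i : (i.+1 < 2 * m.+1)%N -> ~~ ((u i < 0) && (0 < u i.+1)) ->
    cotan (u i.+1) - cotan (u i) < 0.
  move=> im str; have im' : (i < 2 * m.+1)%N by lia.
  have uu : u i < u i.+1 by apply: incr; lia.
  have [h1 h2] := upi _ im'; have [h3 h4] := upi _ im.
  rewrite cotanB ?usin // -opprB sinN mulNr oppr_lt0 divr_gt0 //.
    apply: sin_gt0_of_pos; rewrite ?subr_gt0 //.
    by move: str; rewrite negb_and -!leNgt => /orP[] h; lra.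
  move: str; rewrite negb_and -!leNgt => /orP[h|h].
    have {}h : 0 < u i by rewrite lt_neqAle eq_sym unz.
    by rewrite mulr_gt0 // sin_gt0_of_pos //; lra.
  have {}h : u i.+1 < 0 by rewrite lt_neqAle unz.
  by rewrite nmulr_rgt0 // sin_lt0_of_neg //; lra.
have [/existsP[j /andP[js1 js2]]|] :=
    boolP [exists j : 'I_m.+1, (u (2 * j)%N < 0) && (0 < u (2 * j).+1)]; last first.
  rewrite negb_exists => /forallP nostr; rewrite lt_eqF // (alternating_sum_pairs (fun i => cotan (u i))).
  have neg (i : 'I_m.+1) : cotan (u (2 * i).+1) - cotan (u (2 * i)%N) < 0.
    by apply: same; [have := ltn_ord i; lia|exact: nostr].
  rewrite big_ord_recl -[ltRHS]addr0; apply: ltr_leD; first exact: neg.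
  by apply: sumr_le0 => i _; exact/ltW/neg.
rewrite gt_eqF // (alternating_sum_shifted_pairs (fun i => cotan (u i))).
have j1 := ltn_ord j.
have last_pos : 0 < u (2 * m).+1.
  apply: lt_le_trans js2 _.
  have : (j <= m)%N by lia.
  by rewrite leq_eqVlt => /orP[/eqP->//|jm]; apply/ltW/incr; lia.
have lE : (2 * m).+1 = (2 * m.+1).-1 by lia.
have im : ((2 * m).+1 < 2 * m.+1)%N by lia.
have [h1 h2] := upi _ im.
rewrite -[ltLHS](addr0 0); apply: ltr_leD; last first.
  rewrite oppr_ge0; apply: sumr_le0 => i _; have i1 := ltn_ord i.
  apply/ltW/same; first by lia.
  apply/negP => /andP[k1 k2].
  have ij : (i < j)%N.
    rewrite ltnNge; apply/negP => ji.
    have : u (2 * j).+1 <= u (2 * i).+1.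
      move: ji; rewrite leq_eqVlt => /orP[/eqP->//|ji]; apply/ltW/incr; lia.
    by lra.
  have : u (2 * i).+2 <= u (2 * j)%N.
    have : ((2 * i).+2 <= 2 * j)%N by lia.
    by rewrite leq_eqVlt => /orP[/eqP->//|ij2]; apply/ltW/incr; lia.
  by lra.
rewrite cotanB ?usin //; rewrite ltr_ndivlMr ?mul0r; last first.
  by rewrite pmulr_rlt0 ?sin_lt0_of_neg // sin_gt0_of_pos.
by move: ulast; rewrite -lE => ulast; rewrite sin_lt0_of_neg //; lra.
Qed.

End AlternatingCotangent.

(** * Configurations of arcs *)

Section Configurations.
Variables (R : realType) (N : nat).
Implicit Types (c v : nat -> R) (g : {poly R[i]}) (n : nat) (L : R).

(** Divided by |e|, the inequalities for e and -e bound B and -B by multiples of e, so B = 0; a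
    second division by e leaves C <= K e for small e > 0. *)
Lemma second_order_test (B C K d : R) : 0 < d ->
  (forall e, `|e| <= d -> e * B + e ^+ 2 * C <= K * `|e| ^+ 3) -> B = 0 /\ C <= 0.
Proof.
move=> d0 H.
pose M := `|B| + `|C| + `|K| + 1.
have [KM CM] : `|K| < M /\ `|C| < M by rewrite /M; split; have := normr_ge0 B; have := normr_ge0 C; have := normr_ge0 K; lra.
have M0 : 0 < M by exact: le_lt_trans KM.
have pos e : 0 < e -> e <= d -> B + e * C <= `|K| * e ^+ 2 /\ - B + e * C <= `|K| * e ^+ 2.
  move=> e0 ed; split; rewrite -(ler_pM2l e0).
    have := H e; rewrite gtr0_norm // => /(_ ed) He.
    apply: le_trans (_ : K * e ^+ 3 <= _); first by apply: le_trans He; lra.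
    rewrite (_ : e * (`|K| * e ^+ 2) = `|K| * e ^+ 3) ?ler_wpM2r ?exprn_ge0 ?ler_norm ?ltW //; ring.
  have := H (- e); rewrite normrN gtr0_norm // => /(_ ed) He.
  apply: le_trans (_ : K * e ^+ 3 <= _); first by apply: le_trans He; rewrite sqrrN; lra.
  by rewrite (_ : e * (`|K| * e ^+ 2) = `|K| * e ^+ 3) ?ler_wpM2r ?exprn_ge0 ?ler_norm ?ltW //; ring.
have small (x : R) : (forall e, 0 < e -> e <= Num.min d 1 -> x <= e * (2 * M)) -> x <= 0.
  move=> hx; rewrite leNgt; apply/negP => x0.
  have m0 : 0 < Num.min d 1 by rewrite lt_min d0 ltr01.
  pose e := Num.min (Num.min d 1) (x / (4 * M)).
  have e0 : 0 < e by rewrite /e lt_min m0 divr_gt0 // mulr_gt0.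
  have := hx e e0; rewrite /e ge_min lexx => /(_ isT).
  have : e <= x / (4 * M) by rewrite /e ge_min lexx orbT.
  rewrite ler_pdivlMr ?mulr_gt0 // -/e => h1 h2.
  have : e * (2 * M) = e * (4 * M) / 2 by field.
  by lra.
have B0 : B = 0.
  suff [h1 h2] : B <= 0 /\ - B <= 0 by apply/eqP; rewrite eq_le h1 -oppr_le0 h2.
  split; apply: small => e e0; rewrite le_min => /andP[ed e1].
    have [h _] := pos e e0 ed.
    have h1 : `|e * C| <= e * M by rewrite normrM gtr0_norm // ler_wpM2l ?ltW.
    have h2 : `|K| * e ^+ 2 <= e * M.
      by rewrite expr2 mulrA mulrC ler_pM2l // -[leRHS]mulr1 ler_pM // ltW.
    by have := ler_norm (- (e * C)); rewrite normrN; lra.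
  have [_ h] := pos e e0 ed.
  have h1 : `|e * C| <= e * M by rewrite normrM gtr0_norm // ler_wpM2l ?ltW.
  have h2 : `|K| * e ^+ 2 <= e * M.
    by rewrite expr2 mulrA mulrC ler_pM2l // -[leRHS]mulr1 ler_pM // ltW.
  by have := ler_norm (- (e * C)); rewrite normrN; lra.
split=> //; apply: small => e e0; rewrite le_min => /andP[ed e1].
have [] := pos e e0 ed; rewrite B0 add0r expr2 mulrA [leRHS]mulrC ler_pM2l // => h _.
have : `|K| * e <= e * M by rewrite mulrC ler_pM2l // ltW.
by have := mulr_gt0 e0 M0; lra.
Qed.

(* c lists the endpoints of the n / 2 arcs [c 0, c 1], [c 2, c 3], ..., so that
   alternating n c is their total length. *)
Definition is_config (lt_or_le : rel R) n c :=
  (forall i, (i.+1 < n)%N -> lt_or_le (c i) (c i.+1)) /\ lt_or_le (c n.-1) (c 0 + 2 * pi).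

(** Weak inequalities are closed conditions and serve to find a maximiser; strict ones leave room to
    move every endpoint. *)
Definition config := is_config <=%R.
Definition strict_config := is_config <%R.

Definition alternating n c : R := \sum_(i < n) (-1) ^+ i.+1 * c i.

(** The integral of z^(-N) g over the arcs minus L times the mean value of z^(-N) g. For
    [g := p * crecip N p] its sign compares the concentration of p on the arcs with L / (2 pi). *)
Definition functional n c L g : R[i] :=
  \sum_(i < n) (-1) ^+ i.+1 * prim N g (c i) - L%:C * g`_N.

Lemma functionalD n c L g h : functional n c L (g + h) = functional n c L g + functional n c L h.
Proof.
rewrite /functional coefD; under eq_bigr do rewrite primD mulrDr.
rewrite big_split /=; ring.
Qed.

Lemma functionalZ n c L a g : functional n c L (a *: g) = a * functional n c L g.
Proof.
rewrite /functional coefZ mulrBr mulr_sumr; congr (_ - _); last by rewrite mulrCA.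
by apply: eq_bigr => i _; rewrite primZ mulrCA.
Qed.

Lemma functional_crecip n c L g : functional n c L (crecip (N + N) g) = (functional n c L g)^*%R.
Proof.
rewrite /functional rmorphB rmorph_sum rmorphM /= conj_real_complex coef_crecip.
rewrite (_ : (N < (N + N).+1)%N); last by lia.
rewrite addnK; congr (_ - _); apply: eq_bigr => i _.
by rewrite prim_crecip rmorphM rmorphXn rmorphN1.
Qed.

Lemma sum_alternating_signs (V : pzRingType) m : \sum_(i < 2 * m) (-1) ^+ i.+1 = 0 :> V.
Proof.
elim: m => [|m IH]; first by rewrite muln0 big_ord0.
rewrite mulnS addnC addn2 !big_ord_recr /= IH add0r [X in _ + X]exprS mulN1r.
by rewrite subrr.
Qed.

(** A derivative has mean value 0, so [L] disappears, and the constants of integration cancel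
    because the signs sum to 0. *)
Lemma functional_tder m c L g : (size g <= (N + N).+1)%N ->
  functional (2 * m) c L (tder (N + N) g) =
  \sum_(i < 2 * m) (-1) ^+ i.+1 * lau N (expi (c i)) g.
Proof.
move=> sg; rewrite /functional coef_tder (_ : N%:R - _ = 0); last by rewrite natrD; field.
rewrite mulr0 mul0r mulr0 subr0.
under eq_bigr do rewrite prim_tder // mulrBr.
by rewrite sumrB -mulr_suml sum_alternating_signs mul0r subr0.
Qed.

Lemma functional_taylor n c v L g : (size g <= (N + N).+1)%N ->
  exists2 K : R, 0 <= K & forall e : R,
  `|functional n (fun i => c i + e * v i) L g - (functional n c L g +
     e%:C * (\sum_(i < n) (-1) ^+ i.+1 * (v i)%:C * lau N (expi (c i)) g) +
     e%:C ^+ 2 * (2^-1 * \sum_(i < n) (-1) ^+ i.+1 * (v i)%:C ^+ 2 *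
         lau N (expi (c i)) (tder (N + N) g)))| <= (K * `|e| ^+ 3)%:C.
Proof.
move=> sg; have [K K0 HK] := prim_taylor sg.
exists (\sum_(i < n) K * `|v i| ^+ 3).
  by apply: sumr_ge0 => i _; rewrite mulr_ge0 // exprn_ge0.
move=> e; set X := (X in `|X|).
have -> : X = \sum_(i < n) (-1) ^+ i.+1 * (prim N g (c i + e * v i) - prim N g (c i)
   - (e * v i)%:C * lau N (expi (c i)) g
   - (e * v i)%:C ^+ 2 / 2 * lau N (expi (c i)) (tder (N + N) g)).
  under [RHS]eq_bigr do rewrite !mulrBr.
  rewrite !sumrB /X /functional !mulr_sumr.
  rewrite [\sum_(i < n) (-1) ^+ i.+1 * ((e * v i)%:C * _)](eq_bigr (fun i : 'I_n =>
    e%:C * ((-1) ^+ i.+1 * (v i)%:C * lau N (expi (c i)) g))); last first.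
    by move=> i _; rewrite rmorphM /=; ring.
  rewrite [\sum_(i < n) (-1) ^+ i.+1 * ((e * v i)%:C ^+ 2 / 2 * _)](eq_bigr (fun i : 'I_n =>
    e%:C ^+ 2 * (2^-1 * ((-1) ^+ i.+1 * (v i)%:C ^+ 2 *
         lau N (expi (c i)) (tder (N + N) g))))); last first.
    by move=> i _; rewrite rmorphM /=; ring.
  ring.
apply: le_trans (ler_norm_sum _ _ _) _; rewrite mulr_suml rmorph_sum /=.
apply: ler_sum => i _; rewrite normrM normrX normrN1 expr1n mul1r.
by apply: le_trans (HK _ _) _; rewrite normrM exprMn mulrA mulrAC.
Qed.

End Configurations.

(** * First and second order conditions under motion of the endpoints *)

Section NondegenerateConfiguration.
Variables (R : realType) (N : nat).
Implicit Types (c v : nat -> R) (g : {poly R[i]}) (n : nat) (L : R).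

Lemma finite_positive_lower_bound n (f : nat -> R) : (forall i, (i < n)%N -> 0 < f i) ->
  exists2 d, 0 < d & forall i, (i < n)%N -> d <= f i.
Proof.
elim: n => [|n IH] fp; first by exists 1.
have [d d0 dn] := IH (fun i h => fp i (ltnW h)).
exists (Num.min d (f n)); first by rewrite lt_min d0 fp.
move=> i; rewrite ltnS leq_eqVlt => /orP[/eqP->|/dn h].
  by rewrite ge_min lexx orbT.
by rewrite ge_min h.
Qed.

Lemma strict_config_perturb n c v : (0 < n)%N -> strict_config n c ->
  exists2 d, 0 < d & forall e, `|e| <= d -> config n (fun i => c i + e * v i).
Proof.
move=> n0 [inc wrap].
pose gap i := if (i.+1 < n)%N then c i.+1 - c i else c 0 + 2 * pi - c n.-1.
have [|g0 g0p gle] := @finite_positive_lower_bound n gap.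
  by move=> i _; rewrite /gap; case: ifP => h; rewrite subr_gt0 ?inc.
pose V := \sum_(i < n) `|v i|.
have V0 : 0 <= V by apply: sumr_ge0.
have vV i : (i < n)%N -> `|v i| <= V.
  move=> h; rewrite /V (bigD1 (Ordinal h)) //= lerDl; exact: sumr_ge0.
have V1 : 0 < 2 * (V + 1) by lra.
(* For such [e] every endpoint moves by at most half of the smallest gap; the summand 1 keeps the
   denominator positive. *)
exists (g0 / (2 * (V + 1))); first exact: divr_gt0.
move=> e; rewrite ler_pdivlMr // => he.
have small i : (i < n)%N -> `|e * v i| <= g0 / 2.
  move=> h; rewrite normrM; apply: le_trans (_ : `|e| * (V + 1) <= _); last by lra.
  by rewrite ler_wpM2l // (le_trans (vV i h)) // lerDl.
split=> [i im|].
  have := gle i (ltnW im); rewrite /gap im.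
  by have := small _ im; have := small _ (ltnW im); rewrite !ler_norml; lra.
have := gle n.-1; rewrite /gap prednK // ltnn => /(_ (leqnn _)).
have nn : (n.-1 < n)%N by rewrite prednK.
by have := small _ nn; have := small _ n0; rewrite !ler_norml; lra.
Qed.

Lemma norm_sub_le_shift (a b t : R[i]) : `|a - b| <= `|a - (b + t)| + `|t|.
Proof. by apply: le_trans (ler_normD _ _); rewrite opprD addrA subrK. Qed.

(** In a family g0 + e g1 + e^2 g2 the term g1 needs an expansion to first order only, and g2 only
    to order zero. *)
Lemma functional_taylor1 n c v L g : (size g <= (N + N).+1)%N ->
  exists2 K : R, 0 <= K & forall e : R, `|e| <= 1 ->
  `|functional N n (fun i => c i + e * v i) L g - (functional N n c L g +
     e%:C * (\sum_(i < n) (-1) ^+ i.+1 * (v i)%:C * lau N (expi (c i)) g))|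
  <= (K * `|e| ^+ 2)%:C.
Proof.
move=> sg; have [K K0 HK] := functional_taylor n c v L sg.
set T := 2^-1 * _ in HK.
exists (K + rnorm T) => [|e e1]; first by rewrite addr_ge0 ?rnorm_ge0.
apply: le_trans (norm_sub_le_shift _ _ (e%:C ^+ 2 * T)) _.
apply: le_trans (lerD (HK e) (lexx _)) _.
rewrite normrM normrX !rnormE -rmorphXn -rmorphM -rmorphD lecR /rnorm normc_def /=.
rewrite expr0n addr0 sqrtr_sqr mulrDl [_ ^+ 2 * _]mulrC lerD // ler_wpM2l //.
by rewrite exprSr -[leRHS]mulr1 ler_wpM2l ?exprn_ge0.
Qed.

Lemma functional_taylor0 n c v L g : (size g <= (N + N).+1)%N ->
  exists2 K : R, 0 <= K & forall e : R, `|e| <= 1 ->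
  `|functional N n (fun i => c i + e * v i) L g - functional N n c L g|
  <= (K * `|e|)%:C.
Proof.
move=> sg; have [K K0 HK] := functional_taylor1 n c v L sg.
set T := \sum_(i < n) _ in HK.
exists (K + rnorm T) => [|e e1]; first by rewrite addr_ge0 ?rnorm_ge0.
apply: le_trans (norm_sub_le_shift _ _ (e%:C * T)) _.
apply: le_trans (lerD (HK e e1) (lexx _)) _.
rewrite normrM !rnormE -rmorphM -rmorphD lecR /rnorm normc_def /=.
rewrite expr0n addr0 sqrtr_sqr mulrDl [`|e| * _]mulrC lerD // ler_wpM2l //.
by rewrite expr2 -[leRHS]mulr1 ler_wpM2l.
Qed.

Lemma norm_Im_le (z : R[i]) : `|complex.Im z|%:C <= `|z|.
Proof.
rewrite normc_def lecR -[leLHS]sqrtr_sqr ler_wsqrtr // lerDr sqr_ge0 //.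
Qed.

Lemma perturbation_test n c v L (g0 g1 g2 : {poly R[i]}) (d : R) : 0 < d ->
  (size g0 <= (N + N).+1)%N -> (size g1 <= (N + N).+1)%N -> (size g2 <= (N + N).+1)%N ->
  functional N n c L g0 = 0 -> functional N n c L g1 = 0 ->
  (forall e, `|e| <= d -> functional N n (fun i => c i + e * v i) L
     (g0 + e%:C *: g1 + e%:C ^+ 2 *: g2) <= 0) ->
  \sum_(i < n) (-1) ^+ i.+1 * (v i)%:C * lau N (expi (c i)) g0 = 0 /\
  2^-1 * (\sum_(i < n) (-1) ^+ i.+1 * (v i)%:C ^+ 2 * lau N (expi (c i)) (tder (N + N) g0))
  + \sum_(i < n) (-1) ^+ i.+1 * (v i)%:C * lau N (expi (c i)) g1
  + functional N n c L g2 <= 0.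
Proof.
move=> d0 s0 s1 s2 J0 J1 H.
have [K0 K00 H0] := functional_taylor n c v L s0.
have [K1 K10 H1] := functional_taylor1 n c v L s1.
have [K2 K20 H2] := functional_taylor0 n c v L s2.
set B := \sum_(i < n) _; set Q := _ + _ + _.
have He (e : R) : `|e| <= Num.min d 1 -> exists2 E : R[i],
    `|E| <= ((K0 + K1 + K2) * `|e| ^+ 3)%:C & e%:C * B + e%:C ^+ 2 * Q + E <= 0.
  rewrite le_min => /andP[ed e1].
  have {H} := H e ed; rewrite !functionalD !functionalZ.
  move: (H0 e) (H1 e e1) (H2 e e1); rewrite J0 J1.
  set A0 := functional _ _ _ _ g0; set A1 := functional _ _ _ _ g1.
  set A2 := functional _ _ _ _ g2; set F := functional _ _ _ _ g2.
  rewrite !add0r.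
  set X0 := A0 - _; set X1 := A1 - _; set X2 := A2 - _ => h0 h1 h2 hA.
  exists (X0 + e%:C * X1 + e%:C ^+ 2 * X2); last first.
    by congr (_ <= 0): hA; rewrite /X0 /X1 /X2 /Q -/F -/B; ring.
  have ne : `|e%:C| = `|e|%:C by rewrite normc_def /= expr0n addr0 sqrtr_sqr.
  apply: le_trans (ler_normD _ _) _.
  rewrite !mulrDl !rmorphD /=; apply: lerD.
    apply: le_trans (ler_normD _ _) _; apply: lerD => //.
    rewrite normrM ne exprS mulrCA rmorphM; apply: ler_wpM2l => //.
    by rewrite lecR.
  rewrite normrM normrX ne (_ : K2 * `|e| ^+ 3 = `|e| ^+ 2 * (K2 * `|e|)); last by ring.
  rewrite rmorphM rmorphXn /=; apply: ler_wpM2l => //.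
  by rewrite exprn_ge0 // lecR.
pose K := K0 + K1 + K2.
have d1 : 0 < Num.min d 1 by rewrite lt_min d0 ltr01.
(* A complex number below 0 has imaginary part 0, so the imaginary part and its negative obey the
   same estimate as the real part; three real tests then settle B and Q. *)
have HRI e : `|e| <= Num.min d 1 ->
    [/\ e * complex.Re B + e ^+ 2 * complex.Re Q <= K * `|e| ^+ 3,
        e * complex.Im B + e ^+ 2 * complex.Im Q <= K * `|e| ^+ 3 &
        e * - complex.Im B + e ^+ 2 * - complex.Im Q <= K * `|e| ^+ 3].
  move=> /He[E Ele].
  have := le_trans (normc_ge_Re E) Ele; have := le_trans (norm_Im_le E) Ele.
  rewrite !lecR -/K -rmorphXn.
  move: B Q E {Ele He} => [b b'] [q q'] [x x'] /=; rewrite !ler_norml lecE /=.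
  move=> /andP[i1 i2] /andP[r1 r2] /andP[/eqP i3 r3].
  by split; lra.
have [RB RQ] := second_order_test d1 (fun e h => let: And3 a _ _ := HRI e h in a).
have [IB IQ] := second_order_test d1 (fun e h => let: And3 _ a _ := HRI e h in a).
have [_ IQ'] := second_order_test d1 (fun e h => let: And3 _ _ a := HRI e h in a).
have {}IQ : complex.Im Q = 0 by apply/eqP; rewrite eq_le IQ -oppr_le0 IQ'.
split; last by rewrite lecE IQ /= eqxx RQ.
by apply/eqP; rewrite eq_complex RB IB /= !eqxx.
Qed.

End NondegenerateConfiguration.

(** * Half-angle formulas on the circle *)

Section BalancedPointOffCircle.
Variable R : realType.
Implicit Types (a b t : R).

Lemma expi_inj_lt a b : a < b -> b < a + 2 * pi -> expi a != expi b.
Proof.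
move=> ab ba; apply/eqP => /eqP; apply/negP.
rewrite -subr_eq0 (_ : expi a = expi ((a + b) / 2) * expi (- ((b - a) / 2))); last first.
  by rewrite -expiD; congr expi; field.
rewrite (_ : expi b = expi ((a + b) / 2) * expi ((b - a) / 2)); last first.
  by rewrite -expiD; congr expi; field.
rewrite -mulrBr mulf_neq0 ?expi_neq0 // /expi cosN sinN.
apply/eqP => -[_ /eqP]; apply/negP; rewrite lt_eqF // -opprD oppr_lt0 addr_gt0 //;
  by apply: sin_gt0_of_pos; have := pi_gt0 R; lra.
Qed.

Lemma expi_surj (x : R[i]) a : `|x| = 1 -> x != expi a ->
  exists t, [/\ a < t, t < a + 2 * pi & x = expi t].
Proof.
move=> x1 xa; pose w := x * expi (- a).
have xw : x = w * expi a by rewrite /w -mulrA -expiD addNr expi0 mulr1.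
have w1 : `|w| = 1 by rewrite /w normrM x1 norm_expi mul1r.
have wn1 : w != 1 by apply: contraNneq xa => w1'; rewrite xw w1' mul1r.
suff [s [s0 s1 ws]] : exists s, [/\ 0 < s, s < 2 * pi & w = expi s].
  by exists (a + s); rewrite xw ws -expiD [s + a]addrC; split=> //; lra.
case: w w1 wn1 {xw} => u v w1 wn1.
have uv : u ^+ 2 + v ^+ 2 = 1.
  have := add_Re2_Im2 (u +i* v); rewrite w1 expr1n /=.
  by move=> /(congr1 (@complex.Re R)).
have u1 : -1 <= u <= 1 by apply/andP; split; nra.
have [/andP[s0 spi] cs] := acos_def u1.
have sp : 0 < acos u.
  rewrite lt_def s0 andbT; apply/eqP => s00.
  move: cs; rewrite s00 cos0 => u1'; move: wn1; rewrite -u1' eq_complex /= eqxx /=.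
  by rewrite -sqrf_eq0; apply/negP/negPn/eqP; rewrite -u1' in uv; lra.
have sv : sin (acos u) = `|v|.
  by rewrite sin_acos // (_ : 1 - u ^+ 2 = v ^+ 2) ?sqrtr_sqr //; lra.
have [v0|v0] := leP 0 v.
  exists (acos u); split=> //; first by have := pi_gt0 R; lra.
  by rewrite /expi cs sv ger0_norm.
exists (2 * pi - acos u); split; [by lra|by lra|].
rewrite [2 * pi - _]addrC expi_period.
by rewrite /expi cosN sinN cs sv ltr0_norm // opprK.
Qed.

(** From expi a - expi t = 2 'i expi ((a + t) / 2) sin ((a - t) / 2). The constant -1/2 drops out of
    signed sums, which leaves cotangents. *)
Lemma inv_expiB a t : sin ((a - t) / 2) != 0 ->
  (expi a - expi t)^-1 = (expi t)^-1 * ((cotan ((a - t) / 2))%:C / (2 * 'i) - 2^-1) :> R[i].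
Proof.
set u := (a - t) / 2 => u0.
have -> : a = t + (u + u) by rewrite /u; field.
have u0' : (sin u)%:C != 0 :> R[i] by rewrite -(rmorph0 (real_complex R)) (inj_eq (@complexI _)).
have i0 := neq0Ci R[i]; have e0 := expi_neq0 u; have t0 := expi_neq0 t.
have E : expi u - (expi u)^-1 = 2 * 'i * (sin u)%:C.
  by rewrite -expiN !expiE cosN sinN rmorphN; ring.
have E2 : (cos u)%:C = expi u - 'i * (sin u)%:C by rewrite expiE; ring.
rewrite !expiD /cotan rmorphM fmorphV /= E2.
rewrite (_ : expi t * (expi u * expi u) - expi t = expi t * expi u * (expi u - (expi u)^-1)); last by field.
rewrite (_ : (expi u - 'i * (sin u)%:C) / (sin u)%:C / (2 * 'i) - 2^-1 =
  (expi u - 2 * 'i * (sin u)%:C) / (2 * 'i * (sin u)%:C)); last first.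
  by field; rewrite u0' i0.
rewrite -{1}E opprB addrCA subrr addr0 E.
by field; rewrite u0' i0 e0 t0.
Qed.

End BalancedPointOffCircle.

(** * No strict configuration of at least two arcs is maximal *)

Section StrictConfiguration.
Variables (R : realType) (N m : nat) (c : nat -> R) (L : R).
Hypotheses (N0 : (0 < N)%N) (m1 : (1 < m)%N) (strict_c : strict_config (2 * m) c).
Let n := (2 * m)%N.
Let J := functional N n c L.
Hypothesis maximal : forall c', config n c' -> alternating n c' = alternating n c ->
  forall p : {poly R[i]}, (size p <= N.+1)%N -> functional N n c' L (p * crecip N p) <= 0.

Let sgn (i : 'I_n) : R[i] := (-1) ^+ i.+1.
Let z (i : 'I_n) : R[i] := expi (c i).

Lemma strict_config_lt i j : (i < j < n)%N -> c i < c j.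
Proof.
have [inc _] := strict_c; move=> /andP[ij jn].
elim: j ij jn => // j IH; rewrite ltnS leq_eqVlt => /orP[/eqP->|ij] jn; first exact: inc.
exact: lt_trans (IH ij (ltnW jn)) (inc _ jn).
Qed.

Lemma strict_config_wrap i j : (i < n)%N -> (j < n)%N -> c j < c i + 2 * pi.
Proof.
have [_ wrap] := strict_c => i_n j_n.
have mono k l : (k <= l < n)%N -> c k <= c l.
  rewrite leq_eqVlt => /andP[/orP[/eqP->//|kl] ln]; apply/ltW/strict_config_lt.
  by rewrite kl.
have h1 : c j <= c n.-1 by apply: mono; lia.
have h2 : c 0 <= c i by apply: mono; lia.
rewrite -/n in wrap; lra.
Qed.

Let z_unit i : `|z i| = 1.
Proof. exact: norm_expi. Qed.

Let z_inj : injective z.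
Proof.
have H (i j : 'I_n) : (i < j)%N -> z i != z j.
  move=> ij; apply: expi_inj_lt; last exact: strict_config_wrap.
  by apply: strict_config_lt; rewrite ij ltn_ord.
move=> i j /eqP ij; apply/eqP; rewrite -val_eqE /=; case: (ltngtP i j) => // /H.
  by rewrite ij.
by rewrite eq_sym ij.
Qed.

Let sgn_neq0 i : sgn i != 0.
Proof. by rewrite expf_neq0 // oppr_eq0 oner_eq0. Qed.

Let sgn_real i : sgn i \is Num.real.
Proof. by rewrite rpredX // rpredN rpred1. Qed.

Let sum_sgn : \sum_i sgn i = 0.
Proof. exact: sum_alternating_signs. Qed.

(** A solution on the circle would be expi t with t between c 0 and c 0 + 2 pi, and the half-angles
    (c i - t) / 2 would make the alternating sum of cotangents vanish. *)
Lemma balanced_point_off_circle (x : R[i]) : (forall i, x != z i) ->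
  \sum_i sgn i / (z i - x) = 0 -> `|x| != 1.
Proof.
move=> xz sx; apply/eqP => x1.
have n0 : (0 < n)%N by rewrite /n; lia.
have [t [ct tc xt]] := expi_surj x1 (xz (Ordinal n0)); rewrite /= in ct tc.
pose u i := (c i - t) / 2.
have upi i : (i < n)%N -> - pi < u i /\ u i < pi.
  move=> i_n; have := strict_config_wrap n0 i_n; have := strict_config_wrap i_n n0.
  have : c 0 <= c i.
    by case: i i_n => // i i_n; apply/ltW/strict_config_lt; rewrite i_n.
  by rewrite /u; split; lra.
have un0 i : (i < n)%N -> u i != 0.
  move=> i_n; apply: contraTneq isT => u0; move: (xz (Ordinal i_n)).
  by rewrite xt /z /= (_ : c i = t) ?eqxx //; move: u0; rewrite /u; lra.
have us i : (i < n)%N -> sin (u i) != 0.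
  move=> i_n; have [h1 h2] := upi _ i_n; case: (ltgtP (u i) 0) (un0 _ i_n) => // h _.
    by rewrite lt_eqF // sin_lt0_of_neg.
  by rewrite gt_eqF // sin_gt0_of_pos.
have m0 : (0 < m)%N by lia.
have incr i j : (i < j < n)%N -> u i < u j.
  by move=> /strict_config_lt; rewrite /u; lra.
have ulast : u n.-1 < u 0 + pi.
  by have := strict_config_wrap n0 (_ : n.-1 < n)%N; rewrite /u; (case: (n) n0 => // k _ /(_ (leqnn _))); lra.
have u00 : u 0 < 0 by rewrite /u; lra.
have [u0pi _] := upi 0 n0.
have /negP := alternating_cotan_neq0 m0 incr ulast u0pi u00 un0; apply; apply/eqP.
apply: (@complexI R); rewrite rmorph0 rmorph_sum /=.
have i0 := neq0Ci R[i].
have K0 : (expi t)^-1 / (2 * 'i) != 0 :> R[i].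
  by rewrite mulf_neq0 ?invr_eq0 ?expi_neq0 // mulf_neq0 ?pnatr_eq0.
apply: (mulfI K0); rewrite mulr0 -[RHS]sx.
transitivity ((expi t)^-1 / (2 * 'i) * \sum_(i < n) ((-1) ^+ i.+1 * cotan (u i))%:C
   - (expi t)^-1 / 2 * \sum_i sgn i); first by rewrite sum_sgn mulr0 subr0.
rewrite !mulr_sumr -sumrB.
apply: eq_bigr => i _; rewrite xt /z inv_expiB; last exact: us.
by rewrite rmorphM rmorphXn rmorphN1 /sgn -/(u i) /=; field; rewrite i0 expi_neq0.
Qed.

Let J_le0 (p : {poly R[i]}) : (size p <= N.+1)%N -> J (p * crecip N p) <= 0.
Proof.
apply: maximal => //; have [inc wrap] := strict_c.
by split=> [i h|]; apply/ltW => //; exact: inc.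
Qed.

(** Maximality tested along the path c + e v, p + e q; the condition on [v] keeps the total length
    fixed. *)
Let variation (v : nat -> R) (p q : {poly R[i]}) : \sum_(i < n) (-1) ^+ i.+1 * v i = 0 ->
  (size p <= N.+1)%N -> (size q <= N.+1)%N ->
  J (p * crecip N p) = 0 -> J (p * crecip N q + q * crecip N p) = 0 ->
  \sum_(i < n) (-1) ^+ i.+1 * (v i)%:C * lau N (z i) (p * crecip N p) = 0 /\
  2^-1 * (\sum_(i < n) (-1) ^+ i.+1 * (v i)%:C ^+ 2 * lau N (z i) (tder (N + N) (p * crecip N p)))
  + \sum_(i < n) (-1) ^+ i.+1 * (v i)%:C * lau N (z i) (p * crecip N q + q * crecip N p)
  + J (q * crecip N q) <= 0.
Proof.
move=> sv sp sq J0 J1.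
have n0 : (0 < n)%N by rewrite /n; lia.
have [d d0 dP] := strict_config_perturb v n0 strict_c.
apply: (perturbation_test d0) => //; rewrite ?size_polyM_leS ?size_crecip //.
  by rewrite (leq_trans (size_polyD _ _)) // geq_max !size_polyM_leS ?size_crecip.
move=> e /dP cfg.
have -> : p * crecip N p + e%:C *: (p * crecip N q + q * crecip N p) + e%:C ^+ 2 *: (q * crecip N q)
   = (p + e%:C *: q) * crecip N (p + e%:C *: q).
  rewrite crecipD crecipZ conj_real_complex mulrDl !mulrDr -!scalerAl -!scalerAr scalerA.
  by rewrite scalerDr expr2 !addrA.
apply: maximal => //; last first.
  by rewrite (leq_trans (size_polyD _ _)) // geq_max sp (leq_trans (size_scale_leq _ _)).
rewrite /alternating; under eq_bigr do rewrite mulrDr mulrCA.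
by rewrite big_split /= -mulr_sumr sv mulr0 addr0.
Qed.

Let lift_real (v : 'I_n -> R[i]) (k : nat) : R :=
  if insub k is Some i then complex.Re (v i) else 0.

Let lift_realE (v : 'I_n -> R[i]) (i : 'I_n) : v i \is Num.real -> (lift_real v i)%:C = v i.
Proof. by move=> vr; rewrite /lift_real valK RRe_real. Qed.

Let lift_real_sum (v : 'I_n -> R[i]) : (forall i, v i \is Num.real) -> \sum_i sgn i * v i = 0 ->
  \sum_(i < n) (-1) ^+ i.+1 * lift_real v i = 0.
Proof.
move=> vr sv; apply: (@complexI R); rewrite rmorph0 rmorph_sum -[RHS]sv.
by apply: eq_bigr => i _; rewrite rmorphM rmorphXn rmorphN1 /= lift_realE.
Qed.

Let J_crecip (g : {poly R[i]}) : (size g <= (N + N).+1)%N ->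
  J (crecip (N + N) g) = (J g)^*%R.
Proof. by move=> _; exact: functional_crecip. Qed.

(** For q = 0 and a velocity that moves only nodes i and j, the vanishing linear term equates |p|^2
    at the two nodes. *)
Let first_variation (p : {poly R[i]}) : in_kernel N J p -> forall i j, `|p.[z i]| = `|p.[z j]|.
Proof.
move=> [sp Jp] i j.
pose w k : R[i] := (sgn k)^-1 * ((k == i)%:R - (k == j)%:R).
have wr k : w k \is Num.real by rewrite rpredM ?rpredV // rpredB ?realn.
have sw : \sum_k sgn k * w k = 0.
  by under eq_bigr do rewrite -[_ * _]mulr1; rewrite sum_two_point_weights ?subrr.
have [|||E _] := @variation (lift_real w) p 0 (lift_real_sum wr sw) sp.
- by rewrite size_poly0.
- by rewrite Jp ?size_crecip.
- have c0 : crecip N (0 : {poly R[i]}) = 0.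
    by have := crecipZ N 0 (0 : {poly R[i]}); rewrite scale0r conjC0 scale0r.
  by rewrite c0 mulr0 mul0r addr0; have := functionalZ N n c L 0 0; rewrite scale0r mul0r.
move: E; under eq_bigr do rewrite lift_realE //.
rewrite sum_two_point_weights // => /eqP; rewrite subr_eq0 !lauM_crecip // -!normCK => /eqP.
by move/eqP; rewrite eqrXn2 // => /eqP.
Qed.

Let second_variation (p q : {poly R[i]}) (v : 'I_n -> R[i]) : in_kernel N J p ->
  crecip N p = p -> (size q <= N.+1)%N -> crecip N q = q ->
  (forall i, v i \is Num.real) -> \sum_i sgn i * v i = 0 -> hessian N sgn z J p q v <= 0.
Proof.
move=> [sp Jp] pp sq qq vr sv.
have [||_] := @variation (lift_real v) p q (lift_real_sum vr sv) sp sq.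
- by rewrite pp Jp.
- by rewrite pp qq [q * p]mulrC -mulr2n -scaler_nat /J functionalZ -/J Jp ?mulr0.
rewrite pp qq [q * p]mulrC; congr (_ + _ + _ <= _).
  by congr (_ * _); apply: eq_bigr => i _; rewrite lift_realE.
rewrite mulr_sumr; apply: eq_bigr => i _; rewrite lift_realE //.
by rewrite /lau hornerD /sgn; ring.
Qed.

Theorem strict_config_not_maximal (p : {poly R[i]}) : p != 0 -> (size p <= N.+1)%N ->
  J (p * crecip N p) = 0 -> False.
Proof.
move=> p0 sp J0.
have [|x xz sx] := balanced_point z_unit z_inj sgn_real sgn_neq0 sum_sgn.
  by rewrite card_ord /n; lia.
have i0 : (0 < n)%N by rewrite /n; lia.
have i1 : (1 < n)%N by rewrite /n; lia.
apply: (@no_balanced_point _ N _ sgn z J z_unit z_inj sgn_real sgn_neq0 sum_sgn _ _ _ J_crecip J_le0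
  first_variation second_variation (Ordinal i0) (Ordinal i1) x) => //.
- by move=> g h; exact: functionalD.
- by move=> a g; exact: functionalZ.
- by move=> g sg; exact: functional_tder.
- exists p => //; apply: kernel_of_isotropic => //.
  + by move=> g h; exact: functionalD.
  + by move=> a g; exact: functionalZ.
- exact: balanced_point_off_circle.
Qed.

End StrictConfiguration.

(** * Removing degenerate arcs and merging touching ones *)

Section DegenerateConfigurations.
Variable R : realType.
Implicit Types (c : nat -> R) (n i j k : nat).

Lemma config_mono n c i j : config n c -> (i <= j < n)%N -> c i <= c j.
Proof.
move=> [inc _] /andP[ij jn]; elim: j ij jn => [|j IH]; first by rewrite leqn0 => /eqP->.
rewrite leq_eqVlt => /orP[/eqP->//|ij] jn.
exact: le_trans (IH ij (ltnW jn)) (inc _ jn).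
Qed.

Lemma consecutive_signs_cancel (V : pzRingType) (a : V) k :
  (-1) ^+ k.+1 * a + (-1) ^+ k.+2 * a = 0.
Proof. by rewrite [X in _ + X * _]exprS mulN1r mulNr subrr. Qed.

(** Equal neighbours have opposite signs and cancel, and a shift by two keeps the other signs. For
    even [i] this removes a degenerate arc; for odd [i] it merges two touching arcs. *)
Lemma sum_delete_pair (V : pzRingType) (h : nat -> V) k i : (i <= k)%N -> h i = h i.+1 ->
  \sum_(j < k.+2) (-1) ^+ j.+1 * h j =
  \sum_(j < k) (-1) ^+ j.+1 * h (if (j < i)%N then nat_of_ord j else j.+2).
Proof.
elim: k => [|k IH] ik hi.
  move: ik hi; rewrite leqn0 => /eqP-> hi.
  by rewrite !big_ord_recr !big_ord0 /= hi add0r consecutive_signs_cancel.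
move: ik; rewrite leq_eqVlt => /orP[/eqP ik|ik]; last first.
  rewrite big_ord_recr IH //= [RHS]big_ord_recr /= ltnNge -ltnS ik /=.
  by rewrite [in LHS]exprS [in LHS]exprS mulrA mulrNN mulr1 mul1r.
rewrite 2!big_ord_recr /= -addrA -ik -hi consecutive_signs_cancel addr0.
by rewrite ik; apply: eq_bigr => j _; rewrite ltn_ord.
Qed.

Definition delete_pair i c j := if (j < i)%N then c j else c j.+2.

Lemma config_delete_pair n c i : (0 < n)%N -> (i <= n)%N -> config n.+2 c ->
  config n (delete_pair i c).
Proof.
move=> n0 i_n cfg; have [_ wrap] := cfg; rewrite /delete_pair; split=> [j jn|].
  case: ifP => h1; case: ifP => h2; apply: (config_mono cfg); lia.
apply: le_trans (_ : c n.+1 <= _); first by case: ifP => _; apply: (config_mono cfg); lia.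
apply: le_trans wrap _; rewrite lerD2r.
by case: ifP => _; apply: (config_mono cfg); lia.
Qed.

(* When the last arc touches the first one across c 0, the two are merged. *)
Definition merge_wrap n c j : R := if (j.+1 < n)%N then c j.+2 else c 1%N + 2 * pi.

(** The first and last terms cancel up to [P], which the shift of c 1 by a full turn absorbs. Total
    lengths are the case of the identity, integrals that of [prim]. *)
Lemma sum_merge_wrap (V : comPzRingType) (h : R -> V) (P : V) m c : (0 < m)%N ->
  (forall t, h (t + 2 * pi) = h t + P) -> c (2 * m).+1 = c 0 + 2 * pi ->
  \sum_(j < (2 * m).+2) (-1) ^+ j.+1 * h (c j) =
  \sum_(j < 2 * m) (-1) ^+ j.+1 * h (merge_wrap (2 * m) c j).
Proof.
case: m => // m _ hP cw; rewrite (_ : (2 * m.+1 = (2 * m).+2)%N) in cw *; last by lia.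
rewrite big_ord_recr [\sum_(i < (2 * m).+3) _]big_ord_recl [\sum_(i < (2 * m).+2) _]big_ord_recl.
rewrite [RHS]big_ord_recr /= {2}/merge_wrap ltnn cw !hP /= /bump /=.
rewrite !exprS exprM sqrrN !expr1n expr0.
set S := \sum_(_ < _) _; rewrite [X in _ = X + _](_ : _ = S); first by ring.
apply: eq_bigr => j _; rewrite /merge_wrap ltnS ltn_ord !add1n !exprS; ring.
Qed.

Lemma config_merge_wrap n c : (1 < n)%N -> config n.+2 c -> c n.+1 = c 0 + 2 * pi ->
  config n (merge_wrap n c).
Proof.
move=> n1 cfg cw; rewrite /merge_wrap; split=> [j jn|].
  rewrite jn; case: ifP => h; first by apply: (config_mono cfg); lia.
  apply: le_trans (_ : c n.+1 <= _); first by apply: (config_mono cfg); lia.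
  by rewrite cw lerD2r; apply: (config_mono cfg); lia.
rewrite prednK ?ltnn; last by lia.
by rewrite n1 lerD2r; apply: (config_mono cfg); lia.
Qed.

End DegenerateConfigurations.

(** * Existence of a maximal configuration *)

Section ComplexContinuity.
Variables (R : realType) (T : topologicalType).
Implicit Types (f g : T -> R[i]) (h : T -> R).

(** Stated for the two parts, so that only continuity of real-valued functions is handled. *)
Definition ccontinuous f :=
  continuous (fun x => complex.Re (f x)) /\ continuous (fun x => complex.Im (f x)).

Lemma ccontinuous_cst (a : R[i]) : ccontinuous (fun=> a).
Proof. by split=> x; exact: cvg_cst. Qed.

Lemma ccontinuousD f g : ccontinuous f -> ccontinuous g -> ccontinuous (fun x => f x + g x).
Proof.
move=> [f1 f2] [g1 g2]; split=> x.
  have -> : (fun x => complex.Re (f x + g x)) =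
      (fun x => complex.Re (f x)) \+ (fun x => complex.Re (g x)).
    by apply/funext => y; rewrite /= raddfD.
  by apply: continuousD; [exact: f1|exact: g1].
have -> : (fun x => complex.Im (f x + g x)) =
    (fun x => complex.Im (f x)) \+ (fun x => complex.Im (g x)).
  by apply/funext => y; rewrite /= raddfD.
by apply: continuousD; [exact: f2|exact: g2].
Qed.

Lemma ccontinuousM f g : ccontinuous f -> ccontinuous g -> ccontinuous (fun x => f x * g x).
Proof.
move=> [f1 f2] [g1 g2]; split=> x.
  have -> : (fun x => complex.Re (f x * g x)) =
      (fun x => complex.Re (f x) * complex.Re (g x)) \-
      (fun x => complex.Im (f x) * complex.Im (g x)).
    by apply/funext => y /=; case: (f y) (g y) => [? ?] [? ?].
  apply: continuousB; apply: continuousM; do ?[exact: f1|exact: g1|exact: f2|exact: g2].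
have -> : (fun x => complex.Im (f x * g x)) =
    (fun x => complex.Re (f x) * complex.Im (g x)) \+
    (fun x => complex.Im (f x) * complex.Re (g x)).
  by apply/funext => y /=; case: (f y) (g y) => [? ?] [? ?].
apply: continuousD; apply: continuousM; do ?[exact: f1|exact: g1|exact: f2|exact: g2].
Qed.

Lemma ccontinuous_conj f : ccontinuous f -> ccontinuous (fun x => (f x)^*%R).
Proof.
move=> [f1 f2]; split=> x.
  have -> : (fun x => complex.Re (f x)^*%R) = (fun x => complex.Re (f x)).
    by apply/funext => y /=; case: (f y).
  exact: f1.
have -> : (fun x => complex.Im (f x)^*%R) = \- (fun x => complex.Im (f x)).
  by apply/funext => y /=; case: (f y).
by apply: continuousN; exact: f2.
Qed.

Lemma ccontinuous_rect (h1 h2 : T -> R) : continuous h1 -> continuous h2 ->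
  ccontinuous (fun x => h1 x +i* h2 x).
Proof. by []. Qed.

Lemma ccontinuous_real h : continuous h -> ccontinuous (fun x => (h x)%:C).
Proof. by move=> hc; split=> //= x; exact: cvg_cst. Qed.

Lemma ccontinuous_expi h : continuous h -> ccontinuous (fun x => expi (h x)).
Proof.
move=> hc; split=> x /=.
  by apply: (@continuous_comp _ _ _ h cos); [exact: hc|exact: continuous_cos].
by apply: (@continuous_comp _ _ _ h sin); [exact: hc|exact: continuous_sin].
Qed.

Lemma ccontinuous_sum n (f : nat -> T -> R[i]) :
  (forall i, (i < n)%N -> ccontinuous (f i)) -> ccontinuous (fun x => \sum_(i < n) f i x).
Proof.
elim: n => [|n IH] fc.
  have -> : (fun x => \sum_(i < 0) f i x) = fun=> 0 by apply/funext => x; rewrite big_ord0.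
  exact: ccontinuous_cst.
have -> : (fun x => \sum_(i < n.+1) f i x) = fun x => \sum_(i < n) f i x + f n x.
  by apply/funext => x; rewrite big_ord_recr.
by apply: ccontinuousD; [apply: IH => i /ltnW; exact: fc|exact: fc].
Qed.

Lemma closed_le_continuous (h1 h2 : T -> R) : continuous h1 -> continuous h2 ->
  closed [set x | h1 x <= h2 x]%classic.
Proof.
move=> c1 c2; have -> : [set x | h1 x <= h2 x]%classic =
   ((h2 \- h1) @^-1` [set y | 0 <= y])%classic.
  by apply/seteqP; split=> x /=; rewrite subr_ge0.
apply: preimage_closed; last exact: closed_ge.
by move=> x _; apply: continuousB; [exact: c2|exact: c1].
Qed.

Lemma closed_eq_continuous (h : T -> R) (a : R) : continuous h ->
  closed [set x | h x = a]%classic.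
Proof.
move=> hc; have -> : [set x | h x = a]%classic = (h @^-1` [set a])%classic by [].
apply: preimage_closed; last exact: closed_eq.
by move=> x _; exact: hc.
Qed.

End ComplexContinuity.

Section MaximalConfiguration.
Variables (R : realType) (N : nat).
Implicit Types (c : nat -> R) (p g : {poly R[i]}) (n m : nat).

(** The mean value of |p|^2, that is the squared L^2 norm over 2 pi; [mass_sum] is Parseval's
    formula. *)
Definition mass p : R := complex.Re (p * crecip N p)`_N.

Lemma massE p : (p * crecip N p)`_N = (mass p)%:C.
Proof.
rewrite /mass RRe_real // coefM rpred_sum // => j _.
by rewrite coef_crecip ltnS leq_subr subKn ?leq_ord // -normCK rpredX ?normr_real.
Qed.

Lemma mass_sum p : mass p = \sum_(j < N.+1) (complex.Re p`_j ^+ 2 + complex.Im p`_j ^+ 2).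
Proof.
apply: (@complexI R); rewrite -massE coefM rmorph_sum; apply: eq_bigr => j _.
by rewrite coef_crecip ltnS leq_subr subKn ?leq_ord // -normCK -add_Re2_Im2.
Qed.

Lemma mass_ge0 p : 0 <= mass p.
Proof. by rewrite mass_sum sumr_ge0 // => j _; rewrite addr_ge0 ?sqr_ge0. Qed.

Lemma mass_eq0 p : (size p <= N.+1)%N -> mass p = 0 -> p = 0.
Proof.
move=> sp; rewrite mass_sum => /eqP; rewrite psumr_eq0; last first.
  by move=> j _; rewrite addr_ge0 ?sqr_ge0.
move=> /allP H; apply/polyP => k; rewrite coef0.
have [kN|Nk] := ltnP k N.+1; last by rewrite nth_default // (leq_trans sp).
have /implyP/(_ isT) := H (Ordinal kN) (mem_index_enum _).
rewrite paddr_eq0 ?sqr_ge0 // !sqrf_eq0 /=.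
by case: (p`_k) => x y /= /andP[/eqP-> /eqP->].
Qed.

Lemma coef_le_mass p k : (k < N.+1)%N -> mass p = 1 ->
  -1 <= complex.Re p`_k <= 1 /\ -1 <= complex.Im p`_k <= 1.
Proof.
move=> kN; rewrite mass_sum (bigD1 (Ordinal kN)) //=.
set S := \sum_(_ < _ | _) _ => H.
have S0 : 0 <= S by apply: sumr_ge0 => j _; rewrite addr_ge0 ?sqr_ge0.
by split; apply/andP; split; nra.
Qed.

Lemma functional_mass n c L p : functional N n c L (p * crecip N p) =
  functional N n c 0 (p * crecip N p) - (L * mass p)%:C.
Proof. by rewrite /functional massE rmorph0 mul0r subr0 rmorphM. Qed.

Lemma size_mul_crecip p : (size p <= N.+1)%N -> (size (p * crecip N p)%R <= (N + N).+1)%N.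
Proof. by move=> sp; rewrite size_polyM_leS ?size_crecip. Qed.

Lemma functional_real n c L p : (size p <= N.+1)%N ->
  functional N n c L (p * crecip N p) = (complex.Re (functional N n c L (p * crecip N p)))%:C.
Proof.
move=> sp; rewrite RRe_real // CrealE -functional_crecip crecipM ?size_crecip //.
by rewrite crecipK // mulrC.
Qed.

Lemma prim_periodz g t (k : int) :
  prim N g (t + k%:~R * (2 * pi)) = prim N g t + (k%:~R * (2 * pi))%:C * g`_N.
Proof.
elim/int_ind: k => [|k IH|k IH] in t *; first by rewrite mul0r addr0 rmorph0 mul0r addr0.
  by rewrite -addn1 PoszD intrD mulrDl mul1r addrA prim_period IH -addrA -mulrDl -rmorphD.
apply: (addIr ((2 * pi)%:C * g`_N)); rewrite -prim_period -addn1 PoszD opprD intrD.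
by rewrite mulrDl mulN1r addrA subrK IH -addrA rmorphB /= mulrBl subrK.
Qed.

Lemma functional_shift m c (k : int) L g :
  functional N (2 * m) (fun i => c i + k%:~R * (2 * pi)) L g = functional N (2 * m) c L g.
Proof.
rewrite /functional; congr (_ - _); under eq_bigr do rewrite prim_periodz mulrDr.
by rewrite big_split /= -mulr_suml sum_alternating_signs mul0r addr0.
Qed.

Lemma alternating_shift m c a : alternating (2 * m) (fun i => c i + a) = alternating (2 * m) c.
Proof.
rewrite /alternating; under eq_bigr do rewrite mulrDr.
by rewrite big_split /= -mulr_suml sum_alternating_signs mul0r addr0.
Qed.

Lemma config_shift n c a : config n c -> config n (fun i => c i + a).
Proof.
move=> [inc wrap]; split=> [i h|]; first by rewrite lerD2r inc.
by rewrite addrAC lerD2r.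
Qed.

Lemma exists_base_shift (a : R) : exists k : int, 0 <= a + k%:~R * (2 * pi) < 2 * pi.
Proof.
have p0 : 0 < 2 * pi :> R by rewrite mulr_gt0 ?pi_gt0.
exists (- Num.floor (a / (2 * pi))); have /andP[h1 h2] := floor_itv (a / (2 * pi)).
move: h1 h2; rewrite ler_pdivlMr // ltr_pdivrMr // intrD mulrDl mul1r rmorphN => h1 h2.
by apply/andP; split; rewrite /= mulNr; lra.
Qed.

Section Coordinates.
Variables (m : nat) (l : R).
Let n := (2 * m)%N.
Let D := (n + 2 * N.+1)%N.

(** A configuration and a polynomial are stored in one real row: the [n] endpoints, then alternately
    the real and imaginary parts of the N + 1 coefficients. One spare entry makes the length a
    successor, as [inord] requires. *)
Let X (x : 'rV[R]_D.+1) (j : nat) : R := x ord0 (inord j).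
Let poly_of x : {poly R[i]} := \poly_(k < N.+1) (X x (n + 2 * k) +i* X x (n + 2 * k).+1).

Let X_continuous j : continuous (X^~ j).
Proof. exact: coord_continuous. Qed.

Let coef_continuous k : ccontinuous (fun x => (poly_of x)`_k).
Proof.
have [kN|Nk] := ltnP k N.+1; last first.
  have -> : (fun x => (poly_of x)`_k) = fun=> 0.
    by apply/funext => x; rewrite coef_poly ltnNge Nk.
  exact: ccontinuous_cst.
have -> : (fun x => (poly_of x)`_k) = fun x => X x (n + 2 * k) +i* X x (n + 2 * k).+1.
  by apply/funext => x; rewrite coef_poly kN.
by apply: ccontinuous_rect; exact: X_continuous.
Qed.

Let square_continuous k : ccontinuous (fun x => (poly_of x * crecip N (poly_of x))`_k).
Proof.
have -> : (fun x => (poly_of x * crecip N (poly_of x))`_k) =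
    fun x => \sum_(j < k.+1) (poly_of x)`_j * (if (k - j < N.+1)%N then
       ((poly_of x)`_(N - (k - j)))^*%R else 0).
  by apply/funext => x; rewrite coefM; apply: eq_bigr => j _; rewrite coef_crecip.
apply: (@ccontinuous_sum _ _ k.+1 (fun j x => (poly_of x)`_j * (if (k - j < N.+1)%N then
       ((poly_of x)`_(N - (k - j)))^*%R else 0))) => j _.
apply: ccontinuousM; first exact: coef_continuous.
case: (k - j < N.+1)%N; last exact: ccontinuous_cst.
by apply: ccontinuous_conj; exact: coef_continuous.
Qed.

Let functional_continuous :
  ccontinuous (fun x => functional N n (X x) 0 (poly_of x * crecip N (poly_of x))).
Proof.
have -> : (fun x => functional N n (X x) 0 (poly_of x * crecip N (poly_of x))) =
   fun x => \sum_(i < n) (-1) ^+ i.+1 *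
     prim N (poly_of x * crecip N (poly_of x)) (X x i).
  by apply/funext => x; rewrite /functional rmorph0 mul0r subr0.
apply: (@ccontinuous_sum _ _ n (fun i x => (-1) ^+ i.+1 *
     prim N (poly_of x * crecip N (poly_of x)) (X x i))) => i _.
apply: ccontinuousM; first exact: ccontinuous_cst.
apply: (@ccontinuous_sum _ _ (N + N).+1 (fun k x =>
  (poly_of x * crecip N (poly_of x))`_k * prim_coef N k (X x i))) => k _.
apply: ccontinuousM; first exact: square_continuous.
rewrite /prim_coef; case: (k == N); first by apply: ccontinuous_real; exact: X_continuous.
apply: ccontinuousM; last exact: ccontinuous_cst.
apply: ccontinuous_expi => x; apply: (@continuousM _ _ (fun=> _) (X^~ i)); first exact: cst_continuous.
exact: X_continuous.
Qed.

(** With c 0 shifted into [0, 2 pi[ all endpoints lie below 4 pi, and mass 1 bounds the coefficients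
    by 1; the box contains both ranges. *)
Let admissible : set 'rV[R]_D.+1 := [set x : 'rV[R]_D.+1 |
  (forall j, `[- (4 * pi + 1), 4 * pi + 1]%classic (x ord0 j)) /\
  ((forall i, (i.+1 < n)%N -> X x i <= X x i.+1) /\
  (X x n.-1 <= X x 0 + 2 * pi /\ (alternating n (X x) = l /\ mass (poly_of x) = 1)))]%classic.

Let admissible_compact : compact admissible.
Proof.
apply: compact_closedI.
  by apply: (@rV_compact _ _ (fun=> `[- (4 * pi + 1), 4 * pi + 1]%classic)) => j; exact: segment_compact.
apply: closedI.
  apply: (@closed_bigI _ _ [set i | (i.+1 < n)%N]%classic
    (fun i => [set x | X x i <= X x i.+1]%classic)) => i _.
  by apply: closed_le_continuous; exact: X_continuous.
apply: closedI.
  apply: closed_le_continuous => x; first exact: X_continuous.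
  apply: (@continuousD _ _ _ (X^~ 0%N) (fun=> _)); first exact: X_continuous.
  exact: cst_continuous.
apply: closedI; last by apply: closed_eq_continuous; have [] := square_continuous N.
apply: closed_eq_continuous => x.
have [+ _] : ccontinuous (fun x => \sum_(i < n) (-1) ^+ i.+1 * (X x i)%:C).
  apply: (@ccontinuous_sum _ _ n (fun i x => (-1) ^+ i.+1 * (X x i)%:C)) => i _.
  by apply: ccontinuousM; [exact: ccontinuous_cst|exact: ccontinuous_real].
have -> : (fun x => complex.Re (\sum_(i < n) (-1) ^+ i.+1 * (X x i)%:C)) =
    (fun x => alternating n (X x)).
  apply/funext => y; rewrite (_ : \sum_(i < n) _ = (alternating n (X y))%:C) //.
  by rewrite /alternating rmorph_sum; apply: eq_bigr => i _; rewrite rmorphM rmorphXn rmorphN1.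
exact.
Qed.

Let row_of c p : 'rV[R]_D.+1 := \row_j (if (j < n)%N then c j else
  if odd (j - n) then complex.Im p`_(j - n)./2 else complex.Re p`_(j - n)./2).

Let X_row_of c p i : (i < n)%N -> X (row_of c p) i = c i.
Proof. by move=> i_n; rewrite /X mxE inordK ?i_n // /D; lia. Qed.

Let poly_row_of c p : (size p <= N.+1)%N -> poly_of (row_of c p) = p.
Proof.
move=> sp; apply/polyP => k; rewrite coef_poly; case: ltnP => [kN|Nk]; last first.
  by rewrite nth_default // (leq_trans sp).
rewrite /X !mxE !inordK; [|rewrite /D; lia..].
have -> : ((n + 2 * k)%N < n)%N = false by lia.
have -> : ((n + 2 * k).+1 < n)%N = false by lia.
rewrite -addnS !addKn /= mul2n odd_double /= uphalf_double doubleK.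
by case: (p`_k).
Qed.

(** A continuous function on a compact set has a maximum. Shifting by full turns and scaling to mass
    1 brings every competitor with [p'] nonzero into that set, whence the factor [mass p']. The data
    [c1], [p1] show that the set is nonempty. *)
Lemma exists_maximal_configuration c1 p1 : (0 < m)%N -> config n c1 -> alternating n c1 = l ->
  (size p1 <= N.+1)%N -> p1 != 0 ->
  exists c p, [/\ config n c, alternating n c = l, (size p <= N.+1)%N, mass p = 1 &
   forall c' p', config n c' -> alternating n c' = l -> (size p' <= N.+1)%N ->
     complex.Re (functional N n c' 0 (p' * crecip N p')) <=
     complex.Re (functional N n c 0 (p * crecip N p)) * mass p'].
Proof.
move=> m0; have n0 : (0 < n)%N by rewrite /n; lia.
pose f x := complex.Re (functional N n (X x) 0 (poly_of x * crecip N (poly_of x))).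
have fE c p : (size p <= N.+1)%N ->
    f (row_of c p) = complex.Re (functional N n c 0 (p * crecip N p)).
  move=> sp; rewrite /f poly_row_of // /functional; congr (complex.Re (_ - _)).
  by apply: eq_bigr => i _; rewrite X_row_of.
have massZ (r : R) p : mass (r%:C *: p) = r ^+ 2 * mass p.
  rewrite !mass_sum mulr_sumr; apply: eq_bigr => j _; rewrite coefZ.
  by case: (p`_j) => x y /=; ring.
have functionalZ2 c (r : R) p : complex.Re (functional N n c 0 (r%:C *: p * crecip N (r%:C *: p))) =
    r ^+ 2 * complex.Re (functional N n c 0 (p * crecip N p)).
  rewrite crecipZ conj_real_complex -scalerAl -scalerAr scalerA functionalZ -rmorphM /=.
  by case: (functional _ _ _ _ _) => x y /=; rewrite mul0r subr0 expr2.
have normalize c p : config n c -> alternating n c = l -> (size p <= N.+1)%N -> p != 0 ->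
    exists c' r, [/\ 0 < r, mass p = r & row_of c' ((Num.sqrt r)^-1%:C *: p) \in admissible /\
      complex.Re (functional N n c 0 (p * crecip N p)) =
      f (row_of c' ((Num.sqrt r)^-1%:C *: p)) * r].
  move=> cfg al sp p0.
  have mp : 0 < mass p.
    by rewrite lt_def mass_ge0 andbT; apply: contraNneq p0 => /(mass_eq0 sp) ->.
  have [k k0] := exists_base_shift (c 0%N).
  pose c' i := c i + k%:~R * (2 * pi).
  have cfg' : config n c' by exact: config_shift.
  exists c', (mass p); split=> //.
  set q := _ *: p.
  have sq : (size q <= N.+1)%N by apply: leq_trans (size_scale_leq _ _) _.
  have mq : mass q = 1 by rewrite massZ exprVn sqr_sqrtr ?ltW // mulVf ?gt_eqF.
  split; last first.
    rewrite fE // functionalZ2 exprVn sqr_sqrtr ?ltW // /c' functional_shift.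
    by field; rewrite gt_eqF.
  have [inc wrap] := cfg'.
  apply/mem_set; split=> [j|].
    rewrite /= in_itv /= mxE; have pi0 := pi_gt0 R; case: ifP => jn.
      have h1 : c' 0 <= c' j by apply: (config_mono cfg'); rewrite /= jn.
      have h2 : c' j <= c' n.-1 by apply: (config_mono cfg'); lia.
      move: k0; rewrite -/(c' 0%N) => /andP[k1 k2].
      by apply/andP; split; lra.
    have [kN|Nk] := ltnP (j - n)./2 N.+1.
      have [h1 h2] := coef_le_mass kN mq.
      by case: ifP => _; lra.
    rewrite nth_default ?(leq_trans sq) //=; case: ifP => _; lra.
  split=> [i i_n|]; first by rewrite !X_row_of ?inc // ltnW.
  rewrite poly_row_of // !X_row_of ?prednK //; split=> //; split=> //.
  rewrite -al -(alternating_shift m c (k%:~R * (2 * pi))); apply: eq_bigr => i _.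
  by rewrite X_row_of.
move=> cfg1 al1 sp1 p10.
have [c1' [r1 [_ _ [adm1 _]]]] := normalize c1 p1 cfg1 al1 sp1 p10.
have [||x xA xmax] := @compact_EVT_max _ R f admissible _ admissible_compact.
- by exists (row_of c1' ((Num.sqrt r1)^-1%:C *: p1)); move/set_mem: adm1.
- by apply: continuous_subspaceT; have [] := functional_continuous.
move/set_mem: (xA) => [_ [inc [wrap [al mx]]]].
exists (X x), (poly_of x); split=> //; first exact: size_poly.
move=> c p cfg al' sp; have [->|p0] := eqVneq p 0.
  rewrite (_ : 0 * _ = 0) ?mul0r //.
  have -> : mass 0 = 0 by rewrite mass_sum big1 // => j _; rewrite coef0 /= expr0n addr0.
  have := functionalZ N n c 0 0 0; rewrite scale0r mul0r => ->.
  by rewrite mulr0.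
have [c' [r [r0 mr [adm ->]]]] := normalize c p cfg al' sp p0.
by rewrite mr; apply: ler_wpM2r; [exact: ltW|exact: xmax].
Qed.

End Coordinates.
End MaximalConfiguration.

(** * Induction on the number of arcs *)

Section ConfigurationBound.
Variables (R : realType) (N : nat) (l L : R).
Hypothesis single_arc : forall (c : nat -> R) (p : {poly R[i]}), alternating 2 c = l ->
  (size p <= N.+1)%N -> functional N 2 c L (p * crecip N p) <= 0.

(** Constants see only the total length of the arcs, so for N = 0 all configurations of the same
    length are equally good. *)
Lemma functional_degree0 n (c : nat -> R) (g : {poly R[i]}) :
  functional 0 n c L g = ((alternating n c - L)%:C * g`_0).
Proof.
rewrite /functional /alternating rmorphB rmorph_sum mulrBl mulr_suml; congr (_ - _).
apply: eq_bigr => i _; rewrite /prim big_ord_recl big_ord0 addr0 /prim_coef eqxx.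
by rewrite rmorphM rmorphXn rmorphN1 /=; ring.
Qed.

Theorem configuration_bound m (c : nat -> R) (p : {poly R[i]}) : config (2 * m) c ->
  alternating (2 * m) c = l -> (size p <= N.+1)%N ->
  functional N (2 * m) c L (p * crecip N p) <= 0.
Proof.
have alt2 (a : R) : alternating 2 (fun i => a + i%:R * l) = l.
  by rewrite /alternating !big_ord_recr big_ord0 /=; ring.
have [N0|N0] := posnP N.
  move=> cfg al sp; have := single_arc (alt2 0) sp.
  by rewrite N0 !functional_degree0 alt2 al.
elim: m c p => [|m IH] c p cfg al sp.
  (* Without arcs the length is 0, and a single degenerate arc gives the claim. *)
  have l0 : l = 0 by rewrite -al /alternating muln0 big_ord0.
  have := single_arc (alt2 0) sp; rewrite /functional muln0 big_ord0.
  by rewrite !big_ord_recr big_ord0 /= l0 !mulr0 add0r consecutive_signs_cancel.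
case: m IH cfg al => [|m] IH cfg al; first exact: single_arc.
rewrite functional_real // -(rmorph0 (real_complex R)) lecR leNgt; apply/negP => pos.
have p0 : p != 0.
  apply/eqP => p0; move: pos; rewrite p0 mul0r.
  by have := functionalZ N (2 * m.+2) c L 0 0; rewrite scale0r mul0r => ->; rewrite ltxx.
have m20 : (0 < m.+2)%N by [].
have [c' [q [cfg' al' sq mq qmax]]] := exists_maximal_configuration m20 cfg al sp p0.
set n := (2 * m.+2)%N in cfg al cfg' al' qmax pos.
(* The maximal ratio for this number of arcs. With [M] in place of [L] the form is semidefinite and
   the maximiser isotropic; failure of the bound would mean L < M. *)
pose M := complex.Re (functional N n c' 0 (q * crecip N q)).
have functional_M c2 (p2 : {poly R[i]}) : (size p2 <= N.+1)%N -> functional N n c2 M (p2 * crecip N p2) =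
    (complex.Re (functional N n c2 0 (p2 * crecip N p2)) - M * mass N p2)%:C.
  by move=> s2; rewrite functional_mass [in LHS]functional_real // -rmorphB.
have LM : L < M.
  have mp : 0 < mass N p.
    by rewrite lt_def mass_ge0 andbT; apply: contraNneq p0 => /(mass_eq0 sp) ->.
  rewrite -(ltr_pM2r mp); apply: lt_le_trans (qmax _ _ cfg al sp).
  by move: pos; rewrite functional_mass raddfB /= subr_gt0.
have Jq : functional N n c' M (q * crecip N q) = 0.
  by rewrite functional_M // mq mulr1 subrr.
(* Fewer arcs with the same integral would give M <= L by induction. The conclusion holds for every
   boolean and is used at [true] as a contradiction. *)
have reduce k (c2 : nat -> R) : functional N (2 * m.+1) c2 L (q * crecip N q) <= 0 ->
    \sum_(i < n) (-1) ^+ i.+1 * prim N (q * crecip N q) (c' i) =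
    \sum_(i < 2 * m.+1) (-1) ^+ i.+1 * prim N (q * crecip N q) (c2 i) -> k = false.
  move=> le0 E; move: Jq le0; rewrite /functional E massE mq => /eqP.
  rewrite subr_eq0 => /eqP ->; rewrite !mulr1 -rmorphB -(rmorph0 (real_complex R)) lecR.
  by rewrite subr_le0 leNgt LM.
have q0 : q != 0.
  apply/eqP => q0; move: mq; rewrite q0 mass_sum big1 => [/eqP|j _].
    by rewrite eq_sym oner_eq0.
  by rewrite coef0 /= expr0n addr0.
have nE : n = (2 * m.+1).+2 by rewrite /n; lia.
have [/existsP[[i i_lt] /= /andP[i_n /eqP ci]]|noeq] :=
    boolP [exists i : 'I_n, (i.+1 < n)%N && (c' i == c' i.+1)].
  have i_le : (i <= 2 * m.+1)%N by clear -i_n nE; lia.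
  suff : true = false by [].
  apply: (reduce true (delete_pair i c')).
    apply: IH => //; first by apply: config_delete_pair => //; rewrite -nE.
    rewrite -al' /alternating nE (sum_delete_pair i_le ci).
    by apply: eq_bigr => j _; rewrite /delete_pair; case: ifP.
  rewrite nE (@sum_delete_pair _ (fun j => prim N (q * crecip N q) (c' j)) _ i i_le) ?ci //.
  by apply: eq_bigr => j _; rewrite /delete_pair; case: ifP.
have [wrap|nowrap] := eqVneq (c' n.-1) (c' 0 + 2 * pi).
  have wrap' : c' (2 * m.+1).+1 = c' 0 + 2 * pi by rewrite -wrap nE.
  suff : true = false by [].
  apply: (reduce true (merge_wrap (2 * m.+1) c')).
    apply: IH => //; first by apply: config_merge_wrap; [lia|rewrite -nE|].
    rewrite -al' /alternating nE.
    by rewrite (@sum_merge_wrap _ _ (fun t => t) (2 * pi) _ _ _ _ wrap').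
  by rewrite nE (@sum_merge_wrap _ _ (prim N (q * crecip N q)) _ _ _ _ (prim_period N _) wrap').
have [inc' wrap'] := cfg'.
apply: (@strict_config_not_maximal R N m.+2 c' M N0 _ _ _ q q0 sq Jq) => //.
  split=> [i i_n|]; last by rewrite lt_neqAle nowrap.
  rewrite lt_neqAle inc' // andbT; apply: contra noeq => ci.
  by apply/existsP; exists (Ordinal (ltnW i_n)); rewrite i_n.
move=> c2 cfg2 al2 p2 s2; rewrite functional_M // -(rmorph0 (real_complex R)) lecR subr_le0.
by apply: qmax => //; rewrite al2.
Qed.

End ConfigurationBound.

(** * Integrals over measurable sets and arcs *)

Section LebesgueIntegral.
Variable R : realType.
Implicit Types (A B : set R) (f g F : R -> R).
Local Open Scope classical_set_scope.

Definition lint A f : R := Rintegral (@completed_lebesgue_measure R) A f.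
Definition size_of A : R := fine (@completed_lebesgue_measure R A).

Lemma borel_lebesgue_measurable A :
  @measurable _ (measurableTypeR R) A -> lebesgue_measurable A.
Proof. exact: sub_caratheodory. Qed.

Lemma itv_lebesgue_measurable (i : interval R) : lebesgue_measurable [set` i].
Proof. by apply: borel_lebesgue_measurable; exact: measurable_itv. Qed.

Lemma lebesgue_measurableI A B :
  lebesgue_measurable A -> lebesgue_measurable B -> lebesgue_measurable (A `&` B).
Proof. exact: measurableI. Qed.

Lemma size_of_itv (a b : R) (b1 b2 : bool) : a <= b ->
  size_of [set` Interval (BSide b1 a) (BSide b2 b)] = b - a.
Proof.
move=> ab; rewrite /size_of (_ : completed_lebesgue_measure _ =
    lebesgue_measure ([set` Interval (BSide b1 a) (BSide b2 b)] : set R)) //.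
rewrite lebesgue_measure_itv /= lte_fin; case: ltP => [//|ba].
by have -> : a = b by [apply/eqP; rewrite eq_le ab]; rewrite subrr.
Qed.

Definition bounded_support A := exists M : R, A `<=` `[-M, M].

Lemma bounded_support_finite A : lebesgue_measurable A -> bounded_support A ->
  (completed_lebesgue_measure A < +oo)%E.
Proof.
move=> mA [M AM]; pose I : set R := `[- M, M].
have lt : (completed_lebesgue_measure I < +oo)%E.
  rewrite (_ : completed_lebesgue_measure _ = lebesgue_measure I) //.
  by rewrite lebesgue_measure_itv /=; case: ifP => _; rewrite ?ltry // -EFinB ltry.
apply: le_lt_trans lt.
by apply: le_measure => //; rewrite inE //; exact: itv_lebesgue_measurable.
Qed.

Definition tame f := continuous f /\ exists M : R, forall t, `|f t| <= M.

Lemma tame_integrable A f : lebesgue_measurable A -> bounded_support A -> tame f ->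
  (@completed_lebesgue_measure R).-integrable A (EFin \o f).
Proof.
move=> mA bA [cf [M fM]]; apply: measurable_bounded_integrable => //.
- exact: bounded_support_finite.
- move=> _ Y mY; apply: measurableI => //; apply: borel_lebesgue_measurable.
  by rewrite -[X in measurable X]setTI; exact: (measurable_realfun.continuous_measurable_fun cf).
exists M; split; first exact: num_real.
by move=> N MN t _ /=; exact: le_trans (fM t) (ltW MN).
Qed.

Lemma tame_cst a : tame (fun=> a).
Proof. by split; [move=> t; exact: cst_continuous|exists `|a|]. Qed.

Lemma tameZ a f : tame f -> tame (fun t => a * f t).
Proof.
move=> [cf [M fM]]; split.
  by move=> t; apply: (@continuousM _ _ (fun=> a) f); [exact: cst_continuous|exact: cf].
by exists (`|a| * M) => t; rewrite normrM ler_wpM2l.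
Qed.

Section Additivity.
Variable A : set R.
Hypotheses (mA : lebesgue_measurable A) (bA : bounded_support A).

Lemma lintD f g : tame f -> tame g -> lint A (fun t => f t + g t) = lint A f + lint A g.
Proof. by move=> tf tg; apply: RintegralD => //; exact: tame_integrable. Qed.

Lemma lintZ a f : tame f -> lint A (fun t => a * f t) = a * lint A f.
Proof. by move=> tf; apply: RintegralZl => //; exact: tame_integrable. Qed.

Lemma lint_cst a : lint A (fun=> a) = a * size_of A.
Proof. exact: Rintegral_cst. Qed.

Lemma le_lint f g : tame f -> tame g -> (forall t, A t -> f t <= g t) -> lint A f <= lint A g.
Proof. by move=> tf tg fg; apply: le_Rintegral => //; exact: tame_integrable. Qed.

Lemma size_of_ge0 : 0 <= size_of A.
Proof. exact: fine_ge0. Qed.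

Lemma lint_near_constant a e f : tame f -> (forall t, A t -> `|f t - a| <= e) ->
  `|lint A f - a * size_of A| <= e * size_of A.
Proof.
move=> tf H.
have h1 : lint A f <= (a + e) * size_of A.
  rewrite -lint_cst; apply: le_lint => //; first exact: tame_cst.
  by move=> t /H; rewrite ler_distl => /andP[_].
have h2 : (a - e) * size_of A <= lint A f.
  rewrite -lint_cst; apply: le_lint => //; first exact: tame_cst.
  by move=> t /H; rewrite ler_distl => /andP[+ _].
by rewrite ler_distl; move: h1 h2; rewrite mulrDl mulrBl => -> ->.
Qed.

End Additivity.

Lemma bounded_supportS A B : A `<=` B -> bounded_support B -> bounded_support A.
Proof. by move=> AB [M BM]; exists M; exact: subset_trans BM. Qed.

Lemma lint_setU A B f : lebesgue_measurable A -> lebesgue_measurable B ->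
  bounded_support (A `|` B) -> [disjoint A & B] -> tame f ->
  lint (A `|` B) f = lint A f + lint B f.
Proof.
move=> mA mB bAB dAB tf; apply: Rintegral_setU => //.
by apply: tame_integrable => //; exact: measurableU.
Qed.

Lemma size_of_lint A : lebesgue_measurable A -> size_of A = lint A (fun=> 1).
Proof. by move=> mA; rewrite lint_cst // mul1r. Qed.

End LebesgueIntegral.

(** * Replacing a measurable set by arcs, cell by cell *)

Section CellApproximation.
Variable R : realType.
Implicit Types (A B : set R) (f F : R -> R).
Local Open Scope classical_set_scope.

(** A quantitative F' = f with one constant for all [t]: errors of order h^2 on each cell of width h
    add up to order h. *)
Definition lipschitz_antiderivative f F (K : R) := forall t h, `|h| <= 1 ->
  `|f (t + h) - f t| <= K * `|h| /\ `|F (t + h) - F t - h * f t| <= K * h ^+ 2.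

Lemma le_size_of A B : lebesgue_measurable A -> lebesgue_measurable B -> A `<=` B ->
  bounded_support B -> size_of A <= size_of B.
Proof.
move=> mA mB AB bB; apply: fine_le; last by apply: le_measure; rewrite ?inE.
- by rewrite ge0_fin_numE //; apply: bounded_support_finite => //; exact: bounded_supportS bB.
- by rewrite ge0_fin_numE //; exact: bounded_support_finite.
Qed.

Lemma itv_bounded_support (a b : R) (b1 b2 : bool) :
  bounded_support [set` Interval (BSide b1 a) (BSide b2 b)].
Proof.
exists (`|a| + `|b|) => t /=; rewrite !in_itv /= => tab.
have [h1 h2] : a <= t /\ t <= b by move: tab; case: b1; case: b2 => /= /andP[? ?]; split; lra.
have := ler_norm (- a); have := ler_norm b; rewrite normrN.
have := normr_ge0 a; have := normr_ge0 b.
by move=> ? ? ? ?; apply/andP; split; lra.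
Qed.

(** Pushing [A] to an interval of the same measure at the left end of the cell costs little, since f
    varies by at most K h there. Both integrals are compared with f(a) times the measure, which
    explains the factor 2. *)
Lemma cell_bound f F K A (a h : R) : lipschitz_antiderivative f F K -> 0 <= K -> tame f ->
  0 <= h <= 1 -> lebesgue_measurable A -> A `<=` `[a, a + h[ ->
  `|lint A f - (F (a + size_of A) - F a)| <= 2 * K * h * size_of A.
Proof.
move=> fF K0 tf /andP[h0 h1] mA Aah.
have bA : bounded_support A by apply: bounded_supportS Aah _; exact: itv_bounded_support.
have s0 := size_of_ge0 A.
have sh : size_of A <= h.
  have -> : h = size_of `[a, a + h[ by rewrite size_of_itv ?lerDl // addrC addKr.
  apply: le_size_of => //; [exact: itv_lebesgue_measurable|exact: itv_bounded_support].
have e1 : `|lint A f - f a * size_of A| <= K * h * size_of A.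
  apply: lint_near_constant => // t /Aah /=; rewrite in_itv /= => /andP[at_ ta].
  have ht : `|t - a| <= h by rewrite ger0_norm; lra.
  have [+ _] := fF a (t - a) (le_trans ht h1); rewrite subrKC => H.
  by apply: le_trans H _; rewrite ler_wpM2l.
have ns : `|size_of A| <= 1 by rewrite ger0_norm //; exact: le_trans h1.
have [_ e2] := fF a _ ns.
have e3 : K * size_of A ^+ 2 <= K * h * size_of A.
  by rewrite expr2 mulrA ler_wpM2r // ler_wpM2l.
have -> : lint A f - (F (a + size_of A) - F a) =
  (lint A f - f a * size_of A) - (F (a + size_of A) - F a - size_of A * f a) by ring.
apply: le_trans (ler_normB _ _) _; lra.
Qed.

Section Cells.
Variables (A : set R) (x h : R).
Hypotheses (mA : lebesgue_measurable A) (h0 : 0 <= h).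

Definition cell j : set R := A `&` `[x + j%:R * h, x + j.+1%:R * h[.

Lemma cell_measurable j : lebesgue_measurable (cell j).
Proof. by apply: lebesgue_measurableI => //; exact: itv_lebesgue_measurable. Qed.

Lemma lint_cells f k : tame f ->
  lint (A `&` `[x, x + k%:R * h[) f = \sum_(j < k) lint (cell j) f.
Proof.
move=> tf; elim: k => [|k IH].
  rewrite big_ord0 mul0r addr0 set_itvco0 setI0; exact: Rintegral_set0.
have kh : x <= x + k%:R * h by rewrite lerDl mulr_ge0.
have kh' : x + k%:R * h <= x + k.+1%:R * h by rewrite lerD2l ler_wpM2r // ler_nat.
have mI : lebesgue_measurable (A `&` `[x, x + k%:R * h[).
  by apply: lebesgue_measurableI => //; exact: itv_lebesgue_measurable.
have E : A `&` `[x, x + k.+1%:R * h[ = (A `&` `[x, x + k%:R * h[) `|` cell k.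
  rewrite /cell -setIUr; congr (_ `&` _); apply/seteqP; split=> t /=; rewrite !in_itv /=.
    move=> /andP[h1 h2]; have [h3|h3] := ltP t (x + k%:R * h); [left|right].
      by rewrite h1.
    by rewrite h2.
  by move=> [/andP[h1 h2]|/andP[h1 h2]]; apply/andP; split; lra.
rewrite big_ord_recr -IH E /= lint_setU //; first exact: cell_measurable.
  rewrite -E; apply: bounded_supportS (@itv_bounded_support x (x + k.+1%:R * h) true true).
  by move=> t [].
apply/eqP/seteqP; split=> // t [[_ /= +] [_ /=]]; rewrite !in_itv /=.
by move=> /andP[h1 h2] /andP[h3 h4]; lra.
Qed.

(** The part of [A] in cell j is pushed to its left end: even indices give the left end of the cell,
    odd ones add the measure of that part. *)
Definition cell_endpoint i : R :=
  x + i./2%:R * h + (if odd i then size_of (cell i./2) else 0).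

Lemma cell_endpoint_even j : cell_endpoint (2 * j) = x + j%:R * h.
Proof. by rewrite /cell_endpoint mul2n doubleK odd_double addr0. Qed.

Lemma cell_endpoint_odd j : cell_endpoint (2 * j).+1 = x + j%:R * h + size_of (cell j).
Proof. by rewrite /cell_endpoint mul2n /= uphalf_double odd_double. Qed.

Lemma size_of_cell_le j : size_of (cell j) <= h.
Proof.
have -> : h = size_of `[x + j%:R * h, x + j.+1%:R * h[.
  by rewrite size_of_itv; [rewrite -natr1; ring|rewrite lerD2l ler_wpM2r // ler_nat].
apply: le_size_of; [exact: cell_measurable|exact: itv_lebesgue_measurable|by move=> t []|].
exact: itv_bounded_support.
Qed.

Lemma cell_config m : (0 < m)%N -> m%:R * h <= 2 * pi -> config (2 * m) cell_endpoint.
Proof.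
move=> m0 mh; split=> [i im|].
  have [j [->|->]] : exists j, i = (2 * j)%N \/ i = (2 * j).+1.
    exists i./2; have := odd_double_half i; rewrite -mul2n; case: (odd i) => /= E; lia.
    rewrite cell_endpoint_even cell_endpoint_odd lerDl; exact: size_of_ge0.
  rewrite cell_endpoint_odd (_ : (2 * j).+2 = (2 * j.+1)%N) ?cell_endpoint_even; last by lia.
  by have := size_of_cell_le j; rewrite -natr1 mulrDl mul1r; lra.
case: m m0 mh => // m _ mh.
rewrite (_ : (2 * m.+1).-1 = (2 * m).+1)%N; last by lia.
have c0 : cell_endpoint 0 = x by have := cell_endpoint_even 0; rewrite muln0 mul0r addr0.
rewrite cell_endpoint_odd c0.
have := size_of_cell_le m; move: mh; rewrite -natr1 mulrDl mul1r; lra.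
Qed.

Lemma cell_alternating m F : \sum_(i < 2 * m) (-1) ^+ i.+1 * F (cell_endpoint i) =
  \sum_(j < m) (F (x + j%:R * h + size_of (cell j)) - F (x + j%:R * h)).
Proof.
rewrite (alternating_sum_pairs (fun i => F (cell_endpoint i))).
by apply: eq_bigr => j _; rewrite cell_endpoint_odd cell_endpoint_even.
Qed.

Hypothesis h1 : h <= 1.
Variables (f F : R -> R) (K : R) (m : nat).
Hypotheses (fF : lipschitz_antiderivative f F K) (K0 : 0 <= K) (tf : tame f).
Hypothesis Asub : A `<=` `[x, x + m%:R * h[.

Lemma size_of_cells : size_of A = \sum_(j < m) size_of (cell j).
Proof.
rewrite size_of_lint // -{1}(setIidl Asub) lint_cells; last exact: tame_cst.
by apply: eq_bigr => j _; rewrite -size_of_lint //; exact: cell_measurable.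
Qed.

Lemma cells_bound :
  `|lint A f - \sum_(i < 2 * m) (-1) ^+ i.+1 * F (cell_endpoint i)| <= 2 * K * h * size_of A.
Proof.
rewrite cell_alternating -{1}(setIidl Asub) lint_cells // -sumrB size_of_cells mulr_sumr.
apply: le_trans (ler_norm_sum _ _ _) _; apply: ler_sum => j _.
apply: cell_bound => //; first by rewrite h0.
  exact: cell_measurable.
by move=> t [_ /=]; rewrite -natr1 mulrDl mul1r addrA.
Qed.

End Cells.
End CellApproximation.

(** * The limit of fine cells, and intervals modulo full turns *)

Section IntegralsOverArcs.
Variable R : realType.
Implicit Types (A B : set R) (f F : R -> R).
Local Open Scope classical_set_scope.

Lemma le0_of_le_div (x C : R) m0 : 0 <= C ->
  (forall m, (m0 < m)%N -> x <= C / m%:R) -> x <= 0.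
Proof.
move=> C0 H; rewrite leNgt; apply/negP => x0.
pose m := (Num.bound (C / x) + m0).+1.
have mC : C / x < m%:R.
  apply: lt_trans (archi_boundP _) _; first by rewrite divr_ge0 // ltW.
  by rewrite ltr_nat /m ltnS leq_addr.
have := H m; rewrite /m ltnS leq_addl => /(_ isT).
rewrite -/m ler_pdivlMr ?ltr0n // leNgt => /negP; apply.
by move: mC; rewrite ltr_pdivrMr // mulrC.
Qed.

(** The cell estimate for the interval itself: all cells are full, the signed sum telescopes to F y
    - F x, and the error is of order 1/m. *)
Lemma lint_itv f F (K x y : R) : lipschitz_antiderivative f F K -> 0 <= K -> tame f ->
  x <= y -> lint `[x, y[ f = F y - F x.
Proof.
move=> fF K0 tf xy; pose w := y - x; have w0 : 0 <= w by rewrite subr_ge0.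
apply/eqP; rewrite -subr_eq0 -normr_eq0 eq_le normr_ge0 andbT.
apply: (@le0_of_le_div _ (2 * K * w * w) (Num.bound w)).
  by rewrite !mulr_ge0.
move=> m wm; have m0 : 0 < m%:R :> R by rewrite ltr0n; lia.
pose h := w / m%:R; have h0 : 0 <= h by rewrite divr_ge0 // ltW.
have mh : m%:R * h = w by rewrite /h mulrC divfK // gt_eqF.
have h1 : h <= 1.
  rewrite /h ler_pdivrMr // mul1r; apply: le_trans (ltW (archi_boundP w0)) _.
  by rewrite ler_nat ltnW.
have mA : lebesgue_measurable (`[x, y[ : set R) by exact: itv_lebesgue_measurable.
have Asub : `[x, y[ `<=` `[x, x + m%:R * h[ by rewrite mh /w subrKC.
have := cells_bound mA h0 h1 fF K0 tf Asub.
rewrite cell_alternating size_of_itv //.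
have -> : \sum_(j < m) (F (x + j%:R * h + size_of (cell `[x, y[ x h j)) - F (x + j%:R * h)) =
    F y - F x.
  have cE (j : 'I_m) : size_of (cell `[x, y[ x h j) = h.
    have jm := ltn_ord j.
    rewrite /cell (_ : _ `&` _ = `[x + j%:R * h, x + j.+1%:R * h[).
      by rewrite size_of_itv; [rewrite -natr1; ring|rewrite lerD2l ler_wpM2r // ler_nat].
    rewrite setIC; apply: setIidl => t /=; rewrite !in_itv /= => /andP[t1 t2].
    have h2 : 0 <= j%:R * h by rewrite mulr_ge0.
    have h3 : j.+1%:R * h <= w by rewrite -mh ler_wpM2r // ler_nat.
    by move: h3; rewrite /w => h3; apply/andP; split; lra.
  transitivity (\sum_(j < m) (F (x + j.+1%:R * h) - F (x + j%:R * h))).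
    by apply: eq_bigr => j _; rewrite cE -natr1 mulrDl mul1r addrA.
  rewrite -(big_mkord xpredT (fun j => F (x + j.+1%:R * h) - F (x + j%:R * h))).
  by rewrite (telescope_sumr (fun j => F (x + j%:R * h))) // mh mul0r addr0 /w subrKC.
by rewrite /h -/w (_ : 2 * K * (w / m%:R) * w = 2 * K * w * w / m%:R) //; ring.
Qed.

(** The pushed cells form a configuration whose total length is exactly the measure of [A], while
    its integral is off by order 1/m only. *)
Lemma lint_le_of_configurations f F (K b : R) A : lipschitz_antiderivative f F K ->
  0 <= K -> tame f -> lebesgue_measurable A -> A `<=` `[0, 2 * pi[ ->
  (forall m c, config (2 * m) c -> alternating (2 * m) c = size_of A ->
     \sum_(i < 2 * m) (-1) ^+ i.+1 * F (c i) <= b) -> lint A f <= b.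
Proof.
move=> fF K0 tf mA Asub H; rewrite -subr_le0.
have w0 : 0 <= 2 * pi :> R by rewrite mulr_ge0 ?pi_ge0.
have s0 := size_of_ge0 A.
apply: (@le0_of_le_div _ (2 * K * (2 * pi) * size_of A) (Num.bound (2 * pi : R))).
  by rewrite !mulr_ge0 ?pi_ge0.
move=> m wm; have m0 : 0 < m%:R :> R by rewrite ltr0n; lia.
pose h : R := 2 * pi / m%:R; have h0 : 0 <= h by rewrite divr_ge0 // ltW.
have mh : m%:R * h = 2 * pi by rewrite /h mulrC divfK // gt_eqF.
have h1 : h <= 1.
  rewrite /h ler_pdivrMr // mul1r; apply: le_trans (ltW (archi_boundP w0)) _.
  by rewrite ler_nat ltnW.
have Asub' : A `<=` `[0, 0 + m%:R * h[ by rewrite mh add0r.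
have := cells_bound mA h0 h1 fF K0 tf Asub'.
have alt : alternating (2 * m) (cell_endpoint A 0 h) = size_of A.
  rewrite /alternating (cell_alternating A 0 h m id) (size_of_cells mA h0 Asub').
  by apply: eq_bigr => j _; rewrite addrAC subrr add0r.
have cfg : config (2 * m) (cell_endpoint A 0 h).
  by apply: cell_config; rewrite ?mh //; lia.
have := H m _ cfg alt; rewrite -/h ler_norml => H1 /andP[_ H2].
have : 2 * K * h * size_of A = 2 * K * (2 * pi) * size_of A / m%:R by rewrite /h; ring.
lra.
Qed.

Definition circle_window (I : set R) : set R := I `&` `[0, 2 * pi[.

(** Up to endpoints a nonempty interval is replaced by its closure if it is short, and otherwise by
    a subinterval of length 2 pi, which already covers the circle. An empty interval is replaced by
    a point. *)
Lemma interval_core (i : interval R) : exists x y, [/\ x <= y, y <= x + 2 * pi,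
  (forall t, x < t < y -> t \in i) &
  (forall t, t \in i -> x <= t <= y) \/ y = x + 2 * pi].
Proof.
have p0 : 0 < 2 * pi :> R by rewrite mulr_gt0 ?pi_gt0.
have empty : (forall t, t \notin i) -> exists x y, [/\ x <= y, y <= x + 2 * pi,
    (forall t, x < t < y -> t \in i) &
    (forall t, t \in i -> x <= t <= y) \/ y = x + 2 * pi].
  move=> ei; exists 0, 0; split => //; [by lra|by move=> t; lra|left => t ti].
  by have := ei t; rewrite ti.
case: i empty => [[b1 x|[|]] [b2 y|[|]]] empty.
- have [xy|yx] := ltP x y; last first.
    exists x, x; split; [by []|by lra|by move=> t; lra|left => t].
    by rewrite in_itv /=; case: (b1); case: (b2) => /= /andP[t1 t2]; apply/andP; split; lra.
  have [yx|xy2] := leP y (x + 2 * pi).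
    exists x, y; split; [exact: ltW|by []| |left]; move=> t; rewrite in_itv /=.
      by case: (b1); case: (b2) => /= /andP[t1 t2]; apply/andP; split; lra.
    by case: (b1); case: (b2) => /= /andP[t1 t2]; apply/andP; split; lra.
  exists x, (x + 2 * pi); split; [by lra|by []| |by right].
  move=> t; rewrite in_itv /=.
  by case: (b1); case: (b2) => /= /andP[t1 t2]; apply/andP; split; lra.
- by apply: empty => t; rewrite in_itv /= ?andbF.
- exists x, (x + 2 * pi); split; [by lra|by []| |by right].
  by move=> t /andP[t1 t2]; rewrite in_itv /= andbT; case: (b1) => /=; lra.
- exists (y - 2 * pi), y; split; [by lra|by lra| |right; lra].
  by move=> t /andP[t1 t2]; rewrite in_itv /=; case: (b2) => /=; lra.
- by apply: empty => t; rewrite in_itv /= ?andbF.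
- exists 0, (2 * pi); split; [by lra|by lra| |right; lra].
  by move=> t _; rewrite in_itv.
- by apply: empty => t; rewrite in_itv /= ?andbF.
- by apply: empty => t; rewrite in_itv /= ?andbF.
- by apply: empty => t; rewrite in_itv /= ?andbF.
Qed.

Lemma lint_null A f : lebesgue_measurable A -> bounded_support A -> size_of A = 0 -> tame f ->
  lint A f = 0.
Proof.
move=> mA bA sA tf; have [_ [M fM]] := tf.
have := @lint_near_constant _ A mA bA 0 M f tf.
rewrite sA !mulr0 subr0 normr_le0 => H; apply/eqP/H => t _.
by rewrite subr0.
Qed.

(** Finite sets are null; this absorbs the endpoints, which an arc may or may not contain. *)
Lemma lint_eq_except_finite A B (S : set R) f : lebesgue_measurable B -> bounded_support B ->
  bounded_support A -> finite_set S -> (forall t, ~ S t -> (A t <-> B t)) -> tame f ->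
  lebesgue_measurable A /\ lint A f = lint B f.
Proof.
move=> mB bB bA fS AB tf.
have fin_ok C : finite_set (C `&` S) /\ lebesgue_measurable (C `&` S) /\ size_of (C `&` S) = 0.
  have fC : finite_set (C `&` S) by apply: sub_finite_set fS => t [].
  split=> //; split.
    by apply: borel_lebesgue_measurable; apply: countable_measurable => //; exact: finite_set_countable.
  rewrite /size_of (_ : completed_lebesgue_measure _ = lebesgue_measure (C `&` S)) //.
  by rewrite countable_lebesgue_measure0 //; exact: finite_set_countable.
have mS : lebesgue_measurable S by have [_ [+ _]] := fin_ok setT; rewrite setTI.
have mBS : lebesgue_measurable (B `\` S) by exact: measurableD.
have split_lint C : lebesgue_measurable C -> bounded_support C -> lint C f = lint (C `\` S) f.
  move=> mC bC; have [_ [mCS sCS]] := fin_ok C.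
  have mD : lebesgue_measurable (C `\` S) by exact: measurableD.
  have CE : C = (C `\` S) `|` (C `&` S) by rewrite setUC setUIDK.
  rewrite {1}CE lint_setU // -?CE //.
    rewrite (lint_null mCS) ?addr0 //.
    by apply: bounded_supportS bC => t [].
  by apply/eqP/seteqP; split=> // t [[_ h] [_ /h]].
have AS : A `\` S = B `\` S.
  by apply/seteqP; split=> t [h1 h2]; split=> //; apply/AB.
have mA : lebesgue_measurable A.
  have -> : A = (A `\` S) `|` (A `&` S) by rewrite setUC setUIDK.
  apply: measurableU; first by rewrite AS.
  by have [_ []] := fin_ok A.
by split=> //; rewrite split_lint // AS -split_lint.
Qed.

End IntegralsOverArcs.

(** * Arcs seen in the fundamental domain *)

Section CircleArcs.
Variable R : realType.
Local Open Scope classical_set_scope.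

Lemma window_bounded_support (I : set R) : bounded_support (circle_window I).
Proof.
apply: bounded_supportS (@itv_bounded_support _ 0 (2 * pi) true true).
by move=> t [].
Qed.

(** With a in [0, 2 pi[ the arc meets the fundamental domain in [a, min(b, 2 pi)[ and, if it passes
    2 pi, in [0, b - 2 pi[, up to finitely many points. The constant increment [P] of F glues the
    two pieces. *)
Lemma lint_arc (I : set R) : circle_arc I -> exists a b, [/\ a <= b, b <= a + 2 * pi,
  lebesgue_measurable (circle_window I) &
  forall (f F : R -> R) (K P : R), lipschitz_antiderivative f F K -> 0 <= K -> tame f ->
    (forall t, F (t + 2 * pi) = F t + P) -> lint (circle_window I) f = F b - F a].
Proof.
have int1 (n : int) : n < 0 -> n <= -1 by lia.
have int2 (n : int) : 1 < n -> 2 <= n by lia.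
have int3 (n : int) : 0 <= n -> n <= 1 -> n = 0 \/ n = 1 by lia.
move=> [i IE]; have [x [y [xy yx core cover]]] := interval_core i.
have p0 : 0 < 2 * pi :> R by rewrite mulr_gt0 ?pi_gt0.
have [k /andP[k1 k2]] := exists_base_shift x.
pose a := x + k%:~R * (2 * pi); pose b := y + k%:~R * (2 * pi).
have a0 : 0 <= a by exact: k1.
have a2 : a < 2 * pi by exact: k2.
have ab : a <= b by rewrite lerD2r.
have ba : b <= a + 2 * pi by rewrite /a /b; lra.
pose c := Num.min b (2 * pi); pose d := Num.max 0 (b - 2 * pi).
pose B : set R := `[a, c[ `|` `[0, d[.
pose S : set R := [set a; b; b - 2 * pi].
have cb : c <= b by rewrite ge_min lexx.
have c2 : c <= 2 * pi by rewrite ge_min lexx orbT.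
have ac : a <= c by rewrite le_min ab ltW.
have d0 : 0 <= d by rewrite le_max lexx.
have da : d <= a by rewrite ge_max a0; lra.
have WB t : ~ S t -> (circle_window I t <-> B t).
  move=> St; have [ta tb tb2] : [/\ t != a, t != b & t != b - 2 * pi].
    by split; apply/eqP => tE; apply: St; rewrite /S /= tE; [left; left|left; right|right].
  rewrite /circle_window /B /= !in_itv /= IE /=; split.
    move=> [[j tj] /andP[t0 t2]].
    case: cover => [/(_ _ tj) /andP[h1 h2]|yE]; last first.
      have bE : b = a + 2 * pi by rewrite /b yE /a; ring.
      have cE : c = 2 * pi by apply/min_idPr; lra.
      have [ltta|leat] := ltP t a; [right|left]; last first.
 by apply/andP; split; rewrite ?cE.
      by rewrite t0 /= lt_max; apply/orP; right; lra.
    (* [n] counts the turns from t to its representative in [a, b]; since t and a lie in [0, 2 pi[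
       and b <= a + 2 pi, only 0 and 1 are possible. *)
    have [n hn] : exists n : int, a <= t + n%:~R * (2 * pi) <= b.
      by exists (j + k); rewrite intrD /a /b mulrDl; apply/andP; split; lra.
    have n0 : 0 <= n.
      rewrite leNgt; apply/negP => /int1.
      rewrite -(ler_int R).
      rewrite rmorphN1 => n1; have := ler_wpM2r (ltW p0) n1; rewrite mulN1r => n1p.
      case/andP: hn => h3 h4; suff : a < a by rewrite ltxx.
      by lra.
    have n1 : n <= 1.
      rewrite leNgt; apply/negP => /int2.
      rewrite -(ler_int R).
      move=> n2; have := ler_wpM2r (ltW p0) n2; rewrite -[2%:~R]/(2 : R) => n2p.
      case/andP: hn => h3 h4; suff : a < a by rewrite ltxx.
      by lra.
    have [nE|nE] := int3 _ n0 n1.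
      left; move: hn; rewrite nE mul0r addr0 => /andP[h3 h4].
      by rewrite h3 lt_min t2 andbT lt_neqAle tb h4.
    right; move: hn; rewrite nE mul1r => /andP[h3 h4].
    by rewrite t0 lt_max; apply/orP; right; rewrite lt_neqAle tb2; lra.
  move=> [/andP[h1]|/andP[h1]].
    rewrite lt_min => /andP[h2 h3]; split; last by rewrite h3 andbT; lra.
    have at_ : a < t by rewrite lt_neqAle eq_sym ta.
    exists (- k); apply: core; rewrite rmorphN mulNr; rewrite /a /b in at_ h2.
    by apply/andP; split; lra.
  rewrite lt_max => /orP[h2|h2]; first by lra.
  split; last by rewrite h1 /=; rewrite /a in ba k2; lra.
  exists (1 - k); apply: core; rewrite rmorphB mulrBl mul1r.
  by rewrite /a /b in k2 h2; apply/andP; split; lra.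
have fS : finite_set S by rewrite /S !finite_setU; do !split; exact: finite_set1.
have mac : lebesgue_measurable (`[a, c[ : set R) by exact: itv_lebesgue_measurable.
have m0d : lebesgue_measurable (`[0, d[ : set R) by exact: itv_lebesgue_measurable.
have mB : lebesgue_measurable B by exact: measurableU.
have bB : bounded_support B.
  apply: bounded_supportS (@itv_bounded_support _ 0 (2 * pi) true true) => t.
  rewrite /B /= !in_itv /= => -[|] /andP[h1 h2]; apply/andP; split; rewrite /a in h1 k1 da *; lra.
have bW := window_bounded_support I.
exists a, b; split=> //.
  by have [] := lint_eq_except_finite mB bB bW fS WB (tame_cst 0).
move=> f F K P fF K0 tf FP.
have [_ ->] := lint_eq_except_finite mB bB bW fS WB tf.
rewrite /B lint_setU //; last first.
  apply/eqP/seteqP; split=> // t [/=]; rewrite !in_itv /= => /andP[h1 h2] /andP[h3 h4].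
  suff : t < t by rewrite ltxx.
  by lra.
rewrite (lint_itv fF) // (lint_itv fF) //.
have [b2|b2] := leP b (2 * pi).
  have -> : c = b by apply/min_idPl.
  by have -> : d = 0; [apply/max_idPl; lra|rewrite subrr addr0].
have -> : c = 2 * pi by apply/min_idPr; exact: ltW.
have -> : d = b - 2 * pi by apply/max_idPr; lra.
have := FP 0; have := FP (b - 2 * pi); rewrite subrK add0r => -> ->; ring.
Qed.

Lemma size_of_arc (I : set R) : circle_arc I -> exists a b, [/\ a <= b, b <= a + 2 * pi,
  lebesgue_measurable (circle_window I), size_of (circle_window I) = b - a &
  forall (f F : R -> R) (K P : R), lipschitz_antiderivative f F K -> 0 <= K -> tame f ->
    (forall t, F (t + 2 * pi) = F t + P) -> lint (circle_window I) f = F b - F a].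
Proof.
move=> /lint_arc[a [b [ab ba mW H]]]; exists a, b; split=> //.
rewrite size_of_lint //; apply: (H (fun=> 1) id 0 (2 * pi)) => //; last exact: tame_cst.
move=> t h _; split; first by rewrite subrr normr0 mul0r.
by rewrite mulr1 /= (_ : t + h - t - h = 0) ?normr0 ?mul0r //; ring.
Qed.

End CircleArcs.

(** * Moments and eigenvalues *)

Section Moments.
Variables (R : realType) (N : nat).
Implicit Types (A E : set R) (g p q : {poly R[i]}) (f : R -> R[i]).

Definition ctame f := ccontinuous f /\ exists M : R, forall t, rnorm (f t) <= M.

Lemma rnormD (x y : R[i]) : rnorm (x + y) <= rnorm x + rnorm y.
Proof. by rewrite -lecR rmorphD -!rnormE; exact: ler_normD. Qed.

Lemma rnormM (x y : R[i]) : rnorm (x * y) = rnorm x * rnorm y.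
Proof. by apply: (@complexI R); rewrite rmorphM -!rnormE normrM. Qed.

Lemma norm_Re_le_rnorm (x : R[i]) : `|complex.Re x| <= rnorm x.
Proof. by rewrite -lecR -rnormE; exact: normc_ge_Re. Qed.

Lemma norm_Im_le_rnorm (x : R[i]) : `|complex.Im x| <= rnorm x.
Proof. by rewrite -lecR -rnormE; exact: norm_Im_le. Qed.

Lemma ctame_Re f : ctame f -> tame (fun t => complex.Re (f t)).
Proof.
move=> [[c1 c2] [M fM]]; split=> //; exists M => t.
exact: le_trans (norm_Re_le_rnorm _) (fM t).
Qed.

Lemma ctame_Im f : ctame f -> tame (fun t => complex.Im (f t)).
Proof.
move=> [[c1 c2] [M fM]]; split=> //; exists M => t.
exact: le_trans (norm_Im_le_rnorm _) (fM t).
Qed.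

Lemma lau_expi_norm g t : (size g <= (N + N).+1)%N ->
  rnorm (lau N (expi t) g) <= \sum_(k < (N + N).+1) rnorm g`_k.
Proof.
move=> sg; rewrite lau_expi // -lecR -rnormE rmorph_sum.
apply: le_trans (ler_norm_sum _ _ _) _; apply: ler_sum => k _.
by rewrite normrM norm_expi mulr1 rnormE.
Qed.

Lemma ctame_lau g : (size g <= (N + N).+1)%N -> ctame (fun t => lau N (expi t) g).
Proof.
move=> sg; split; last by exists (\sum_(k < (N + N).+1) rnorm g`_k) => t; exact: lau_expi_norm.
have -> : (fun t => lau N (expi t) g) =
    (fun t => \sum_(k < (N + N).+1) g`_k * expi (freq R N k * t)).
  by apply/funext => t; rewrite lau_expi.
apply: (@ccontinuous_sum _ _ (N + N).+1 (fun k t => g`_k * expi (freq R N k * t))) => k _.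
apply: ccontinuousM; first exact: ccontinuous_cst.
apply: ccontinuous_expi => x; apply: (@continuousM _ _ (fun=> freq R N k) id).
  exact: cst_continuous.
exact: cvg_id.
Qed.

Lemma prim_bounds g : (size g <= (N + N).+1)%N -> exists2 K : R, 0 <= K & forall t h, `|h| <= 1 ->
  rnorm (prim N g (t + h) - prim N g t) <= K * `|h| /\
  rnorm (prim N g (t + h) - prim N g t - h%:C * lau N (expi t) g) <= K * h ^+ 2.
Proof.
move=> sg; have [K K0 HK] := prim_taylor sg.
pose B1 := \sum_(k < (N + N).+1) rnorm g`_k.
pose B2 := \sum_(k < (N + N).+1) rnorm (tder (N + N) g)`_k.
have B10 : 0 <= B1 by apply: sumr_ge0 => k _; exact: rnorm_ge0.
have B20 : 0 <= B2 by apply: sumr_ge0 => k _; exact: rnorm_ge0.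
exists (K + B1 + B2); first by rewrite !addr_ge0.
move=> t h h1; have h0 := normr_ge0 h.
have n1 : rnorm (lau N (expi t) g) <= B1 by exact: lau_expi_norm.
have n2 : rnorm (lau N (expi t) (tder (N + N) g)) <= B2.
  by apply: lau_expi_norm; exact: leq_trans (size_tder _ _) _.
have H := HK t h; rewrite rnormE lecR in H.
have rh (x : R) : rnorm x%:C = `|x| by rewrite /rnorm normc_def /= expr0n addr0 sqrtr_sqr.
have e2 : rnorm (prim N g (t + h) - prim N g t - h%:C * lau N (expi t) g) <= (K + B2) * `|h| ^+ 2.
  set X := prim N g (t + h) - _ - _ in H *; set T := h%:C ^+ 2 / 2 * _ in H.
  have -> : X = (X - T) + T by rewrite subrK.
  apply: le_trans (rnormD _ _) _; rewrite mulrDl; apply: lerD.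
    apply: le_trans H _; by rewrite ler_wpM2l // exprSr ler_piMr ?exprn_ge0.
  rewrite /T (_ : h%:C ^+ 2 / 2 = (h ^+ 2 / 2)%:C); last by rewrite rmorphM rmorphXn fmorphV rmorph_nat.
  rewrite rnormM rh mulrC ger0_norm ?divr_ge0 ?sqr_ge0 // -real_normK ?num_real //.
  have : 0 <= `|h| ^+ 2 by exact: exprn_ge0.
  move=> hh; apply: ler_pM => //; try exact: rnorm_ge0; lra.
split; last first.
  apply: le_trans e2 _; rewrite real_normK ?num_real // ler_wpM2r ?sqr_ge0 //; lra.
set X := prim N g (t + h) - _ in e2 *; set Y := h%:C * _ in e2.
have -> : X = (X - Y) + Y by rewrite subrK.
apply: le_trans (rnormD _ _) _.
have e1 : rnorm Y <= B1 * `|h| by rewrite /Y rnormM rh mulrC ler_wpM2r.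
have e3 : (K + B2) * `|h| ^+ 2 <= (K + B2) * `|h|.
  by rewrite ler_wpM2l ?addr_ge0 // expr2 -[leRHS]mulr1 ler_wpM2l.
rewrite !mulrDl in e2 e3 *; lra.
Qed.

(** z^(-N) g is itself a primitive, up to a constant, of its derivative [tder (N + N) g]; so
    [prim_bounds] also yields the Lipschitz bound. *)
Lemma lau_lipschitz_antiderivative g : (size g <= (N + N).+1)%N -> exists2 K : R, 0 <= K &
  lipschitz_antiderivative (fun t => complex.Re (lau N (expi t) g))
    (fun t => complex.Re (prim N g t)) K.
Proof.
move=> sg; have [K K0 HK] := prim_bounds sg.
have [K' K'0 HK'] := prim_bounds (leq_trans (size_tder (N + N) g) sg).
exists (K + K'); first exact: addr_ge0.
move=> t h h1; split.
  have [H _] := HK' t h h1; have {}H := le_trans (norm_Re_le_rnorm _) H.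
  rewrite !prim_tder // opprB addrA subrK raddfB /= in H.
  by apply: le_trans H _; rewrite ler_wpM2r // lerDr.
have [_ H] := HK t h h1; have {}H := le_trans (norm_Re_le_rnorm _) H.
move: H; rewrite !raddfB /=.
rewrite (_ : complex.Re (h%:C * lau N (expi t) g) = h * complex.Re (lau N (expi t) g)).
  by move=> H; apply: le_trans H _; rewrite ler_wpM2r ?sqr_ge0 // lerDl.
by case: (lau N (expi t) g) => x y /=; rewrite mul0r subr0.
Qed.

Definition cint A f : R[i] :=
  lint A (fun t => complex.Re (f t)) +i* lint A (fun t => complex.Im (f t)).

Definition moment A g : R[i] := cint A (fun t => lau N (expi t) g).

Section MomentLinearity.
Variable A : set R.
Hypotheses (mA : lebesgue_measurable A) (bA : bounded_support A).

Lemma cintD f1 f2 : ctame f1 -> ctame f2 -> cint A (fun t => f1 t + f2 t) = cint A f1 + cint A f2.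
Proof.
move=> t1 t2; rewrite /cint; apply/eqP; rewrite eq_complex /=; apply/andP; split; apply/eqP.
  rewrite -lintD //; [|exact: ctame_Re..].
  by congr lint; apply/funext => t; rewrite raddfD.
rewrite -lintD //; [|exact: ctame_Im..].
by congr lint; apply/funext => t; rewrite raddfD.
Qed.

Lemma cintZ a f : ctame f -> cint A (fun t => a * f t) = a * cint A f.
Proof.
move=> tf; have r1 := ctame_Re tf; have r2 := ctame_Im tf.
case: a => x y; apply/eqP; rewrite eq_complex /=; apply/andP; split; apply/eqP.
  rewrite -!lintZ // -[RHS]addrC -mulN1r -lintZ //; last exact: tameZ.
  rewrite -lintD //; [|exact/tameZ/tameZ|exact: tameZ].
  by congr lint; apply/funext => t; case: (f t) => u v /=; ring.
rewrite -!lintZ // -lintD //; [|exact: tameZ..].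
by congr lint; apply/funext => t; case: (f t) => u v /=; ring.
Qed.

Lemma momentD g (g' : {poly R[i]}) : (size g <= (N + N).+1)%N -> (size g' <= (N + N).+1)%N ->
  moment A (g + g') = moment A g + moment A g'.
Proof.
move=> sg sg'; rewrite /moment -cintD; [|exact: ctame_lau..].
by congr cint; apply/funext => t; rewrite /lau hornerD mulrDr.
Qed.

Lemma momentZ a g : (size g <= (N + N).+1)%N -> moment A (a *: g) = a * moment A g.
Proof.
move=> sg; rewrite /moment -cintZ; last exact: ctame_lau.
by congr cint; apply/funext => t; rewrite /lau hornerZ mulrCA.
Qed.

Lemma Re_moment g : complex.Re (moment A g) = lint A (fun t => complex.Re (lau N (expi t) g)).
Proof. by []. Qed.

End MomentLinearity.

Lemma moment_arc A (a b : R) : lebesgue_measurable A -> bounded_support A ->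
  (forall (f F : R -> R) (K P : R), lipschitz_antiderivative f F K -> 0 <= K -> tame f ->
    (forall t, F (t + 2 * pi) = F t + P) -> lint A f = F b - F a) ->
  forall g, (size g <= (N + N).+1)%N -> moment A g = prim N g b - prim N g a.
Proof.
move=> mA bA H.
have HRe g : (size g <= (N + N).+1)%N ->
    complex.Re (moment A g) = complex.Re (prim N g b - prim N g a).
  move=> sg; have [K K0 HK] := lau_lipschitz_antiderivative sg.
  rewrite Re_moment raddfB /= (H _ _ _ (complex.Re ((2 * pi)%:C * g`_N)) HK K0) //.
    exact: ctame_Re (ctame_lau sg).
  by move=> t; rewrite prim_period raddfD.
move=> g sg; apply/eqP; rewrite eq_complex HRe // eqxx andTb.
(* The imaginary part for g is the real part for - 'i g. *)
have := HRe ((- 'i%R) *: g) (leq_trans (size_scale_leq _ _) sg).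
rewrite momentZ // !primZ -mulrBr imaginaryE.
case: (moment A g) (prim N g b - prim N g a) => x y [u v] /=.
by rewrite oppr0 !mul0r => imE; apply/eqP; lra.
Qed.

Lemma moment_circle g : (size g <= (N + N).+1)%N ->
  moment `[0, 2 * pi[%classic g = (2 * pi)%:C * g`_N.
Proof.
move=> sg; rewrite (@moment_arc _ 0 (0 + 2 * pi)) //.
- by rewrite prim_period addrC addKr.
- exact: itv_lebesgue_measurable.
- exact: itv_bounded_support.
move=> f F K P fF K0 tf _; rewrite add0r (lint_itv fF) //.
by rewrite mulr_ge0 ?pi_ge0.
Qed.

End Moments.

(** * The operator and its eigenvalues in terms of coefficients and moments *)

Section Eigenvalues.
Variables (R : realType) (N : nat).
Implicit Types (A E : set R) (p q : {poly R[i]}) (f : R -> R[i]).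

Definition trig_fun p : R -> R[i] := fun t => p.[expi t].

Lemma A_trig_fun p : (size p <= N.+1)%N -> A_ N (trig_fun p).
Proof.
move=> sp; exists (fun k => p`_k); apply/funext => t.
rewrite /trig_fun (horner_coef_wide _ sp); apply: eq_bigr => k _.
by rewrite expi_mulrn.
Qed.

Lemma A_trig_funP f : A_ N f -> exists2 p : {poly R[i]}, (size p <= N.+1)%N & f = trig_fun p.
Proof.
move=> [c ->]; exists (\poly_(k < N.+1) (if insub k is Some j then c j else 0)).
  exact: size_poly.
apply/funext => t; rewrite /trig_fun horner_poly; apply: eq_bigr => k _.
by rewrite valK expi_mulrn.
Qed.

Lemma trig_funM_conj p q t : (size q <= N.+1)%N ->
  trig_fun p t * (trig_fun q t)^*%R = lau N (expi t) (p * crecip N q).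
Proof.
move=> sq; symmetry.
exact: (@lauM_crecip _ N unit (fun=> expi t) (fun=> norm_expi t) p q tt sq).
Qed.

Let size_mul p q : (size p <= N.+1)%N -> (size (p * crecip N q)%R <= (N + N).+1)%N.
Proof. by move=> sp; rewrite size_polyM_leS ?size_crecip. Qed.

Lemma inner_trig_fun p q : (size p <= N.+1)%N -> (size q <= N.+1)%N ->
  inner (trig_fun p) (trig_fun q) = (2 * pi)%:C * (p * crecip N q)`_N.
Proof.
move=> sp sq; rewrite -moment_circle ?size_mul //.
by rewrite /inner; congr circle_integral; apply/funext => t; rewrite trig_funM_conj.
Qed.

Section MaskedInner.
Variable E : set R.
Hypothesis mE : lebesgue_measurable E.

Let I0 : set R := `[0, 2 * pi[%classic.
Let mI : lebesgue_measurable I0.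
Proof. exact: itv_lebesgue_measurable. Qed.
Let bI : bounded_support I0.
Proof. exact: itv_bounded_support. Qed.

Lemma window_measurable : lebesgue_measurable (circle_window E).
Proof. exact: lebesgue_measurableI. Qed.

Lemma masked_restrict (h : R -> R) : (fun t => \1_E t * h t) = (h \_ E)%classic.
Proof.
apply/funext => t; rewrite /patch indicE; case: ifP => _; first by rewrite mul1r.
by rewrite mul0r.
Qed.

Lemma lint_mask (h : R -> R) : lint I0 (fun t => \1_E t * h t) = lint (circle_window E) h.
Proof.
rewrite masked_restrict /lint -Rintegral_mkcondr /circle_window.
by rewrite classical_sets.setIC.
Qed.

Lemma mask_integrable (h : R -> R) : tame h ->
  (@completed_lebesgue_measure R).-integrable I0 (EFin \o (fun t => \1_E t * h t)).
Proof.
move=> th; rewrite masked_restrict -restrict_EFin.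
apply/integrable_restrict => //.
rewrite classical_sets.setIC; apply: tame_integrable => //; last exact: window_bounded_support.
exact: window_measurable.
Qed.

Lemma lint_maskB (h1 h2 : R -> R) : tame h1 -> tame h2 ->
  lint I0 (fun t => \1_E t * h1 t - h2 t) = lint (circle_window E) h1 - lint I0 h2.
Proof.
move=> t1 t2; rewrite -lint_mask; apply: RintegralB => //; first exact: mask_integrable.
exact: tame_integrable.
Qed.

Lemma inner_mask_sub p (g q : {poly R[i]}) : (size p <= N.+1)%N -> (size g <= N.+1)%N -> (size q <= N.+1)%N ->
  inner (M_ E (trig_fun p) \- trig_fun g) (trig_fun q) =
  moment N (circle_window E) (p * crecip N q) - (2 * pi)%:C * (g * crecip N q)`_N.
Proof.
move=> sp sg sq; rewrite -moment_circle ?size_mul // /inner /circle_integral.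
have tp := ctame_lau (size_mul q sp); have tg := ctame_lau (size_mul q sg).
have fE t : (M_ E (trig_fun p) \- trig_fun g) t * (trig_fun q t)^*%R =
    (\1_E t)%:C * lau N (expi t) (p * crecip N q) - lau N (expi t) (g * crecip N q).
  by rewrite -!trig_funM_conj // /M_ /= mulrBl mulrA.
apply/eqP; rewrite eq_complex; apply/andP; split; apply/eqP; rewrite /=.
  rewrite -[LHS]/(lint I0 _) -lint_maskB; [|exact: ctame_Re..].
  congr lint; apply/funext => t; rewrite fE.
  by case: (lau _ _ _) (lau _ _ _) => x y [u v] /=; rewrite mul0r subr0.
rewrite -[LHS]/(lint I0 _) -lint_maskB; [|exact: ctame_Im..].
congr lint; apply/funext => t; rewrite fE.
by case: (lau _ _ _) (lau _ _ _) => x y [u v] /=; rewrite mul0r addr0.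
Qed.

End MaskedInner.

Lemma coef_mul_crecipXn p k : (k < N.+1)%N -> (p * crecip N 'X^k)`_N = p`_k.
Proof.
move=> kN; have -> : crecip N 'X^k = 'X^(N - k) :> {poly R[i]}.
  apply/polyP => j; rewrite coef_crecip !coefXn.
  case: ltnP => jN; last by case: eqP => // jE; lia.
  by rewrite (_ : (N - j == k)%N = (j == N - k)%N) ?conjC_nat //; apply/eqP/eqP; lia.
by rewrite coefMXn (_ : (N < N - k)%N = false) ?subKn //; lia.
Qed.

Lemma coef_determined p q : (size p <= N.+1)%N -> (size q <= N.+1)%N ->
  (forall r : {poly R[i]}, (size r <= N.+1)%N -> (p * crecip N r)`_N = (q * crecip N r)`_N) -> p = q.
Proof.
move=> sp sq H; apply/polyP => k; have [kN|Nk] := ltnP k N.+1; last first.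
  by rewrite !nth_default // ?(leq_trans sp) ?(leq_trans sq).
by have := H 'X^k; rewrite size_polyXn !coef_mul_crecipXn // => /(_ kN).
Qed.

Lemma crecip_expansion q : (size q <= N.+1)%N ->
  crecip N q = \sum_(k < N.+1) (q`_k)^*%R *: crecip N 'X^k.
Proof.
move=> sq; have {1}-> : q = \sum_(k < N.+1) q`_k *: 'X^k.
  rewrite -[LHS]coefK poly_def (big_ord_widen_cond _ xpredT (fun k => q`_k *: 'X^k) sq).
  rewrite big_mkcond; apply: eq_bigr => k _; case: ifP => // /negbT; rewrite -leqNgt => h.
  by rewrite nth_default ?scale0r.
elim: N.+1 => [|n IH]; last by rewrite !big_ord_recr /= crecipD IH crecipZ.
rewrite !big_ord0; have := crecipZ N 0 (0 : {poly R[i]}).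
by rewrite scale0r conjC0 scale0r.
Qed.

Lemma moment_sum A n (c : nat -> R[i]) (g : nat -> {poly R[i]}) : lebesgue_measurable A ->
  bounded_support A -> (forall k, (k < n)%N -> (size (g k) <= (N + N).+1)%N) ->
  moment N A (\sum_(k < n) c k *: g k) = \sum_(k < n) c k * moment N A (g k).
Proof.
move=> mA bA; elim: n => [|n IH] sg.
  rewrite !big_ord0; have := @momentZ R N A mA bA 0 0; rewrite scale0r mul0r; apply.
  by rewrite size_poly0.
rewrite !big_ord_recr /= momentD // ?momentZ ?IH ?sg //.
- by move=> k kn; apply: sg; exact: ltnW.
- apply: leq_trans (size_sum _ _ _) _; apply/bigmax_leqP => k _.
  by apply: leq_trans (size_scale_leq _ _) _; apply: sg; exact: leqW.
- by apply: leq_trans (size_scale_leq _ _) _; exact: sg.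
Qed.

Lemma trig_fun_inj p q : (size p <= N.+1)%N -> (size q <= N.+1)%N ->
  trig_fun p = trig_fun q -> p = q.
Proof.
move=> sp sq pq; apply: coef_determined => // r sr.
have p0 : (2 * pi)%:C != 0 :> R[i].
  by rewrite -(rmorph0 (real_complex R)) (inj_eq (@complexI _)) mulf_neq0 ?pnatr_eq0 // gt_eqF ?pi_gt0.
by apply: (mulfI p0); rewrite -!inner_trig_fun // pq.
Qed.

Lemma P_trig_fun p : (size p <= N.+1)%N -> P_ N (trig_fun p) = trig_fun p.
Proof.
move=> sp; rewrite /P_; apply: xget_unique.
  split; first exact: A_trig_fun.
  move=> f /A_trig_funP[q sq ->].
  rewrite (_ : trig_fun p \- trig_fun p = trig_fun 0); last first.
    by apply/funext => t; rewrite /trig_fun /= subrr horner0.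
  by rewrite inner_trig_fun ?size_poly0 // mul0r coef0 mulr0.
move=> f [/A_trig_funP[g sg ->] H]; congr trig_fun; symmetry; apply: coef_determined => // r sr.
have := H _ (A_trig_fun sr).
rewrite (_ : trig_fun p \- trig_fun g = trig_fun (p - g)); last first.
  by apply/funext => t; rewrite /trig_fun /= hornerD hornerN.
rewrite inner_trig_fun // ?(leq_trans (size_polyD _ _)) ?geq_max ?sp ?size_polyN //.
move/eqP; rewrite mulf_eq0 -(rmorph0 (real_complex R)) (inj_eq (@complexI _)).
rewrite mulf_eq0 pnatr_eq0 /= gt_eqF ?pi_gt0 //= rmorph0 mulrBl coefB subr_eq0 => /eqP.
by [].
Qed.

(** The coefficients of the projection are the Fourier coefficients of the masked function, namely
    moments against monomials over 2 pi; the general [q] follows by conjugate linearity. *)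
Lemma T_trig_fun E p : lebesgue_measurable E -> (size p <= N.+1)%N ->
  exists g : {poly R[i]}, [/\ (size g <= N.+1)%N, T_ N E (trig_fun p) = trig_fun g &
   forall q : {poly R[i]}, (size q <= N.+1)%N ->
     moment N (circle_window E) (p * crecip N q) = (2 * pi)%:C * (g * crecip N q)`_N].
Proof.
move=> mE sp; rewrite /T_ P_trig_fun //.
have p0 : (2 * pi)%:C != 0 :> R[i].
  by rewrite -(rmorph0 (real_complex R)) (inj_eq (@complexI _)) mulf_neq0 ?pnatr_eq0 // gt_eqF ?pi_gt0.
have mW := window_measurable mE; have bW := @window_bounded_support _ E.
pose g := \poly_(k < N.+1) ((2 * pi)%:C^-1 * moment N (circle_window E) (p * crecip N 'X^k)).
have sg : (size g <= N.+1)%N by exact: size_poly.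
have gE q : (size q <= N.+1)%N ->
    moment N (circle_window E) (p * crecip N q) = (2 * pi)%:C * (g * crecip N q)`_N.
  move=> sq.
  rewrite (crecip_expansion sq) !mulr_sumr coef_sum mulr_sumr.
  under eq_bigr do rewrite -scalerAr.
  rewrite (@moment_sum _ N.+1 (fun k => (q`_k)^*%R) (fun k => p * crecip N 'X^k)) //; last first.
    by move=> k _; exact: size_mul.
  apply: eq_bigr => k _; rewrite -scalerAr coefZ coef_mul_crecipXn // coef_poly ltn_ord.
  by rewrite [RHS]mulrCA mulVKf.
exists g; split=> //; rewrite /P_; apply: xget_unique.
  split; first exact: A_trig_fun.
  by move=> f /A_trig_funP[q sq ->]; rewrite inner_mask_sub // gE // subrr.
move=> f [/A_trig_funP[g2 sg2 ->] H]; congr trig_fun; apply: coef_determined => // r sr.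
have := H _ (A_trig_fun sr); rewrite inner_mask_sub // gE // => /eqP.
by rewrite subr_eq0 (inj_eq (mulfI p0)) => /eqP ->.
Qed.

(** The weak form of the eigenvalue equation: moments over the set represent the operator, and 2 pi
    times the coefficient of index [N] is the inner product. *)
Lemma eigenvalueP E (l : R) : lebesgue_measurable E ->
  is_eigenvalue N (T_ N E) l%:C <-> exists p : {poly R[i]}, [/\ p != 0, (size p <= N.+1)%N &
    forall q : {poly R[i]}, (size q <= N.+1)%N ->
      moment N (circle_window E) (p * crecip N q) = (2 * pi * l)%:C * (p * crecip N q)`_N].
Proof.
move=> mE; split.
  move=> [f [/A_trig_funP[p sp ->] f0 Tf]].
  exists p; split=> //.
    by apply: contra_notN f0 => /eqP ->; apply/funext => t; rewrite /trig_fun horner0.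
  move=> q sq; have [g [sg Tg ->]] := T_trig_fun mE sp; last by [].
  have -> : g = l%:C *: p.
    apply: trig_fun_inj => //; first exact: leq_trans (size_scale_leq _ _) _.
    by rewrite -Tg Tf; apply/funext => t; rewrite /trig_fun hornerZ.
  by rewrite -(scalerAl l%:C p) coefZ mulrA -rmorphM.
move=> [p [p0 sp H]]; exists (trig_fun p); split; first exact: A_trig_fun.
  move=> pf; move/eqP: p0; apply; apply: trig_fun_inj; rewrite ?size_poly0 // pf.
  by apply/funext => t; rewrite /trig_fun horner0.
have [g [sg Tg gE]] := T_trig_fun mE sp.
have pi0 : (2 * pi)%:C != 0 :> R[i].
  by rewrite -(rmorph0 (real_complex R)) (inj_eq (@complexI _)) mulf_neq0 ?pnatr_eq0 // gt_eqF ?pi_gt0.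
rewrite Tg (_ : g = l%:C *: p); first by apply/funext => t; rewrite /trig_fun hornerZ.
apply: coef_determined => //; first exact: leq_trans (size_scale_leq _ _) _.
move=> r sr; apply: (mulfI pi0); rewrite -gE // H //.
by rewrite -(scalerAl l%:C p) coefZ mulrA -rmorphM.
Qed.

End Eigenvalues.

(** * Extremal polynomials for a single arc *)

Section ArcConcentration.
Variables (R : realType) (N : nat).
Implicit Types (p q g : {poly R[i]}).

Lemma circle_arc_measurable (I : set R) : circle_arc I -> lebesgue_measurable I.
Proof.
move=> [i ->].
rewrite (_ : [set t | _]%classic = (\bigcup_(k in [set: int])
    ((fun t => t + k%:~R * (2 * pi)) @^-1` [set` i]))%classic); last first.
  by apply/seteqP; split=> t /= [k]; [exists k|exists k].
apply: borel_lebesgue_measurable; apply: countable_bigcupT_measurable => [|k].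
  exact: countableP.
rewrite -[X in measurable X]setTI; apply: measurable_realfun.continuous_measurable_fun => //.
move=> t; apply: (@continuousD _ _ _ id (fun=> _)); [exact: cvg_id|exact: cst_continuous].
Qed.

Definition rotate (s : R) p : {poly R[i]} := \poly_(k < N.+1) (p`_k * expi (k%:R * s)).

Lemma horner_rotate s p x : (size p <= N.+1)%N -> (rotate s p).[x] = p.[x * expi s].
Proof.
move=> sp; rewrite horner_poly (horner_coef_wide _ sp); apply: eq_bigr => k _.
by rewrite expi_mulrn exprMn; ring.
Qed.

Lemma coef_rotate_square s p k : (size p <= N.+1)%N ->
  (rotate s p * crecip N (rotate s p))`_k = (p * crecip N p)`_k * expi (freq R N k * s).
Proof.
move=> sp; pose g := p * crecip N p.
have sr : (size (rotate s p) <= N.+1)%N by exact: size_poly.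
suff -> : rotate s p * crecip N (rotate s p) =
    \poly_(k < (N + N).+1) (g`_k * expi (freq R N k * s)).
  rewrite coef_poly; case: ltnP => // k2.
  by rewrite nth_default ?mul0r // (leq_trans (size_mul_crecip sp)).
apply: poly_eq_nonzero => x x0; rewrite hornerM horner_crecip // !horner_rotate // horner_poly.
have e0 := expi_neq0 s.
have xe0 : x * expi s != 0 by rewrite mulf_neq0.
have := horner_crecip sp xe0.
rewrite invfM rmorphM /= -[(expi s)^-1]expiN conj_expi opprK => H.
have -> : x ^+ N * (p.[(x^-1)^*%R * expi s])^*%R = expi (- (N%:R * s)) * (crecip N p).[x * expi s].
  rewrite H exprMn expiN expi_mulrn; have := expf_neq0 N e0.
  by move: (_ ^+ N) (expi s ^+ N) (_^*%R) => u v w v0; field.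
rewrite mulrCA -hornerM -/g (horner_coef_wide _ (size_mul_crecip sp)) mulr_sumr.
apply: eq_bigr => k' _; rewrite /freq mulrBl expiD expi_mulrn exprMn; ring.
Qed.

Lemma mass_rotate s p : (size p <= N.+1)%N -> mass N (rotate s p) = mass N p.
Proof.
move=> sp; rewrite /mass coef_rotate_square // /freq subrr mul0r expi0.
by rewrite mulr1.
Qed.

(** |p|^2 is translated by s. The zero-frequency part of [prim] is t and not t + s, whence the
    correction, which cancels in differences. *)
Lemma prim_rotate s p t : (size p <= N.+1)%N ->
  prim N (rotate s p * crecip N (rotate s p)) t =
  prim N (p * crecip N p) (t + s) - s%:C * (p * crecip N p)`_N.
Proof.
move=> sp; have NN : (N < (N + N).+1)%N by lia.
set g := p * crecip N p.
have -> : s%:C * g`_N = \sum_(k < (N + N).+1) (if k == N :> nat then s%:C * g`_N else 0).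
  rewrite (bigD1 (Ordinal NN)) //= eqxx big1 ?addr0 // => j.
  by rewrite -val_eqE /= => /negPf ->.
rewrite -sumrB; apply: eq_bigr => k _; rewrite coef_rotate_square // -/g /prim_coef.
case: eqP => [->|_].
  by rewrite /freq subrr mul0r expi0 rmorphD; ring.
by rewrite subr0 mulrDr expiD; ring.
Qed.

Definition arc_config (a b : R) (i : nat) : R := if i == 0 then a else b.

Lemma functional_arc a b L g :
  functional N 2 (arc_config a b) L g = prim N g b - prim N g a - L%:C * g`_N.
Proof.
rewrite /functional !big_ord_recr big_ord0 /= add0r /arc_config /=.
by rewrite expr1 expr2 mulrNN !mul1r mulN1r [- _ + _]addrC.
Qed.

Lemma functional_arc_rotate a b s L p : (size p <= N.+1)%N ->
  functional N 2 (arc_config a b) L (rotate s p * crecip N (rotate s p)) =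
  functional N 2 (arc_config (a + s) (b + s)) L (p * crecip N p).
Proof.
move=> sp; rewrite !functional_arc !prim_rotate // coef_rotate_square //.
by rewrite /freq subrr mul0r expi0; ring.
Qed.

Lemma functional2E (c : nat -> R) L g :
  functional N 2 c L g = functional N 2 (arc_config (c 0%N) (c 1%N)) L g.
Proof. by rewrite /functional !big_ord_recr !big_ord0. Qed.

Lemma alternating2E (c : nat -> R) : alternating 2 c = c 1%N - c 0%N.
Proof. by rewrite /alternating !big_ord_recr big_ord0 /=; ring. Qed.

(* The best concentration on arcs of length b - a is attained on the arc [a, b] itself. *)
Lemma maximal_arc_kernel (a b : R) : a <= b -> b <= a + 2 * pi ->
  exists M p, [/\ p != 0, (size p <= N.+1)%N,
    forall q, (size q <= N.+1)%N -> functional N 2 (arc_config a b) M (p * q) = 0 &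
    forall (c : nat -> R) q, alternating 2 c = b - a -> (size q <= N.+1)%N ->
      functional N 2 c M (q * crecip N q) <= 0].
Proof.
move=> ab ba.
have cfg1 (c : nat -> R) : alternating 2 c = b - a -> config (2 * 1) c.
  rewrite alternating2E => cE; split=> [[|i] //= _|/=]; lra.
have alt1 : alternating (2 * 1) (arc_config a b) = b - a by rewrite alternating2E.
have sz1 : (size (1 : {poly R[i]})%R <= N.+1)%N by rewrite size_poly1.
have [c [p [cfg al sp mp pmax]]] :=
  @exists_maximal_configuration R N 1 (b - a) _ 1 isT (cfg1 _ alt1) alt1 sz1 (oner_neq0 _).
pose M := complex.Re (functional N 2 c 0 (p * crecip N p)).
(* The maximiser belongs to some arc of length b - a; rotating by c 0 - a carries it to [a, b]. *)
pose p' := rotate (c 0%N - a) p.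
have sp' : (size p' <= N.+1)%N by exact: size_poly.
have le0 (c' : nat -> R) q : alternating 2 c' = b - a -> (size q <= N.+1)%N ->
    functional N 2 c' M (q * crecip N q) <= 0.
  move=> al' sq; rewrite functional_mass [X in X - _]functional_real // -rmorphB.
  rewrite -(rmorph0 (real_complex R)) lecR subr_le0.
  by apply: pmax => //; exact: cfg1.
have cb : c 1%N = b + (c 0%N - a).
  by have := al; rewrite -[(2 * 1)%N]/2%N alternating2E; lra.
have eq0 : functional N 2 (arc_config a b) M (p' * crecip N p') = 0.
  rewrite functional_arc_rotate // -cb subrKC -functional2E functional_mass mp mulr1.
  by rewrite [X in X - _]functional_real // subrr.
have [sk Jk] : in_kernel N (functional N 2 (arc_config a b) M) p'.
  apply: kernel_of_isotropic => //.
  - by move=> g h; exact: functionalD.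
  - by move=> x g; exact: functionalZ.
  - by move=> g _; exact: functional_crecip.
  - by move=> q sq; apply: le0 => //; rewrite alternating2E.
exists M, p'; split=> //.
apply/eqP => p'0; have := mass_rotate (c 0%N - a) sp; rewrite -/p' p'0 mp mass_sum big1.
  by move/eqP; rewrite eq_sym oner_eq0.
by move=> j _; rewrite coef0 /= expr0n addr0.
Qed.

End ArcConcentration.

Local Close Scope complex_scope.

(** Both sides are compared with M / (2 pi), where M is the best ratio of an arc integral of |q|^2
    to [mass N q]; the factor 2 pi relates [mass] to the L^2 norm. *)
Theorem theorem2p1 (R : realType) (N : nat) (E I : set R)
    (E_circle : circle_set E) (E_meas : lebesgue_measurable E)
    (I_arc : circle_arc I) (eq_measure : circle_measure I = circle_measure E) :
  lambda_max N E <= lambda_max N I.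
Proof.
have I_meas := circle_arc_measurable I_arc.
have [a [b [ab ba mW sW lintW]]] := size_of_arc I_arc.
have mE := window_measurable E_meas.
have bE := @window_bounded_support R E; have bI := @window_bounded_support R I.
have sE : size_of (circle_window E) = b - a.
  by rewrite -sW /size_of; congr fine; exact: esym eq_measure.
have [M [p [p0 sp pker le0]]] := maximal_arc_kernel N ab ba.
have pi0 := pi_gt0 R.
have momentI (g : {poly R[i]%C}) : (size g <= (N + N).+1)%N ->
    moment N (circle_window I) g = prim N g b - prim N g a.
  exact: moment_arc.
(* The weak eigenvalue equation is tested on the eigenvector itself, whose mass is positive. *)
have eigen_bound A l : lebesgue_measurable A ->
    (forall q : {poly R[i]%C}, (size q <= N.+1)%N ->
       complex.Re (moment N (circle_window A) (q * crecip N q)) <= M * mass N q) ->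
    is_eigenvalue N (T_ N A) l%:C%C -> l <= M / (2 * pi).
  move=> mA bnd /(eigenvalueP _ _ mA)[q [q0 sq qE]].
  have mq : 0 < mass N q.
    by rewrite lt_def mass_ge0 andbT; apply: contraNneq q0 => /(mass_eq0 sq) ->.
  have := bnd q sq; rewrite qE // massE -rmorphM /= ler_pM2r //.
  by rewrite ler_pdivlMr ?mulr_gt0 // mulrC.
have boundI (q : {poly R[i]%C}) : (size q <= N.+1)%N ->
    complex.Re (moment N (circle_window I) (q * crecip N q)) <= M * mass N q.
  move=> sq; rewrite momentI ?size_mul_crecip //.
  have := le0 (arc_config a b) q; rewrite alternating2E => /(_ erefl sq).
  by rewrite functional_arc massE -rmorphM subr_le0 lecE => /andP[_].
have boundE (q : {poly R[i]%C}) : (size q <= N.+1)%N ->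
    complex.Re (moment N (circle_window E) (q * crecip N q)) <= M * mass N q.
  move=> sq; have sqq := size_mul_crecip sq.
  have [K K0 qK] := lau_lipschitz_antiderivative sqq.
  rewrite Re_moment; apply: (lint_le_of_configurations qK K0) => //.
  - exact: ctame_Re (ctame_lau sqq).
  - by move=> t [].
  move=> m c cfg; rewrite sE => al.
  have := configuration_bound le0 cfg al sq.
  rewrite /functional massE -rmorphM subr_le0 lecE => /andP[_].
  rewrite raddf_sum; congr (_ <= _); apply: eq_bigr => i _.
  rewrite -(rmorphN1 (real_complex R)) -rmorphXn.
  by case: (prim _ _ _) => x y /=; rewrite mul0r subr0.
have M0 : 0 <= M.
  have mp : 0 < mass N p.
    by rewrite lt_def mass_ge0 andbT; apply: contraNneq p0 => /(mass_eq0 sp) ->.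
  rewrite -(pmulr_lge0 M mp); apply: le_trans (boundI p sp).
  rewrite Re_moment; apply: Rintegral_ge0 => t _.
  by rewrite -trig_funM_conj // -normCK rnormE -rmorphXn; exact: sqr_ge0.
(* The kernel element of the arc satisfies the weak eigenvalue equation with eigenvalue M / (2
   pi). *)
have MI : M / (2 * pi) <= lambda_max N I.
  apply: ub_le_sup.
    by exists (M / (2 * pi)) => l /= /eigen_bound; apply.
  apply/(eigenvalueP _ _ I_meas); exists p; split=> // q sq.
  rewrite momentI ?size_polyM_leS ?size_crecip //.
  have := pker (crecip N q) (size_crecip _ _); rewrite functional_arc => /eqP.
  rewrite subr_eq0 => /eqP ->; congr (real_complex _ _ * _).
  by rewrite mulrC divfK // gt_eqF // mulr_gt0.
apply: le_trans MI; rewrite /lambda_max.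
set S := (X in sup X).
(* An empty set would have [sup] 0 by default, a value that [M0] keeps below the bound. *)
have [[l Sl]|S0] := pselect (exists l, S l); last first.
  have -> : S = (set0)%classic.
    by apply/seteqP; split=> // l Sl; apply: S0; exists l.
  by rewrite sup0 divr_ge0 // mulr_ge0 // ltW.
apply: ge_sup; first by exists l.
by move=> l' /= /eigen_bound; apply.
Qed.
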